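(* Let $\mathbf{k}=(k_1,k_2,\dots)$ be an infinite sequence of non-negative integers and $n\geq1$. For any partition $\lambda\vdash k_1+\dots+k_n$, set $W_{\mathbf{k},\lambda}:=P_{\mathbf{k},n}(V_{\lambda})$. Then: 1. The space $W_{\mathbf{k},\lambda}$ is spanned by the vectors $w_{\boldsymbol{T}}$, where $\boldsymbol{T}\in\mathrm{SSTab}(\lambda,\mathbf{k}_{|n})$. 2. A complete set of pairwise non-isomorphic irreducible (non-zero) representations of $H_{\mathbf{k},n}(q)$ is $\{W_{\mathbf{k},\lambda}\}_{\lambda\in S_{\mathbf{k},n}}$ with $S_{\mathbf{k},n}:=\{\lambda\vdash k_1+\dots+k_n\mid \lambda\geq\mathbf{k}^{\mathrm{ord}}_{|n}\}$. The dimension of $W_{\mathbf{k},\lambda}$ is the Kostka number $K_{\lambda,\mathbf{k}_{|n}}=|\mathrm{SSTab}(\lambda,\mathbf{k}_{|n})|$. 3. For $\lambda\in S_{\mathbf{k},n}$, the restriction of $W_{\mathbf{k},\lambda}$ to $H_{\mathbf{k},n-1}(q)$ decomposes as $$\mathrm{Res}_{H_{\mathbf{k},n-1}(q)}(W_{\mathbf{k},\lambda})\cong\bigoplus_{\mu\in\mathrm{Res}_{\mathbf{k}}(\lambda)}W_{\mathbf{k},\mu},$$ where $\mathrm{Res}_{\mathbf{k}}(\lambda):=\{\mu\in S_{\mathbf{k},n-1}\mid \mu\subset\lambda$ and $\lambda/\mu$ contains at most one box in each column$\}$.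
   Context: $q\in\mathbb{C}^{\times}$ with $q^2$ not a non-trivial root of unity ($q^2=1$ allowed). $H_m(q)$ is the $\mathbb{C}$-algebra generated by $\sigma_1,\dots,\sigma_{m-1}$ with relations $\sigma_i^2=(q-q^{-1})\sigma_i+1$, $\sigma_i\sigma_{i+1}\sigma_i=\sigma_{i+1}\sigma_i\sigma_{i+1}$, $\sigma_i\sigma_j=\sigma_j\sigma_i$ if $|i-j|>1$ ($H_0(q)=\mathbb{C}$); for $w\in\mathfrak{S}_m$ with reduced expression $w=s_{a_1}\cdots s_{a_r}$, $\sigma_w=\sigma_{a_1}\cdots\sigma_{a_r}$. The $q$-symmetriser is $P_m=\bigl(\sum_{w\in\mathfrak{S}_m}q^{\ell(w)}\sigma_w\bigr)/\bigl(\sum_{w\in\mathfrak{S}_m}q^{2\ell(w)}\bigr)$. The idempotent $P_{\mathbf{k},n}:=P_{k_1}\otimes\dots\otimes P_{k_n}$ lies in the parabolic subalgebra $H_{k_1}(q)\otimes\dots\otimes H_{k_n}(q)\subset H_{k_1+\dots+k_n}(q)$ (first factor generated by $\sigma_1,\dots,\sigma_{k_1-1}$, second by $\sigma_{k_1+1},\dots,\sigma_{k_1+k_2-1}$, etc.). The fused Hecke algebra $H_{\mathbf{k},n}(q)$ is identified throughout with the algebra $P_{\mathbf{k},n}H_{k_1+\dots+k_n}(q)P_{\mathbf{k},n}$ with unit $P_{\mathbf{k},n}$ (it is defined in the paper by diagrams, ''fused braids'', with $k_a$ strands attached to the $a$-th top and bottom ellipses, and is isomorphic to this algebra by replacing each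 ellipse by a $q$-symmetriser). $H_{\mathbf{k},0}(q)=\mathbb{C}$. The inclusion $H_{\mathbf{k},n-1}(q)\subset H_{\mathbf{k},n}(q)$ is $P_{\mathbf{k},n-1}xP_{\mathbf{k},n-1}\mapsto P_{\mathbf{k},n}xP_{\mathbf{k},n}=P_{\mathbf{k},n-1}xP_{\mathbf{k},n-1}\otimes P_{k_n}$. If $V$ is an $H_{k_1+\dots+k_n}(q)$-module, $P_{\mathbf{k},n}(V)$ is an $H_{\mathbf{k},n}(q)$-module by restriction. Tableaux. Boxes of a Young diagram are pairs $(x,y)$ (row $x$, column $y$), with classical content $\mathrm{cc}(x,y)=y-x$. $\mathrm{STab}(\lambda)$ is the set of standard Young tableaux of shape $\lambda$ (bijective filling with $1,\dots,|\lambda|$ increasing along rows and down columns). A Young tableau is semistandard if its entries are weakly increasing along rows and strictly increasing down columns; it has weight $\nu=(\nu_1,\nu_2,\dots)$ if $a$ appears $\nu_a$ times. $\mathrm{SSTab}(\lambda,\nu)$ is the set of semistandard tableaux of shape $\lambda$ and weight $\nu$. $\mathbf{k}_{|n}:=(k_1,\dots,k_n)$ and $\mathbf{k}^{\mathrm{ord}}_{|n}$ is the partition obtained by reordering $k_1,\dots,k_n$ decreasingly. For partitions of the same size, $\lambda\ge\mu$ is the dominance order: $\lambda_1+\dots+\lambda_i\ge\mu_1+\dots+\mu_i$ for all $i$. $V_\lambda$ (for $\lambda\vdash m$) is the irreducible representation of $H_m(q)$ with basis $\{v_{\boldsymbol{t}}\}_{\boldsymbol{t}\in\mathrm{STab}(\lambda)}$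 and action $$\sigma_i(v_{\boldsymbol{t}})=\frac{q^{d}}{[d]_q}v_{\boldsymbol{t}}+\frac{[d+1]_q}{[d]_q}v_{s_i(\boldsymbol{t})},\qquad d=\mathrm{cc}_{i+1}(\boldsymbol{t})-\mathrm{cc}_i(\boldsymbol{t}),$$ where $[L]_q=\frac{q^L-q^{-L}}{q-q^{-1}}$ (value by continuity if $q^2=1$), $\mathrm{cc}_j(\boldsymbol{t})$ is the classical content of the box of $\boldsymbol{t}$ containing $j$, $s_i(\boldsymbol{t})$ is obtained by exchanging $i$ and $i+1$, and $v_{\boldsymbol{t}'}:=0$ for non-standard $\boldsymbol{t}'$. For $\boldsymbol{t}\in\mathrm{STab}(\lambda)$ with $\lambda\vdash k_1+\dots+k_n$, $\overline{\boldsymbol{t}}$ is the tableau obtained from $\boldsymbol{t}$ by replacing the entries $1,\dots,k_1$ by $1$, the entries $k_1+1,\dots,k_1+k_2$ by $2$, ..., the entries $k_1+\dots+k_{n-1}+1,\dots,k_1+\dots+k_n$ by $n$. For $\boldsymbol{T}\in\mathrm{SSTab}(\lambda,\mathbf{k}_{|n})$, $w_{\boldsymbol{T}}:=\sum_{\boldsymbol{t}\in\mathrm{STab}(\lambda),\ \overline{\boldsymbol{t}}=\boldsymbol{T}}v_{\boldsymbol{t}}\in V_\lambda$. By convention $S_{\mathbf{k},0}=\{\emptyset\}$. *)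

(* Defs.v *)
From HB Require Import structures.
From mathcomp Require Import all_boot all_order all_fingroup all_algebra.
From mathcomp Require Import boolp classical_sets reals.
From mathcomp Require Import complex.
From mathcomp Require Import generic_quotient.

Set Implicit Arguments.
Unset Strict Implicit.
Unset Printing Implicit Defensive.

Import GRing.Theory.
Local Open Scope ring_scope.
Local Open Scope quotient_scope.

Section Hecke.
Variables (F : fieldType) (q : F) (m : nat).

(* The index i : 'I_m.-1 is 0-based: it stands for sigma_{i+1}. *)
Inductive hterm :=
  | HScal of F
  | HGen of 'I_m.-1
  | HAdd of hterm & hterm
  | HMul of hterm & hterm.

(* The least congruence on terms making the quotient an F-algebra in which the
   Hecke relations hold. *)
Inductive heq : hterm -> hterm -> Prop :=
  | heq_refl x : heq x x
  | heq_sym x y : heq x y -> heq y x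
  | heq_trans x y z : heq x y -> heq y z -> heq x z
  | heq_add x x' y y' : heq x x' -> heq y y' -> heq (HAdd x y) (HAdd x' y')
  | heq_mul x x' y y' : heq x x' -> heq y y' -> heq (HMul x y) (HMul x' y')
  | heq_addA x y z : heq (HAdd x (HAdd y z)) (HAdd (HAdd x y) z)
  | heq_addC x y : heq (HAdd x y) (HAdd y x)
  | heq_add0 x : heq (HAdd (HScal 0) x) x
  | heq_mulA x y z : heq (HMul x (HMul y z)) (HMul (HMul x y) z)
  | heq_mul1 x : heq (HMul (HScal 1) x) x
  | heq_mul0 x : heq (HMul (HScal 0) x) (HScal 0)
  | heq_mulDl x y z : heq (HMul (HAdd x y) z) (HAdd (HMul x z) (HMul y z))
  | heq_mulDr x y z : heq (HMul x (HAdd y z)) (HAdd (HMul x y) (HMul x z))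
  | heq_scalD a b : heq (HScal (a + b)) (HAdd (HScal a) (HScal b))
  | heq_scalM a b : heq (HScal (a * b)) (HMul (HScal a) (HScal b))
  | heq_scalC a x : heq (HMul (HScal a) x) (HMul x (HScal a))
  | heq_quad i :
      heq (HMul (HGen i) (HGen i))
          (HAdd (HMul (HScal (q - q^-1)) (HGen i)) (HScal 1))
  | heq_braid (i j : 'I_m.-1) : j = i.+1 :> nat ->
      heq (HMul (HMul (HGen i) (HGen j)) (HGen i))
          (HMul (HMul (HGen j) (HGen i)) (HGen j))
  | heq_comm (i j : 'I_m.-1) : (i.+1 < j)%N || (j.+1 < i)%N ->
      heq (HMul (HGen i) (HGen j)) (HMul (HGen j) (HGen i)).

Section Eval.
Variables (A : algType F) (f : 'I_m.-1 -> A).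

Fixpoint heval (x : hterm) : A :=
  match x with
  | HScal a => a%:A
  | HGen i => f i
  | HAdd x y => heval x + heval y
  | HMul x y => heval x * heval y
  end.

Definition hecke_rel : Prop :=
  [/\ forall i, f i * f i = (q - q^-1) *: f i + 1,
      forall i j : 'I_m.-1, j = i.+1 :> nat -> f i * f j * f i = f j * f i * f j
    & forall i j : 'I_m.-1, (i.+1 < j)%N || (j.+1 < i)%N -> f i * f j = f j * f i].

Lemma heval_heq : hecke_rel -> forall x y, heq x y -> heval x = heval y.
Proof.
move=> [fq fb fc] x y; elim=> {x y} /=.
- by [].
- by move=> x y _ ->.
- by move=> x y z _ -> _ ->.
- by move=> x x' y y' _ -> _ ->.
- by move=> x x' y y' _ -> _ ->.
- by move=> x y z; rewrite addrA.
- by move=> x y; rewrite addrC.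
- by move=> x; rewrite scale0r add0r.
- by move=> x y z; rewrite mulrA.
- by move=> x; rewrite scale1r mul1r.
- by move=> x; rewrite scale0r mul0r.
- by move=> x y z; rewrite mulrDl.
- by move=> x y z; rewrite mulrDr.
- by move=> a b; rewrite scalerDl.
- by move=> a b; rewrite -scalerAl mul1r scalerA.
- by move=> a x; rewrite -scalerAl -scalerAr mul1r mulr1.
- by move=> i; rewrite fq scale1r -scalerAl mul1r.
- exact: fb.
- exact: fc.
Qed.

End Eval.

Section EvalAct.
Variables (V : lmodType F) (f : 'I_m.-1 -> V -> V).

Fixpoint heval_act (x : hterm) (v : V) : V :=
  match x with
  | HScal a => a *: v
  | HGen i => f i v
  | HAdd x y => heval_act x v + heval_act y v
  | HMul x y => heval_act x (heval_act y v)
  end.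

Definition hecke_act_rel : Prop :=
  [/\ forall i, linear (f i),
      forall i v, f i (f i v) = (q - q^-1) *: f i v + v,
      forall (i j : 'I_m.-1) v, j = i.+1 :> nat ->
        f i (f j (f i v)) = f j (f i (f j v))
    & forall (i j : 'I_m.-1) v, (i.+1 < j)%N || (j.+1 < i)%N ->
        f i (f j v) = f j (f i v)].

Lemma heval_act_linear : hecke_act_rel -> forall x, linear (heval_act x).
Proof.
case=> fl _ _ _; elim=> [a|i|x IHx y IHy|x IHx y IHy] c u v /=.
- by rewrite scalerDr !scalerA mulrC.
- exact: fl.
- by rewrite IHx IHy scalerDr addrACA.
- by rewrite IHy IHx.
Qed.

Lemma heval_act_heq : hecke_act_rel ->
  forall x y, heq x y -> heval_act x =1 heval_act y.
Proof.
move=> fH; have L := heval_act_linear fH; case: fH => [_ fq fb fc] x y.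
have D z u v : heval_act z (u + v) = heval_act z u + heval_act z v.
  by rewrite -[u]scale1r L !scale1r.
have Z z a v : heval_act z (a *: v) = a *: heval_act z v.
  have z0 : heval_act z 0 = 0 by apply: (addIr (heval_act z 0)); rewrite -D !add0r.
  by rewrite -[a *: v]addr0 L z0 addr0.
elim=> {x y} /=.
- by [].
- by move=> x y _ IH v; rewrite IH.
- by move=> x y z _ IH1 _ IH2 v; rewrite IH1 IH2.
- by move=> x x' y y' _ IH1 _ IH2 v; rewrite /= IH1 IH2.
- by move=> x x' y y' _ IH1 _ IH2 v; rewrite /= IH1 IH2.
- by move=> x y z v; rewrite /= addrA.
- by move=> x y v; rewrite /= addrC.
- by move=> x v; rewrite /= scale0r add0r.
- by [].
- by move=> x v; rewrite /= scale1r.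
- by move=> x v; rewrite /= !scale0r.
- by [].
- by move=> x y z v; rewrite /= D.
- by move=> a b v; rewrite /= scalerDl.
- by move=> a b v; rewrite /= scalerA.
- by move=> a x v; rewrite /= Z.
- by move=> i v; rewrite /= fq scale1r.
- by move=> i j ij v; rewrite /= fb.
- by move=> i j ij v; rewrite /= fc.
Qed.

End EvalAct.

HB.instance Definition _ := gen_eqMixin hterm.
HB.instance Definition _ := gen_choiceMixin hterm.

Definition heqb (x y : hterm) : bool := `[< heq x y >].

Fact heqb_equiv : equiv_class_of heqb.
Proof.
split=> [x|x y|y x z].
- exact/asboolP/heq_refl.
- by apply/asboolP/asboolP; apply: heq_sym.
- by move=> /asboolP xy /asboolP yz; apply/asboolP; exact: heq_trans yz.
Qed.

Canonical heq_equiv : equiv_rel hterm := EquivRelPack heqb_equiv.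

Definition hecke := {eq_quot heq_equiv}.

HB.instance Definition _ := Choice.on hecke.
HB.instance Definition _ := EqQuotient.on hecke.

Definition hcls (x : hterm) : hecke := \pi_hecke x.

Lemma heckeW (P : hecke -> Prop) : (forall x, P (hcls x)) -> forall x, P x.
Proof. by move=> Pc x; rewrite -[x]reprK; exact: Pc. Qed.

Lemma hecke_eqP (x y : hterm) : heq x y <-> hcls x = hcls y.
Proof.
split=> [xy|/eqmodP/asboolP //].
by apply/eqmodP/asboolP.
Qed.

Lemma hrepr_pi (x : hterm) : heq (repr (hcls x)) x.
Proof. by apply/hecke_eqP; rewrite /hcls reprK. Qed.

Definition hscal (a : F) : hecke := hcls (HScal a).
Definition hgen (i : 'I_m.-1) : hecke := hcls (HGen i).
Definition hadd (x y : hecke) : hecke := hcls (HAdd (repr x) (repr y)).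
Definition hmul (x y : hecke) : hecke := hcls (HMul (repr x) (repr y)).
Definition hopp (x : hecke) : hecke := hmul (hscal (-1)) x.

Lemma hadd_pi x y : hadd (hcls x) (hcls y) = hcls (HAdd x y).
Proof. by apply/hecke_eqP; apply: heq_add; exact: hrepr_pi. Qed.

Lemma hmul_pi x y : hmul (hcls x) (hcls y) = hcls (HMul x y).
Proof. by apply/hecke_eqP; apply: heq_mul; exact: hrepr_pi. Qed.

Let hpi := (hadd_pi, hmul_pi).

Fact haddA : associative hadd.
Proof.
by elim/heckeW=> x; elim/heckeW=> y; elim/heckeW=> z; rewrite !hpi; apply/hecke_eqP; apply: heq_addA.
Qed.

Fact haddC : commutative hadd.
Proof. by elim/heckeW=> x; elim/heckeW=> y; rewrite !hpi; apply/hecke_eqP; apply: heq_addC. Qed.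

Fact hadd0 : left_id (hscal 0) hadd.
Proof. by elim/heckeW=> x; rewrite !hpi; apply/hecke_eqP; apply: heq_add0. Qed.

Fact hmulA : associative hmul.
Proof.
by elim/heckeW=> x; elim/heckeW=> y; elim/heckeW=> z; rewrite !hpi; apply/hecke_eqP; apply: heq_mulA.
Qed.

Fact hmul1l : left_id (hscal 1) hmul.
Proof. by elim/heckeW=> x; rewrite !hpi; apply/hecke_eqP; apply: heq_mul1. Qed.

Fact hscalC a x : hmul (hscal a) x = hmul x (hscal a).
Proof. by elim/heckeW: x => x; rewrite !hpi; apply/hecke_eqP; apply: heq_scalC. Qed.

Fact hmul1r : right_id (hscal 1) hmul.
Proof. by move=> x; rewrite -hscalC hmul1l. Qed.

Fact hmulDl : left_distributive hmul hadd.
Proof.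
by elim/heckeW=> x; elim/heckeW=> y; elim/heckeW=> z; rewrite !hpi; apply/hecke_eqP; apply: heq_mulDl.
Qed.

Fact hmulDr : right_distributive hmul hadd.
Proof.
by elim/heckeW=> x; elim/heckeW=> y; elim/heckeW=> z; rewrite !hpi; apply/hecke_eqP; apply: heq_mulDr.
Qed.

Fact hscalD a b : hscal (a + b) = hadd (hscal a) (hscal b).
Proof. by rewrite !hpi; apply/hecke_eqP; apply: heq_scalD. Qed.

Fact hscalM a b : hscal (a * b) = hmul (hscal a) (hscal b).
Proof. by rewrite !hpi; apply/hecke_eqP; apply: heq_scalM. Qed.

Fact hmul0 x : hmul (hscal 0) x = hscal 0.
Proof. by elim/heckeW: x => x; rewrite !hpi; apply/hecke_eqP; apply: heq_mul0. Qed.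

Fact haddN : left_inverse (hscal 0) hopp hadd.
Proof.
by move=> x; rewrite /hopp -{2}[x]hmul1l -hmulDl -hscalD addNr hmul0.
Qed.

HB.instance Definition _ := GRing.isZmodule.Build hecke haddA haddC hadd0 haddN.

Fact hone_neq0 : hscal 1 != 0.
Proof.
pose c := if q == 0 then 1 else q.
have cH : @hecke_rel F^o (fun=> c).
  split=> // _; rewrite /c; case: (eqVneq q 0) => [->|q0].
    by rewrite invr0 subr0 scale0r add0r mulr1.
  by rewrite /GRing.scale /= mulrBl mulVf // subrK.
apply/eqP=> /hecke_eqP /(heval_heq cH)/eqP /=.
by rewrite scale1r scale0r oner_eq0.
Qed.

HB.instance Definition _ :=
  GRing.Zmodule_isNzRing.Build hecke hmulA hmul1l hmul1r hmulDl hmulDr hone_neq0.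

Definition hscale (a : F) (x : hecke) : hecke := hscal a * x.

Fact hscaleA a b x : hscale a (hscale b x) = hscale (a * b) x.
Proof. by rewrite /hscale mulrA; congr (_ * _); rewrite hscalM. Qed.

Fact hscale1 : left_id 1 hscale.
Proof. exact: hmul1l. Qed.

Fact hscaleDr : right_distributive hscale +%R.
Proof. by move=> a x y; rewrite /hscale mulrDr. Qed.

Fact hscaleDl x : {morph hscale^~ x : a b / a + b}.
Proof. by move=> a b; rewrite /hscale -mulrDl; congr (_ * _); rewrite hscalD. Qed.

HB.instance Definition _ :=
  GRing.Zmodule_isLmodule.Build F hecke hscaleA hscale1 hscaleDr hscaleDl.

Fact hscaleAl (a : F) (x y : hecke) : a *: (x * y) = a *: x * y.
Proof. exact: mulrA. Qed.

HB.instance Definition _ := GRing.LSemiModule_isLSemiAlgebra.Build F hecke hscaleAl.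

Fact hscaleAr (a : F) (x y : hecke) : a *: (x * y) = x * (a *: y).
Proof.
rewrite /GRing.scale /= /hscale !mulrA; congr (_ * _); exact: hscalC.
Qed.

HB.instance Definition _ := GRing.LSemiAlgebra_isSemiAlgebra.Build F hecke hscaleAr.

(* 0 when i is not a valid 0-based index. *)
Definition hgen_nat (i : nat) : hecke := oapp hgen 0 (insub i).

Lemma haddE (x y : hecke) : x + y = hcls (HAdd (repr x) (repr y)).
Proof. by []. Qed.

Lemma hmulE (x y : hecke) : x * y = hcls (HMul (repr x) (repr y)).
Proof. by []. Qed.

Lemma honeE : 1 = hcls (HScal 1) :> hecke.
Proof. by []. Qed.

Lemma hscaleE a (x : hecke) : a *: x = hcls (HMul (HScal a) (repr x)).
Proof. by apply/hecke_eqP; apply: heq_mul (heq_refl _); exact: hrepr_pi. Qed.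

(* The algebra morphism sending the i-th generator to f i, when f satisfies
   hecke_rel (see hliftP); the value on x is computed on an arbitrary term
   representing x. *)
Definition hlift (A : algType F) (f : 'I_m.-1 -> A) (x : hecke) : A :=
  heval f (repr x).

Lemma hliftP (A : algType F) (f : 'I_m.-1 -> A) : hecke_rel f ->
  [/\ forall i, hlift f (hgen i) = f i,
      linear (hlift f),
      hlift f 1 = 1
    & forall x y, hlift f (x * y) = hlift f x * hlift f y].
Proof.
move=> fH; have E x : hlift f (hcls x) = heval f x.
  exact: heval_heq (hrepr_pi x).
split=> [i|a x y||x y].
- exact: E.
- rewrite haddE E /= -![heval f (repr _)]/(hlift f _) hscaleE E /=.
  by rewrite -scalerAl mul1r.
- by rewrite honeE E /= scale1r.
- by rewrite hmulE E.
Qed.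

(* The H_m(q)-module structure in which the i-th generator acts by f i, when f
   satisfies hecke_act_rel (see hactP). *)
Definition hact (V : lmodType F) (f : 'I_m.-1 -> V -> V) (x : hecke) : V -> V :=
  heval_act f (repr x).

Lemma hactP (V : lmodType F) (f : 'I_m.-1 -> V -> V) : hecke_act_rel f ->
  [/\ forall i, hact f (hgen i) =1 f i,
      forall x, linear (hact f x),
      forall a x y v, hact f (a *: x + y) v = a *: hact f x v + hact f y v,
      hact f 1 =1 id
    & forall x y v, hact f (x * y) v = hact f x (hact f y v)].
Proof.
move=> fH; have E x : hact f (hcls x) =1 heval_act f x.
  exact: heval_act_heq (hrepr_pi x).
split=> [i v|x|a x y v|v|x y v].
- exact: E.
- exact: heval_act_linear.
- by rewrite haddE E /= -![heval_act f (repr _) v]/(hact f _ v) hscaleE E.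
- by rewrite honeE E /= scale1r.
- by rewrite hmulE E.
Qed.

Lemma hgen_rel : hecke_rel hgen.
Proof.
split=> [i|i j ij|i j ij].
- rewrite hscaleE honeE /hgen -[_ * _]/(hmul _ _) -[_ + _]/(hadd _ _) !hpi.
  apply/hecke_eqP; apply: heq_trans (heq_quad i) _; apply: heq_add (heq_refl _).
  by apply: heq_mul (heq_refl _) (heq_sym (hrepr_pi _)).
- by rewrite /hgen -![_ * _]/(hmul _ _) !hpi; apply/hecke_eqP; exact: heq_braid.
- by rewrite /hgen -![_ * _]/(hmul _ _) !hpi; apply/hecke_eqP; exact: heq_comm.
Qed.

Definition lo (i : 'I_m.-1) : 'I_m := widen_ord (leq_pred m) i.

Fact hi_subproof (i : 'I_m.-1) : (i.+1 < m)%N.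
Proof. by rewrite -ltn_predRL. Qed.

Definition hi (i : 'I_m.-1) : 'I_m := Ordinal (hi_subproof i).

Definition word_perm (s : seq 'I_m.-1) : 'S_m :=
  (\prod_(i <- s) tperm (lo i) (hi i))%g.

Definition reduced (w : 'S_m) (s : seq 'I_m.-1) : Prop :=
  word_perm s = w /\ forall s', word_perm s' = w -> (size s <= size s')%N.

Definition red_word (w : 'S_m) : seq 'I_m.-1 := xget [::] (reduced w).

Definition ell (w : 'S_m) : nat := size (red_word w).

Definition hsig (w : 'S_m) : hecke := \prod_(i <- red_word w) hgen i.

Definition qsym : hecke :=
  (\sum_(w : 'S_m) q ^+ (2 * ell w))^-1 *: \sum_(w : 'S_m) q ^+ ell w *: hsig w.

End Hecke.

Arguments hgen {F} q {m} i.
Arguments hgen_nat {F} q m i.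

Section Fused.
Variables (F : fieldType) (q : F) (k : nat -> nat).

(* H_m -> H_m', sigma_i |-> sigma_{i+j}, for j + m <= m'. *)
Definition hshift (m m' j : nat) : hecke q m -> hecke q m' :=
  hlift (fun i : 'I_m.-1 => hgen_nat q m' (j + i)).

(* k a, for a = 0, 1, ..., stands for k_{a+1}; psum a = k_1 + ... + k_a. *)
Definition psum (a : nat) : nat := \sum_(i < a) k i.

Definition fidem (n : nat) : hecke q (psum n) :=
  \prod_(a < n) hshift (psum n) (psum a) (qsym q (k a)).

Definition fincl (n' n : nat) (x : hecke q (psum n')) : hecke q (psum n) :=
  fidem n * hshift (psum n) 0 x * fidem n.

End Fused.

Arguments fincl {F q} k n' n x.

Section CornerRep.
Variables (F : fieldType) (A : algType F) (e : A).

Definition corner : set A := [set x | exists y, x = e * y * e].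

(* A representation of the algebra e A e, whose unit is e; act is only
   relevant on corner. *)
Definition is_rep (V : lmodType F) (act : A -> V -> V) : Prop :=
  [/\ forall x, corner x -> linear (act x),
      forall a x y v, corner x -> corner y ->
        act (a *: x + y) v = a *: act x v + act y v,
      forall x y v, corner x -> corner y -> act (x * y) v = act x (act y v)
    & forall v, act e v = v].

Definition is_subrep (V : lmodType F) (act : A -> V -> V) (S : set V) : Prop :=
  [/\ S 0, forall a u v, S u -> S v -> S (a *: u + v)
    & forall x v, corner x -> S v -> S (act x v)].

Definition irreducible_rep (V : lmodType F) (act : A -> V -> V) : Prop :=
  [/\ is_rep act, exists v : V, v != 0
    & forall S, is_subrep act S -> S = [set 0]%classic \/ S = setT].

Definition equivariant (V U : lmodType F) (actV : A -> V -> V)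
    (actU : A -> U -> U) (f : V -> U) : Prop :=
  linear f /\ forall x v, corner x -> f (actV x v) = actU x (f v).

Definition iso_rep (V U : lmodType F) (actV : A -> V -> V)
    (actU : A -> U -> U) : Prop :=
  exists2 f : V -> U, equivariant actV actU f & bijective f.

(* Isomorphism with a finite external direct sum, realised as the product of
   the summands with the componentwise structure. *)
Definition iso_dsum (V : lmodType F) (actV : A -> V -> V) (I : finType)
    (U : I -> lmodType F) (actU : forall i, A -> U i -> U i) : Prop :=
  exists2 f : forall i, V -> U i, forall i, equivariant actV (actU i) (f i)
    & bijective (fun v : V => (fun i => f i v) : forall i, U i).

Definition complete_irreps (I : Type) (U : I -> lmodType F)
    (actU : forall i, A -> U i -> U i) : Prop :=
  [/\ forall i, irreducible_rep (actU i),
      forall i j, iso_rep (actU i) (actU j) -> i = j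
    & forall (V : lmodType F) (actV : A -> V -> V), irreducible_rep actV ->
        exists i, iso_rep actV (actU i)].

End CornerRep.

(* A partition of m is padded by zeros to length m. *)
Definition is_part (m : nat) (l : m.-tuple 'I_m.+1) : bool :=
  sorted geq [seq val i | i <- l] && (sumn [seq val i | i <- l] == m).

Definition part (m : nat) : Type := {l : m.-tuple 'I_m.+1 | is_part l}.

HB.instance Definition _ m := Finite.on (part m).

Definition parts (m : nat) (la : part m) : seq nat := [seq val i | i <- val la].

Definition prow (m : nat) (la : part m) (x : nat) : nat := nth 0%N (parts la) x.

(* Boxes are 0-based pairs (row, column). *)
Definition box (m : nat) (la : part m) : Type :=
  {b : 'I_m * 'I_m | (b.2 < prow la b.1)%N}.

HB.instance Definition _ m (la : part m) := Finite.on (box la).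

Section Tableaux.
Variables (m : nat) (la : part m).

Definition brow (b : box la) : nat := (val b).1.
Definition bcol (b : box la) : nat := (val b).2.
Definition bcc (b : box la) : int := (bcol b)%:Z - (brow b)%:Z.

(* The entry i : 'I_m stands for i + 1. *)
Definition is_std (t : {ffun box la -> 'I_m}) : bool :=
  [&& injectiveb t, [forall j, j \in codom t],
      [forall b, forall c, (brow b == brow c) && (bcol b < bcol c)%N ==> (t b < t c)%N]
    & [forall b, forall c, (bcol b == bcol c) && (brow b < brow c)%N ==> (t b < t c)%N]].

Definition STab : Type := {t : {ffun box la -> 'I_m} | is_std t}.

HB.instance Definition _ := Finite.on STab.

Definition is_sstd (nu : nat -> nat) (n : nat) (T : {ffun box la -> 'I_n}) : bool :=
  [&& [forall b, forall c, (brow b == brow c) && (bcol b < bcol c)%N ==> (T b <= T c)%N],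
      [forall b, forall c, (bcol b == bcol c) && (brow b < brow c)%N ==> (T b < T c)%N]
    & [forall a : 'I_n, #|[set b | T b == a]| == nu a]].

Definition SSTab (nu : nat -> nat) (n : nat) : Type :=
  {T : {ffun box la -> 'I_n} | is_sstd nu T}.

HB.instance Definition _ nu n := Finite.on (SSTab nu n).

Definition tab_cc (t : STab) (j : 'I_m) : int :=
  if [pick b | val t b == j] is Some b then bcc b else 0.

Definition tab_swap (i : 'I_m.-1) (t : STab) : {ffun box la -> 'I_m} :=
  [ffun b => tperm (lo i) (hi i) (val t b)].

(* T is the tableau obtained from t by replacing the entries of the a-th block
   of size k a by a. *)
Definition is_bar (k : nat -> nat) (n : nat) (t : STab) (T : {ffun box la -> 'I_n}) :=
  [forall b, (psum k (T b) <= val t b < psum k (T b).+1)%N].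

End Tableaux.

Section Seminormal.
Variables (F : fieldType) (q : F).

(* The q-integer; L q^(L-1) is its limit at q = 1 and q = -1. *)
Definition qint (L : int) : F :=
  if q ^+ 2 == 1 then L%:~R * q ^ (L - 1) else (q ^ L - q ^ (- L)) / (q - q^-1).

Variables (m : nat) (la : part m).

Definition Vmod : vectType F := {ffun STab la -> F^o}.

(* v_t, which is 0 when the filling t is not standard. *)
Definition vtab (t : {ffun box la -> 'I_m}) : Vmod := [ffun t' => (val t' == t)%:R].

Definition sigma_tab (i : 'I_m.-1) (t : STab la) : Vmod :=
  let d := tab_cc t (hi i) - tab_cc t (lo i) in
  (q ^ d / qint d) *: vtab (val t) + (qint (d + 1) / qint d) *: vtab (tab_swap i t).

Definition sigma_op (i : 'I_m.-1) (v : Vmod) : Vmod :=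
  \sum_(t : STab la) v t *: sigma_tab i t.

Definition Vrep : hecke q m -> Vmod -> Vmod := hact sigma_op.

End Seminormal.

Section FusedModules.
Variables (F : fieldType) (q : F) (k : nat -> nat) (n : nat).

Definition Wsp (la : part (psum k n)) : {vspace Vmod F la} :=
  limg (linfun (Vrep (fidem q k n))).

Definition Wmod (la : part (psum k n)) : lmodType F := subvs_of (Wsp la).

(* For x in the fused algebra, Vrep x maps Wsp la into itself, so that vsproj is
   just the corestriction. *)
Definition Wact (la : part (psum k n)) (x : hecke q (psum k n)) (w : Wmod la) : Wmod la :=
  vsproj (Wsp la) (Vrep x (vsval w)).

Definition wvec (la : part (psum k n)) (T : SSTab la k n) : Vmod F la :=
  \sum_(t : STab la | is_bar k t (val T)) vtab F (val t).

End FusedModules.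

Definition dominates (la mu : seq nat) : bool :=
  `[< forall i, (sumn (take i mu) <= sumn (take i la))%N >].

Definition kord (k : nat -> nat) (n : nat) : seq nat := sort geq (mkseq k n).

Definition inS (k : nat -> nat) (n : nat) (la : part (psum k n)) : bool :=
  dominates (parts la) (kord k n).

Definition Skn (k : nat -> nat) (n : nat) : Type := {la : part (psum k n) | inS la}.

(* mu is contained in la and la / mu has at most one box in each column. *)
Definition horiz_strip (m m' : nat) (la : part m) (mu : part m') : bool :=
  `[< forall x, (prow mu x <= prow la x)%N >] &&
  [forall y : 'I_m, (#|[set x : 'I_m | (prow mu x <= y < prow la x)%N]| <= 1)%N].

Definition Resk (k : nat -> nat) (n' n : nat) (la : part (psum k n)) : Type :=
  {mu : part (psum k n') | inS mu && horiz_strip la mu}.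

HB.instance Definition _ k n' n (la : part (psum k n)) := Finite.on (Resk n' la).

(* Main.v *)
Require Import Defs.
From HB Require Import structures.
From mathcomp Require Import all_boot all_order all_fingroup all_algebra.
From mathcomp Require Import zify ring.
From mathcomp Require Import boolp classical_sets functions reals complex.

Set Implicit Arguments.
Unset Strict Implicit.
Unset Printing Implicit Defensive.

Import Order.TTheory GRing.Theory Num.Theory.
Local Open Scope ring_scope.

(** The Hecke algebra [H] is the direct product of the endomorphism algebras of
    the modules [V_la]. Once this is known, everything follows from a general
    fact on corners: for an idempotent [e] of a product of matrix algebras, the
    simple modules of [e H e] are the nonzero images [e V_la], and they are
    pairwise non-isomorphic ([corner_complete_irreps]).

    A standard tableau is encoded by its Yamanouchi word, the sequence of the
    rows of its entries ([rw]); extending, restricting and exchanging entries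
    become operations on sequences. The Hecke relations hold in the seminormal
    form because the diagonal coefficients [gcoef] satisfy an addition law
    ([gcoefD]) and because the off-diagonal ones vanish as soon as an exchange
    leaves the set of standard tableaux ([sigma_act_rel]). The Jucys-Murphy
    elements act diagonally, by functions of the contents; since the contents
    determine a tableau, polynomials in them isolate every single basis vector,
    and the generators link the basis vectors of a given shape, because sorting
    by columns leads from any two of them to the same tableau. Hence [H] contains all
    matrix units ([mx_unitP]). They are as many as the pairs of standard tableaux
    of the same shape, that is [m`!] ([size_same_shape_pairs], by the up-down
    relation in Young's lattice), while Matsumoto's theorem ([hprod_reduced])
    shows that [H] is spanned by [m`!] elements; so they form a basis, and [H]
    acts faithfully on the sum of the [V_la] ([hecke_faithful]).

    The idempotent [fidem] projects onto the vectors on which every generator of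
    the parabolic subalgebra acts by [q] ([fidem_fixP], [mem_Wsp]). In the
    seminormal basis this eigenvector condition says that the coefficients do not
    change when two entries of the same block are exchanged, and vanish when two
    such entries are consecutive in a column. Sorting each block by columns shows
    that an eigenvector is determined by its coefficients on the tableaux whose
    columns increase strictly in each block ([Wsp_determined]). These canonical
    tableaux are the standardisations of the semistandard tableaux, and the
    vectors [wvec] take the value 1 on one of them and 0 on the others: they form a basis of
    the image. Canonical tableaux exist exactly for the shapes dominating the
    sorted weight ([inS_canonical]), by removing one horizontal strip after the
    other.

    Cutting a canonical tableau at the beginning of the last block leaves a
    canonical tableau and a horizontal strip, filled from left to right in the
    only possible way. Restricting coefficient functions to the tableaux that end
    with this strip commutes with the smaller Hecke algebra and gives the
    branching rule ([restriction_decomposes]). *)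

(** * Quantum integers *)

Section Scalars.
Variables (F : fieldType) (q : F).
Hypothesis q_neq0 : q != 0.
Hypothesis qint_neq0 : forall L : int, L != 0 -> qint q L != 0.

Let kappa : F := q - q^-1.

(** The eigenvalue of a Jucys-Murphy element at an entry of content [c]. Unlike
    [q ^ (2 * c)], it still separates the contents when [q ^+ 2 = 1]. *)
Definition jmval (c : int) : F := q ^ c * qint q c.

Definition gcoef (d : int) : F := q ^ d / qint q d.

(** The off-diagonal coefficient of the seminormal form. It is set to 0 when the
    two entries are in adjacent boxes, so that the value of a function at
    the word obtained by exchanging them, which labels no tableau, is ignored. *)
Definition ucoef (d : int) : F :=
  if (d == 1) || (d == -1) then 0 else gcoef (- d) + q^-1.

Let sq1 : q ^+ 2 = 1 -> q^-1 = q.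
Proof. by move=> h; rewrite -[LHS]mulr1 -h expr2 mulKf. Qed.

Let exz2 (c : int) : q ^+ 2 = 1 -> q ^ c * q ^ c = 1.
Proof. by move=> h; rewrite -expfzMl -expr2 h exp1rz. Qed.

Let kappa_neq0 : q ^+ 2 != 1 -> kappa != 0.
Proof.
move=> h; rewrite /kappa subr_eq0; apply: contra h => /eqP h.
by rewrite expr2 {2}h mulfV.
Qed.

Lemma jmval_kappa c : q ^ c * q ^ c = 1 + kappa * jmval c.
Proof.
rewrite /jmval /qint; case: ifPn => [/eqP h|h].
  by rewrite exz2 // /kappa sq1 // subrr mul0r addr0.
have := kappa_neq0 h; rewrite -/kappa -invr_expz => k0.
have := expfz_neq0 c q_neq0; move: (q ^ c) => x x0; field.
by rewrite k0 x0.
Qed.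

Lemma jmvalD c d : jmval (c + d) = jmval c + q ^ c * q ^ c * jmval d.
Proof.
rewrite /jmval /qint; case: ifPn => [/eqP h|h].
  have e L : q ^ L * (L%:~R * q ^ (L - 1)) = L%:~R * q.
    rewrite expfzDr // -[q ^ (-1)]/(q^-1) sq1 //.
    by transitivity (q ^ L * q ^ L * (L%:~R * q)); [ring | rewrite exz2 ?mul1r].
  by rewrite exz2 // mul1r !e intrD mulrDl.
have := kappa_neq0 h; rewrite -/kappa -!invr_expz => k0.
have := expfz_neq0 c q_neq0; have := expfz_neq0 d q_neq0.
rewrite expfzDr //; move: (q ^ c) (q ^ d) => x y y0 x0; field.
by rewrite k0 x0 y0.
Qed.

Lemma jmval0 : jmval 0 = 0.
Proof.
by rewrite /jmval /qint; case: ifP => _; rewrite ?mul0r ?oppr0 ?subrr ?mul0r mulr0.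
Qed.

Lemma qint1 : qint q 1 = 1.
Proof.
rewrite /qint; case: ifPn => [_|/kappa_neq0 h]; first by rewrite mul1r.
by rewrite -[q ^ (-1)]/(q^-1) divff.
Qed.

Lemma jmval1 : jmval 1 = q.
Proof. by rewrite /jmval qint1 mulr1. Qed.

Lemma jmval_neq0 d : d != 0 -> jmval d != 0.
Proof. by move=> d0; rewrite mulf_neq0 ?qint_neq0 // expfz_neq0. Qed.

Lemma jmval_inj : injective jmval.
Proof.
move=> c d h; apply/eqP; rewrite -subr_eq0; apply/negPn/negP => /jmval_neq0.
have := jmvalD d (c - d); rewrite addrC subrK h => /eqP.
rewrite -subr_eq0 opprD addrA subrr add0r oppr_eq0 !mulf_eq0 orbA orbb.
by rewrite (negPf (expfz_neq0 d q_neq0)) /= => ->.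
Qed.

Lemma gcoefE d : d != 0 -> gcoef d = kappa + (jmval d)^-1.
Proof.
move=> d0; have h := jmval_kappa d; have j0 := jmval_neq0 d0.
apply: (mulIf j0); rewrite mulrDl mulVf // addrC -h /gcoef /jmval.
by rewrite mulrA mulrAC divfK ?qint_neq0.
Qed.

Let jmvalN d : jmval d + (1 + kappa * jmval d) * jmval (- d) = 0.
Proof. by rewrite -jmval_kappa -jmvalD subrr jmval0. Qed.

Lemma gcoefN d : d != 0 -> gcoef (- d) = kappa - gcoef d.
Proof.
move=> d0; have d0' : - d != 0 by rewrite oppr_eq0.
rewrite !gcoefE //.
have := jmvalN d; have := jmval_neq0 d0; have := jmval_neq0 d0'.
move: (jmval d) (jmval (- d)) kappa => x y k y0 x0 h.
apply/eqP; rewrite -subr_eq0.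
have -> : k + y^-1 - (k - (k + x^-1)) = (x + (1 + k * x) * y) / (x * y).
  by field; rewrite x0 y0.
by rewrite h mul0r.
Qed.

(** The addition law of [gcoef]. The braid relation of the seminormal form is a
    formal consequence of it and of [gcoefN] and [gcoef_quad]. *)
Lemma gcoefD d e : d != 0 -> e != 0 -> d + e != 0 ->
  gcoef d * gcoef e = gcoef (d + e) * (gcoef d + gcoef e - kappa).
Proof.
move=> d0 e0 de0; rewrite !gcoefE // jmvalD jmval_kappa.
have := jmval_neq0 de0; rewrite jmvalD jmval_kappa.
have := jmval_neq0 d0; have := jmval_neq0 e0.
by move: (jmval d) (jmval e) kappa => x y k y0 x0 s0; field; rewrite s0 x0 y0.
Qed.

Lemma gcoef1 : gcoef 1 = q.
Proof. by rewrite /gcoef qint1 divr1. Qed.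

Lemma gcoefN1 : gcoef (-1) = - q^-1.
Proof. by rewrite gcoefN // gcoef1 /kappa addrC addKr. Qed.

Lemma hcoefE d : d != 0 -> qint q (d + 1) / qint q d = gcoef d + q^-1.
Proof.
move=> d0; have q1 := qint_neq0 d0; rewrite /gcoef.
apply: (mulIf q1); rewrite mulrDl !divfK //.
apply: (mulfI (expfz_neq0 (d + 1) q_neq0)).
rewrite -[LHS]/(jmval _) addrC jmvalD jmval1 [1 + d]addrC expfzDr // -[q ^ 1]/q.
have := jmval_kappa d; rewrite /jmval /kappa.
move: (q ^ d) (qint q d) => x y h; transitivity (q * (x * x) + x * y).
  by rewrite h; field.
by field.
Qed.

Lemma ucoefE d : d != 0 -> d != 1 -> d != -1 -> ucoef d = q - gcoef d.
Proof.
move=> d0 d1 dN1; rewrite /ucoef (negPf d1) (negPf dN1) gcoefN // /kappa.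
by ring.
Qed.

Lemma ucoef_neq0 d : d != 0 -> d != 1 -> d != -1 -> ucoef d != 0.
Proof.
move=> d0 d1 dN1; rewrite /ucoef (negPf d1) (negPf dN1).
have d0' : - d != 0 by rewrite oppr_eq0.
rewrite -hcoefE // mulf_neq0 ?invr_eq0 ?qint_neq0 //.
by rewrite addrC subr_eq0 eq_sym.
Qed.

Lemma ucoefM d : d != 0 ->
  ucoef d * ucoef (- d) = (gcoef d + q^-1) * (gcoef (- d) + q^-1).
Proof.
move=> d0; have E : (- d == 1) || (- d == -1) = (d == 1) || (d == -1).
  by rewrite eqr_oppLR (inj_eq oppr_inj) orbC.
rewrite /ucoef E opprK; case: ifPn => [|_]; last by rewrite mulrC.
by case/orP => /eqP ->; rewrite ?opprK gcoefN1 addNr ?mulr0 ?mul0r.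
Qed.

Lemma two_qint_neq0 : q + q^-1 != 0.
Proof.
have := @qint_neq0 2 isT; have := @hcoefE 1 isT.
by rewrite qint1 divr1 gcoef1 => ->.
Qed.

Lemma gcoef_quad d : d != 0 ->
  gcoef d * gcoef d + ucoef d * ucoef (- d) = kappa * gcoef d + 1.
Proof.
by move=> d0; rewrite ucoefM // gcoefN // /kappa; field.
Qed.

(** [jm_diag] and [jm_offdiag] are the two entries of the relation
    [J' = s J s + s] between consecutive Jucys-Murphy elements, in the basis of
    two tableaux that differ by an exchange. *)
Lemma jm_diag x y : x != y ->
  gcoef (y - x) * (jmval x * gcoef (y - x)) +
  ucoef (y - x) * (jmval y * ucoef (x - y)) + gcoef (y - x) = jmval y.
Proof.
move=> xy; have d0 : y - x != 0 by rewrite subr_eq0 eq_sym.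
have -> : ucoef (y - x) * (jmval y * ucoef (x - y)) =
  jmval y * (ucoef (y - x) * ucoef (- (y - x))) by rewrite opprB; ring.
rewrite ucoefM // gcoefN // gcoefE //.
have -> : jmval y = jmval x + (1 + kappa * jmval x) * jmval (y - x).
  by rewrite -jmval_kappa -jmvalD addrC subrK.
have := jmval_neq0 d0; move: (jmval x) (jmval (y - x)) => a b b0.
by rewrite /kappa; field; rewrite b0 q_neq0.
Qed.

Lemma jm_offdiag x y : x != y ->
  gcoef (y - x) * jmval x + gcoef (x - y) * jmval y + 1 = 0.
Proof.
move=> xy; have d0 : y - x != 0 by rewrite subr_eq0 eq_sym.
rewrite -(opprB y x) gcoefN // gcoefE //.
have -> : jmval y = jmval x + (1 + kappa * jmval x) * jmval (y - x).
  by rewrite -jmval_kappa -jmvalD addrC subrK.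
have := jmval_neq0 d0; move: (jmval x) (jmval (y - x)) => a b b0.
by rewrite /kappa; field; rewrite b0 q_neq0.
Qed.

End Scalars.

(** * Yamanouchi words *)

(** [yam w]: every prefix of [w] has the counts of a partition, so that [w]
    records the rows in which the boxes of a standard tableau are added. *)
Definition yam (w : seq nat) : bool :=
  `[< forall j r, (count_mem r.+1 (take j w) <= count_mem r (take j w))%N >].

Definition addable (w : seq nat) (r : nat) : bool :=
  (r == 0%N) || (count_mem r w < count_mem r.-1 w)%N.

(** The content of the box that the letter [a] adds after the word [u]. *)
Definition ct (u : seq nat) (a : nat) : int := (count_mem a u)%:Z - a%:Z.

Definition cont (w : seq nat) (i : nat) : int := ct (take i w) (nth 0%N w i).

Lemma yamP w : reflect
  (forall j r, (count_mem r.+1 (take j w) <= count_mem r (take j w))%N) (yam w).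
Proof. exact: asboolP. Qed.

Lemma yam_nil : yam [::].
Proof. by apply/yamP => -[|j] r. Qed.

Lemma yam_shape w r : yam w -> (count_mem r.+1 w <= count_mem r w)%N.
Proof. by move=> /yamP /(_ (size w) r); rewrite take_size. Qed.

Lemma yam_shape_le w r r' : yam w -> (r <= r')%N ->
  (count_mem r' w <= count_mem r w)%N.
Proof.
move=> yw /subnK <-; elim: (r' - r)%N => // n IH.
by rewrite addSn (leq_trans (yam_shape _ yw)).
Qed.

Lemma yam_take j w : yam w -> yam (take j w).
Proof.
move=> /yamP yw; apply/yamP => i r; case: (leqP i j) => h.
  by rewrite take_takel.
by rewrite take_taker ?(ltnW h).
Qed.

Lemma yam_prefix u v : yam (u ++ v) -> yam u.
Proof. by move=> /(@yam_take (size u)); rewrite take_size_cat. Qed.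

Lemma count_rcons (a : nat) s x :
  count_mem a (rcons s x) = (count_mem a s + (x == a))%N.
Proof. by rewrite -cats1 count_cat /= addn0. Qed.

Lemma yam_rcons w r : yam (rcons w r) = yam w && addable w r.
Proof.
apply/idP/andP => [yw|[yw aw]].
  have yw' : yam w by apply: (@yam_prefix w [:: r]); rewrite cats1.
  split=> //; rewrite /addable; case: r yw => //= r yw.
  by have := yam_shape r yw; rewrite !count_rcons eqxx /=; lia.
apply/yamP => j x; case: (leqP j (size w)) => hj.
  by rewrite -cats1 takel_cat //; move/yamP: yw.
rewrite take_oversize ?size_rcons // !count_rcons.
have := yam_shape x yw; case: (eqVneq r x.+1) aw => [->|_] /=; last lia.
by rewrite /addable /=; lia.
Qed.

Lemma perm_addable u u' r : perm_eq u u' -> addable u r = addable u' r.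
Proof. by move=> /seq.permP h; rewrite /addable !h. Qed.

Lemma perm_ct u u' r : perm_eq u u' -> ct u r = ct u' r.
Proof. by move=> /seq.permP h; rewrite /ct !h. Qed.

Lemma yam_cat_perm u u' v : perm_eq u u' -> yam u' -> yam (u ++ v) -> yam (u' ++ v).
Proof.
move=> puu yu'; elim/last_ind: v => [|v x IH]; first by rewrite !cats0.
rewrite -!rcons_cat !yam_rcons => /andP[/IH-> /=].
by rewrite (@perm_addable (u ++ v) (u' ++ v)) // perm_cat2r.
Qed.

Lemma split2 (w : seq nat) i : (i.+1 < size w)%N ->
  w = take i w ++ nth 0%N w i :: nth 0%N w i.+1 :: drop i.+2 w.
Proof.
by move=> h; rewrite -(drop_nth 0%N h) -(drop_nth 0%N (ltnW h)) cat_take_drop.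
Qed.

Lemma split2P (w : seq nat) i : (i.+1 < size w)%N ->
  exists u a b v, w = u ++ a :: b :: v /\ size u = i.
Proof.
move=> h; exists (take i w), (nth 0%N w i), (nth 0%N w i.+1), (drop i.+2 w).
by split; [exact: split2 | exact/size_takel/ltnW/ltnW].
Qed.

Lemma cont_cat u a v : cont (u ++ a :: v) (size u) = ct u a.
Proof. by rewrite /cont take_size_cat // nth_cat ltnn subnn. Qed.

Lemma cont_cat1 u a b v : cont (u ++ a :: b :: v) (size u).+1 = ct (rcons u a) b.
Proof. by rewrite -cat_rcons -(size_rcons u a) cont_cat. Qed.

Definition swp (i : nat) (w : seq nat) : seq nat :=
  take i w ++ nth 0%N w i.+1 :: nth 0%N w i :: drop i.+2 w.

Lemma swp_cat u a b v : swp (size u) (u ++ a :: b :: v) = u ++ b :: a :: v.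
Proof.
rewrite /swp take_size_cat // !nth_cat ltnn subnn ltnNge leqnSn subSnn /=.
by rewrite drop_cat ltnNge ltnW //= subSn // subSnn /= drop0.
Qed.

Lemma size_swp i w : (i.+1 < size w)%N -> size (swp i w) = size w.
Proof. by move=> h; rewrite [in RHS](split2 h) /swp !size_cat. Qed.

Lemma perm_swp i w : (i.+1 < size w)%N -> perm_eq (swp i w) w.
Proof.
move=> h; rewrite perm_sym [X in perm_eq X](split2 h) /swp perm_cat2l.
by rewrite -[_ :: _ :: _]/([:: _; _] ++ _) -[X in perm_eq _ X]/([:: _; _] ++ _)
   perm_cat2r; apply/seq.permP => p /=; rewrite addnCA.
Qed.

(** The last boxes of the rows of a shape lie on strictly decreasing diagonals.
    This keeps the denominators of the seminormal form different from 0. *)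
Lemma ct_neq u a b : yam (rcons (rcons u a) b) -> ct (rcons u a) b - ct u a != 0.
Proof.
rewrite !yam_rcons => /andP[/andP[yu au] ab].
rewrite /ct count_rcons; case: (ltngtP a b) => [h|h|->]; last lia.
- by have := yam_shape_le yu (ltnW h); lia.
- by have := yam_shape_le yu (ltnW h); lia.
Qed.

(** Two successive boxes of a diagonal are separated by the box to the right of
    the first and by the one below it, hence are filled at distance at least 3.
    The braid relation needs this for its outer two entries. *)
Lemma ct_neq2 u a b c : yam (rcons (rcons (rcons u a) b) c) ->
  ct (rcons (rcons u a) b) c - ct u a != 0.
Proof.
rewrite !yam_rcons => /andP[/andP[/andP[yu au] ab] abc]; move: ab abc.
rewrite /addable /ct !count_rcons.
case: (ltngtP a c) => [h|h|->]; last lia.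
- have := yam_shape_le yu (ltnW h); case: (eqVneq a c.-1) => [<-|]; lia.
- by have := yam_shape_le yu (ltnW h); lia.
Qed.

(** The later of two consecutive boxes can be added first unless it needs the
    earlier one, that is, unless the two are adjacent. *)
Lemma yam_swap u a b v : let d := ct (rcons u a) b - ct u a in
  yam (u ++ a :: b :: v) -> d != 1 -> d != -1 ->
  [/\ a != b, yam (u ++ b :: a :: v), ct u b = ct (rcons u a) b
    & ct (rcons u b) a = ct u a].
Proof.
move=> d yw d1 dN1.
have yab : yam (rcons (rcons u a) b).
  by apply: (@yam_prefix _ v); rewrite !cat_rcons.
have ab : a != b.
  apply: contra d1 => /eqP ab; rewrite /d /ct ab count_rcons eqxx.
  by apply/eqP; lia.
have e1 : ct u b = ct (rcons u a) b by rewrite /ct count_rcons (negPf ab) addn0.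
have e2 : ct (rcons u b) a = ct u a.
  by rewrite /ct count_rcons eq_sym (negPf ab) addn0.
split=> //.
rewrite -!cat_rcons in yw *; apply: yam_cat_perm yw.
  by rewrite -!cats1 -!catA perm_cat2l; apply/seq.permP => p /=; rewrite addnCA.
move: yab; rewrite !yam_rcons => /andP[/andP[-> aa] bb] /=.
move: aa bb d1 dN1; rewrite /d /addable /ct !count_rcons => aa bb d1 dN1.
apply/andP; split; last lia.
by move: aa bb d1 dN1; case: (eqVneq a b.-1) => [e|_]; rewrite -?e; lia.
Qed.

Lemma perm_eq_cons2 (u v : seq nat) a b :
  perm_eq (u ++ a :: b :: v) (u ++ b :: a :: v).
Proof. by rewrite perm_cat2l; apply/seq.permP => p /=; rewrite addnCA. Qed.

(** * The seminormal operators on functions of words *)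

Section SeminormalWords.
Variables (F : fieldType) (q : F).
Hypothesis q_neq0 : q != 0.
Hypothesis qint_neq0 : forall L : int, L != 0 -> qint q L != 0.
Variable m : nat.

Let kappa : F := q - q^-1.

(** The matrix of the action of a generator in the seminormal basis, all shapes
    of size [m] at once, acting on coefficient functions; on the words that
    label no tableau it is completed by the character sending the generators to
    [q], so that the Hecke relations hold for all functions. *)
Definition opw (i : nat) (f : seq nat -> F) (w : seq nat) : F :=
  if yam w && (size w == m) then
    gcoef q (cont w i.+1 - cont w i) * f w
      + ucoef q (cont w i.+1 - cont w i) * f (swp i w)
  else q * f w.

Lemma opw_cat f u a b v : let d := ct (rcons u a) b - ct u a in
  yam (u ++ a :: b :: v) -> size (u ++ a :: b :: v) = m ->
  opw (size u) f (u ++ a :: b :: v) =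
    gcoef q d * f (u ++ a :: b :: v) + ucoef q d * f (u ++ b :: a :: v).
Proof. by move=> d yw sw; rewrite /opw yw sw eqxx /= cont_cat cont_cat1 swp_cat. Qed.

Lemma opw_out i f w : ~~ (yam w && (size w == m)) -> opw i f w = q * f w.
Proof. by rewrite /opw => /negPf->. Qed.

Lemma ucoef_swap u a b v : let d := ct (rcons u a) b - ct u a in
  yam (u ++ a :: b :: v) ->
  ucoef q d = 0 \/
  [/\ a != b, yam (u ++ b :: a :: v), ct u b = ct (rcons u a) b
    & ct (rcons u b) a = ct u a].
Proof.
move=> d yw; case: (boolP ((d == 1) || (d == -1))) => h.
  by left; rewrite /ucoef h.
by right; move: h; rewrite negb_or => /andP[h1 h2]; exact: yam_swap.
Qed.

Lemma opw_quad i f w : (i.+1 < m)%N ->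
  opw i (opw i f) w = kappa * opw i f w + f w.
Proof.
move=> im; case: (boolP (yam w && (size w == m))) => [|h]; last first.
  by rewrite !opw_out // /kappa mulrBl mulKf // subrK.
case/andP=> yw /eqP sw; rewrite -sw in im.
have [u [a [b [v [Ew iu]]]]] := split2P im; rewrite {}Ew -{}iu in sw yw *.
have sw' : size (u ++ b :: a :: v) = m by rewrite -sw !size_cat.
have yab : yam (rcons (rcons u a) b).
  by apply: (@yam_prefix _ v); rewrite !cat_rcons.
have d0 := ct_neq yab.
rewrite opw_cat // [in RHS]opw_cat // opw_cat //.
have [u0|[ab yw' e1 e2]] := ucoef_swap yw.
  rewrite u0 !mul0r !addr0 mulrA.
  have := gcoef_quad q_neq0 qint_neq0 d0; rewrite u0 mul0r addr0 => ->.
  by rewrite -/kappa; ring.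
rewrite opw_cat // e1 e2 -(opprB (ct (rcons u a) b)).
have := gcoef_quad q_neq0 qint_neq0 d0; have := gcoefN q_neq0 qint_neq0 d0.
rewrite -/kappa; move: (ct (rcons u a) b - ct u a) => d -> h; move: h.
move: (gcoef q d) (ucoef q d) (ucoef q (- d)) (f (u ++ [:: a, b & v]))
  (f (u ++ [:: b, a & v])) => g x y A B h.
transitivity ((g * g + x * y) * A + x * kappa * B); first by ring.
by rewrite h; ring.
Qed.

Section Braid.
Variables u v : seq nat.

(** The hypothesis under which the braid relation is checked: it is preserved,
    up to permuting the letters and the contents, by every exchange with a
    nonzero coefficient. *)
Definition triple (a b c : nat) (A B C : int) : Prop :=
  [/\ yam (u ++ a :: b :: c :: v), size (u ++ a :: b :: c :: v) = m
    & [/\ ct u a = A, ct (rcons u a) b = B & ct (rcons (rcons u a) b) c = C]].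

Lemma triple_op1 a b c A B C f : triple a b c A B C ->
  opw (size u) f (u ++ a :: b :: c :: v) =
  gcoef q (B - A) * f (u ++ a :: b :: c :: v) +
  ucoef q (B - A) * f (u ++ b :: a :: c :: v).
Proof. by case=> yw sw [<- <- _]; exact: opw_cat. Qed.

Lemma triple_op2 a b c A B C f : triple a b c A B C ->
  opw (size u).+1 f (u ++ a :: b :: c :: v) =
  gcoef q (C - B) * f (u ++ a :: b :: c :: v) +
  ucoef q (C - B) * f (u ++ a :: c :: b :: v).
Proof.
case=> yw sw [_ <- <-]; rewrite -(size_rcons u a) -!(cat_rcons a) in yw sw *.
exact: opw_cat.
Qed.

Lemma triple_swap1 a b c A B C : triple a b c A B C ->
  ucoef q (B - A) = 0 \/ triple b a c B A C.
Proof.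
case=> yw sw [<- <- <-]; have [->|[ab yw' e1 e2]] := ucoef_swap yw; first by left.
right; split=> //; first by rewrite -sw !size_cat.
split=> //; apply: perm_ct; rewrite -!cats1 -!catA.
exact: perm_eq_cons2.
Qed.

Lemma triple_swap2 a b c A B C : triple a b c A B C ->
  ucoef q (C - B) = 0 \/ triple a c b A C B.
Proof.
case=> yw sw [<- <- <-]; rewrite -(cat_rcons a) in yw.
have [->|[ab yw' e1 e2]] := ucoef_swap yw; first by left.
by right; split; rewrite -?sw ?size_cat //; rewrite cat_rcons in yw'.
Qed.

Lemma triple_neq a b c A B C : triple a b c A B C ->
  [/\ B - A != 0, C - B != 0 & C - A != 0].
Proof.
case=> yw _ [<- <- <-].
have y3 : yam (rcons (rcons (rcons u a) b) c).
  by apply: (@yam_prefix _ v); rewrite !cat_rcons.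
have y2 : yam (rcons (rcons u a) b) by move: y3; rewrite yam_rcons => /andP[].
by split; [exact: ct_neq | exact: ct_neq | exact: ct_neq2].
Qed.

(** Only the words reached from [a], [b], [c] through nonzero coefficients enter,
    so that both sides can be computed as if all six permutations of the letters
    were allowed. *)
Lemma triple_braid a b c A B C f : triple a b c A B C ->
  let w := u ++ a :: b :: c :: v in
  opw (size u) (opw (size u).+1 (opw (size u) f)) w =
  opw (size u).+1 (opw (size u) (opw (size u).+1 f)) w.
Proof.
move=> T w; have [nBA nCB nCA] := triple_neq T.
pose ABC := f (u ++ a :: b :: c :: v); pose BAC := f (u ++ b :: a :: c :: v).
pose ACB := f (u ++ a :: c :: b :: v); pose CAB := f (u ++ c :: a :: b :: v).
pose BCA := f (u ++ b :: c :: a :: v); pose CBA := f (u ++ c :: b :: a :: v).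
pose g := gcoef q; pose y := ucoef q.
have E1 : y (B - A) * opw (size u).+1 (opw (size u) f) (u ++ b :: a :: c :: v) =
  y (B - A) * (g (C - A) * (g (A - B) * BAC + y (A - B) * ABC) +
               y (C - A) * (g (C - B) * BCA + y (C - B) * CBA)).
  have [h|T1] := triple_swap1 T; first by rewrite /y h !mul0r.
  rewrite (triple_op2 _ T1) (triple_op1 _ T1).
  have [h|T2] := triple_swap2 T1; first by rewrite /y h !mul0r.
  by rewrite (triple_op1 _ T2).
have E2 : y (C - B) * opw (size u) (opw (size u).+1 f) (u ++ a :: c :: b :: v) =
  y (C - B) * (g (C - A) * (g (B - C) * ACB + y (B - C) * ABC) +
               y (C - A) * (g (B - A) * CAB + y (B - A) * CBA)).
  have [h|T1] := triple_swap2 T; first by rewrite /y h !mul0r.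
  rewrite (triple_op1 _ T1) (triple_op2 _ T1).
  have [h|T2] := triple_swap1 T1; first by rewrite /y h !mul0r.
  by rewrite (triple_op2 _ T2).
have E3 : y (C - B) * opw (size u) f (u ++ a :: c :: b :: v) =
          y (C - B) * (g (C - A) * ACB + y (C - A) * CAB).
  have [h|T1] := triple_swap2 T; first by rewrite /y h !mul0r.
  by rewrite (triple_op1 _ T1).
have E4 : y (B - A) * opw (size u).+1 f (u ++ b :: a :: c :: v) =
          y (B - A) * (g (C - A) * BAC + y (C - A) * BCA).
  have [h|T1] := triple_swap1 T; first by rewrite /y h !mul0r.
  by rewrite (triple_op2 _ T1).
rewrite (triple_op1 _ T) E1 (triple_op2 _ T) E3 (triple_op1 _ T).
rewrite (triple_op2 _ T) E2 (triple_op1 _ T) E4 (triple_op2 _ T).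
rewrite -/ABC -/BAC -/ACB; clear E1 E2 E3 E4.
have := gcoefD q_neq0 qint_neq0 nBA nCB.
have -> : B - A + (C - B) = C - A by ring.
move=> /(_ nCA).
have := gcoef_quad q_neq0 qint_neq0 nBA; have := gcoef_quad q_neq0 qint_neq0 nCB.
have := gcoefN q_neq0 qint_neq0 nBA; have := gcoefN q_neq0 qint_neq0 nCB.
rewrite (opprB B A) (opprB C B) /g /y -/kappa => -> ->.
move: (gcoef q (B - A)) (gcoef q (C - B)) (gcoef q (C - A)) => r s t.
move: (ucoef q (B - A)) (ucoef q (C - B)) (ucoef q (C - A)) => x z p.
move: (ucoef q (A - B)) (ucoef q (B - C)) => x' z'.
move: ABC BAC ACB CAB BCA CBA => f1 f2 f3 f4 f5 f6 hz hx ht.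
(* The difference of the two sides lies in the ideal generated by the addition
   law and the two quadratic relations. *)
apply/eqP; rewrite -subr_eq0; apply/eqP.
transitivity ((r * s - t * (r + s - kappa)) * ((r - s) * f1 + x * f2 - z * f3)
  + (t * f1) * ((r * r + x * x' - (kappa * r + 1)) -
                (s * s + z * z' - (kappa * s + 1)))); first by ring.
by rewrite ht hx hz !subrr mul0r mulr0 addr0.
Qed.

End Braid.

Lemma opw_braid i f w : (i.+2 < m)%N ->
  opw i (opw i.+1 (opw i f)) w = opw i.+1 (opw i (opw i.+1 f)) w.
Proof.
move=> im; case: (boolP (yam w && (size w == m))) => [|h]; last first.
  by rewrite !opw_out.
case/andP=> yw /eqP sw; rewrite -{1}sw in im.
have [u [a [b [v [Ew iu]]]]] := split2P (ltnW im).
case: v Ew => [|c v] Ew; first by move: im; rewrite Ew size_cat /=; lia.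
rewrite Ew -iu; apply: triple_braid; split; first 1 last.
- by rewrite -Ew.
- by split.
- by rewrite -Ew.
Qed.

Lemma opw_linear i a f g w : opw i (fun x => a * f x + g x) w =
  a * opw i f w + opw i g w.
Proof. by rewrite /opw; case: ifP => _; ring. Qed.

Lemma cont_swp_lt i j w : (i < j)%N -> (j.+1 < size w)%N ->
  cont (swp j w) i = cont w i.
Proof.
move=> ij jw; rewrite /cont /swp takel_cat ?size_takel ?take_takel //; try lia.
by rewrite nth_cat size_takel ?ij ?nth_take //; lia.
Qed.

Lemma cont_swp_gt i j w : (j.+1 < i)%N -> (i < size w)%N ->
  cont (swp j w) i = cont w i.
Proof.
move=> ij iw; have jw : (j.+1 < size w)%N by exact: ltn_trans iw.
have [u [a [b [v [-> ju]]]]] := split2P jw; rewrite -ju swp_cat /cont.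
rewrite -ju in ij; rewrite !nth_cat !take_cat !ifN; try lia.
move: ij; rewrite -subn_gt0 subnS -subn1; move: (i - size u)%N => [|[|k]] // _ /=.
by apply: perm_ct; exact: perm_eq_cons2.
Qed.

Lemma swpC i j w : (i.+1 < j)%N -> (j.+1 < size w)%N ->
  swp i (swp j w) = swp j (swp i w).
Proof.
move=> ij jw; have [u [a [b [v [Ew iu]]]]] := @split2P w i ltac:(lia).
have jv : (j - i.+2 + 1 < size v)%N by move: jw; rewrite Ew size_cat /=; lia.
rewrite addn1 in jv; have [x [c [d [y [Ev xj]]]]] := split2P jv.
have e s t : swp j (u ++ s :: t :: x ++ [:: c, d & y]) =
    u ++ s :: t :: x ++ [:: d, c & y].
  have -> : j = size (u ++ [:: s, t & x]) by rewrite size_cat /=; lia.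
  have e' c' d' : u ++ s :: t :: x ++ [:: c', d' & y] =
    (u ++ [:: s, t & x]) ++ [:: c', d' & y] by rewrite -catA.
  by rewrite !e' swp_cat.
by rewrite Ew Ev e -iu !swp_cat e.
Qed.

Lemma opw_comm i j f w : (i.+1 < j)%N -> (j.+1 < m)%N ->
  opw i (opw j f) w = opw j (opw i f) w.
Proof.
move=> ij jm; case: (boolP (yam w && (size w == m))) => [|h]; last first.
  by rewrite !opw_out //; ring.
case/andP=> yw /eqP sw.
have swap l : (l.+1 < m)%N ->
    ucoef q (cont w l.+1 - cont w l) = 0 \/ yam (swp l w).
  rewrite -sw => /split2P[u [a [b [v [Ew lu]]]]]; rewrite Ew -lu swp_cat.
  rewrite cont_cat cont_cat1; rewrite Ew in yw.
  by have [|[]] := ucoef_swap yw; [left | right].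
have im : (i.+1 < m)%N by lia.
have E l g x : yam x -> size x = m -> opw l g x =
    gcoef q (cont x l.+1 - cont x l) * g x
      + ucoef q (cont x l.+1 - cont x l) * g (swp l x).
  by move=> yx sx; rewrite /opw yx sx eqxx.
have Ei : ucoef q (cont w i.+1 - cont w i) * opw j f (swp i w) =
  ucoef q (cont w i.+1 - cont w i) *
    (gcoef q (cont w j.+1 - cont w j) * f (swp i w) +
     ucoef q (cont w j.+1 - cont w j) * f (swp j (swp i w))).
  have [->|h] := swap i im; first by rewrite !mul0r.
  by rewrite E ?size_swp ?sw // !cont_swp_gt ?sw //; lia.
have Ej : ucoef q (cont w j.+1 - cont w j) * opw i f (swp j w) =
  ucoef q (cont w j.+1 - cont w j) *
    (gcoef q (cont w i.+1 - cont w i) * f (swp j w) +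
     ucoef q (cont w i.+1 - cont w i) * f (swp i (swp j w))).
  have [->|h] := swap j jm; first by rewrite !mul0r.
  by rewrite E ?size_swp ?sw // !cont_swp_lt ?sw //; lia.
rewrite E // [in RHS]E // Ei Ej E // [in RHS]E // (swpC ij) ?sw //.
by ring.
Qed.

End SeminormalWords.

(** * Standard tableaux as Yamanouchi words *)

Section PartFacts.
Variables (m : nat) (la : part m).

Lemma size_parts : size (parts la) = m.
Proof. by rewrite size_map size_tuple. Qed.

Lemma prow_out x : (m <= x)%N -> prow la x = 0%N.
Proof. by move=> h; rewrite /prow nth_default // size_parts. Qed.

Lemma prow_noninc x : (prow la x.+1 <= prow la x)%N.
Proof.
case: (ltnP x.+1 m) => h; last by rewrite prow_out.
have /andP[srt _] := valP la.
have tr : transitive geq by move=> a b c /= h1 h2; exact: leq_trans h2 h1.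
have := sorted_ltn_nth tr 0%N srt; move=> /(_ x x.+1); rewrite !inE.
by rewrite -/(parts la) size_parts h (ltnW h) => /(_ isT isT (ltnSn x)).
Qed.

Lemma prow_le x y : (x <= y)%N -> (prow la y <= prow la x)%N.
Proof.
move=> /subnK <-; elim: (y - x)%N => // d IH.
by rewrite addSn (leq_trans (prow_noninc _)).
Qed.

Lemma sum_prow : (\sum_(x < m) prow la x)%N = m.
Proof.
have /andP[_ /eqP] := valP la; rewrite -/(parts la) sumnE (big_nth 0%N) size_parts.
by rewrite big_mkord.
Qed.

Lemma prow_bound x : (prow la x <= m)%N.
Proof.
case: (ltnP x m) => h; last by rewrite prow_out.
by rewrite -[leqRHS]sum_prow (bigD1 (Ordinal h)) //= leq_addr.
Qed.

Lemma mkbox r y : (y < prow la r)%N -> {b : box la | brow b = r /\ bcol b = y}.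
Proof.
move=> h; have hr : (r < m)%N.
  by rewrite ltnNge; apply/negP => /prow_out E; rewrite E in h.
have hy : (y < m)%N := leq_trans h (prow_bound r).
by exists (exist _ (Ordinal hr, Ordinal hy) h).
Qed.

Lemma box_inj (b c : box la) : brow b = brow c -> bcol b = bcol c -> b = c.
Proof.
case: b c => [[b1 b2] hb] [[c1 c2] hc]; rewrite /brow /bcol /= => /ord_inj e1 /ord_inj e2.
by apply/val_inj; rewrite /= e1 e2.
Qed.

Lemma bcol_lt (b : box la) : (bcol b < prow la (brow b))%N.
Proof. exact: (valP b). Qed.

Lemma card_row_prefix r n : (n <= prow la r)%N ->
  #|[set b : box la | (brow b == r) && (bcol b < n)%N]| = n.
Proof.
elim: n => [|n IH] h; first by rewrite (eq_card0 (A := _)) // => b; rewrite !inE ltn0 andbF.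
have [b0 [r0 c0]] := mkbox h.
rewrite -{2}(IH (ltnW h)) -[RHS]/(0 + _)%N.
have -> : [set b : box la | (brow b == r) && (bcol b < n.+1)%N] =
  b0 |: [set b : box la | (brow b == r) && (bcol b < n)%N].
  apply/setP => b; rewrite !inE ltnS leq_eqVlt andb_orr; congr (_ || _).
  apply/andP/eqP => [[/eqP e1 /eqP e2]|->]; last by rewrite r0 c0.
  by apply: box_inj; rewrite ?r0 ?c0.
by rewrite cardsU1 !inE c0 ltnn andbF.
Qed.

End PartFacts.

Section TabWord.
Variables (m : nat) (la : part m).
Implicit Types (t : STab la) (b c : box la).

Lemma stab_inj t b c : val t b = val t c -> b = c.
Proof. by case/and4P: (valP t) => /injectiveP h _ _ _; exact: h. Qed.

Lemma stab_onto t j : (j < m)%N -> {b | val t b = j :> nat}.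
Proof.
move=> h; have [b /eqP e] : {b | val t b == Ordinal h}; last by exists b; rewrite e.
apply/sigW; case/and4P: (valP t) => _ /forallP /(_ (Ordinal h)) /codomP[b ->] _ _.
by exists b.
Qed.

Lemma stab_row t b c : brow b = brow c -> (bcol b < bcol c)%N -> (val t b < val t c)%N.
Proof.
move=> e h; case/and4P: (valP t) => _ _ /forallP /(_ b) /forallP /(_ c) + _.
by rewrite e eqxx h.
Qed.

Lemma stab_col t b c : bcol b = bcol c -> (brow b < brow c)%N -> (val t b < val t c)%N.
Proof.
move=> e h; case/and4P: (valP t) => _ _ _ /forallP /(_ b) /forallP /(_ c).
by rewrite e eqxx h.
Qed.

Lemma stab_row_ltE t b c : brow b = brow c -> (val t b < val t c)%N = (bcol b < bcol c)%N.
Proof.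
move=> e; case: (ltngtP (bcol b) (bcol c)) => h.
- by rewrite stab_row.
- by apply/negbTE; rewrite -leqNgt ltnW // stab_row.
- by rewrite (box_inj e h) ltnn.
Qed.

Lemma stab_col_ltE t b c : bcol b = bcol c -> (val t b < val t c)%N = (brow b < brow c)%N.
Proof.
move=> e; case: (ltngtP (brow b) (brow c)) => h.
- by rewrite stab_col.
- by apply/negbTE; rewrite -leqNgt ltnW // stab_col.
- by rewrite (box_inj h e) ltnn.
Qed.

Definition rowat t (j : nat) : nat :=
  if [pick b | val t b == j :> nat] is Some b then brow b else 0%N.

(** The Yamanouchi word of a standard tableau. *)
Definition rw t : seq nat := mkseq (rowat t) m.

Lemma rowat_box t b : rowat t (val t b) = brow b.
Proof.
rewrite /rowat; case: pickP => [c /eqP/val_inj/stab_inj-> //|/(_ b)].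
by rewrite eqxx.
Qed.

Lemma size_rw t : size (rw t) = m.
Proof. exact: size_mkseq. Qed.

Lemma nth_rw t b : nth 0%N (rw t) (val t b) = brow b.
Proof. by rewrite nth_mkseq // rowat_box. Qed.

Lemma count_take_rw t r j : (j <= m)%N ->
  count_mem r (take j (rw t)) = #|[set b | (brow b == r) && (val t b < j)%N]|.
Proof.
move=> h; have -> : take j (rw t) = mkseq (rowat t) j.
  by rewrite /rw /mkseq -map_take take_iota (minn_idPl h).
elim: j h => [|j IH] h.
  by rewrite (eq_card0 (A := _)) // => b; rewrite !inE ltn0 andbF.
rewrite mkseqS count_rcons (IH (ltnW h)).
have [b0 e0] := stab_onto t h; rewrite -{2}e0 rowat_box.
have inE0 b : (val t b < j.+1)%N = (b == b0) || (val t b < j)%N.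
  rewrite ltnS leq_eqVlt; congr (_ || _); rewrite -e0.
  by apply/eqP/eqP => [/val_inj/stab_inj|->].
case: eqP => e.
  have -> : [set b | (brow b == r) && (val t b < j.+1)%N] =
            b0 |: [set b | (brow b == r) && (val t b < j)%N].
    apply/setP => b; rewrite !inE inE0 andb_orr; congr (_ || _).
    by case: (eqVneq b b0) => [->|_]; rewrite ?e ?eqxx ?andbF.
  by rewrite cardsU1 !inE e0 ltnn andbF addnC.
rewrite addn0; apply: eq_card => b; rewrite !inE inE0.
by case: (eqVneq b b0) => [->|//]; rewrite (introF eqP e).
Qed.

Lemma count_rw t r : count_mem r (rw t) = prow la r.
Proof.
rewrite -[in LHS](take_size (rw t)) size_rw count_take_rw //.
rewrite -[RHS](@card_row_prefix _ la r (prow la r)) //; apply: eq_card => b.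
by rewrite !inE ltn_ord; case: (eqVneq (brow b) r) => [e|//]; rewrite -e bcol_lt.
Qed.

Lemma count_take_box t b : count_mem (brow b) (take (val t b) (rw t)) = bcol b.
Proof.
rewrite count_take_rw 1?ltnW //.
rewrite -[RHS](@card_row_prefix _ la (brow b) (bcol b)) 1?ltnW ?bcol_lt //.
by apply: eq_card => c; rewrite !inE; case: eqP => // e; rewrite stab_row_ltE.
Qed.

Lemma yam_rw t : yam (rw t).
Proof.
apply/yamP => j r; wlog h : j / (j <= m)%N.
  move=> H; case: (leqP j m) => [|h]; first exact: H.
  by have := H m (leqnn m); rewrite !take_oversize ?size_rw // ltnW.
rewrite !count_take_rw //.
pose col (b : box la) := (val b).2.
have cinj s : {in [set b | (brow b == s) && (val t b < j)%N] &, injective col}.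
  move=> b c; rewrite !inE => /andP[/eqP eb _] /andP[/eqP ec _] /(congr1 val) e.
  by apply: box_inj; rewrite ?eb ?ec.
rewrite -(card_in_imset (cinj r.+1)) -(card_in_imset (cinj r)).
apply: subset_leq_card; apply/fintype.subsetP => y /imsetP[b]; rewrite inE => /andP[/eqP eb hb] ->.
have hb' : (bcol b < prow la r)%N.
  by apply: leq_trans (bcol_lt b) _; rewrite eb prow_noninc.
have [c [ec1 ec2]] := mkbox hb'; apply/imsetP; exists c; last exact/val_inj.
by rewrite inE ec1 eqxx /=; apply: ltn_trans hb; apply: stab_col; rewrite ?ec1 ?eb.
Qed.

Lemma tab_boxP t b j : (j < m)%N ->
  (val t b = j :> nat) <->
  (nth 0%N (rw t) j = brow b /\ count_mem (brow b) (take j (rw t)) = bcol b).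
Proof.
move=> h; split=> [<-|]; first by rewrite nth_rw count_take_box.
have [c <-] := stab_onto t h; rewrite nth_rw => -[e].
by rewrite -e count_take_box => e'; rewrite (box_inj e e').
Qed.

Lemma rw_inj : injective rw.
Proof.
move=> t t' e; apply/val_inj/ffunP => b; apply/val_inj/esym.
by apply/(tab_boxP t' b (ltn_ord _)); rewrite -e nth_rw count_take_box.
Qed.

Lemma tab_cc_rw t (j : 'I_m) : tab_cc t j = cont (rw t) j.
Proof.
have [b e] := stab_onto t (ltn_ord j); rewrite /tab_cc.
case: pickP => [c /eqP ec|/(_ b)/eqP[]]; last exact/val_inj.
by rewrite /bcc /cont /ct -ec nth_rw count_take_box.
Qed.

(** The position found is the entry of the box [(r, y)] of the tableau of [w]. *)
Lemma nth_occurrence (w : seq nat) r y : (y < count_mem r w)%N ->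
  exists2 j, (j < size w)%N & nth 0%N w j = r /\ count_mem r (take j w) = y.
Proof.
elim/last_ind: w => // w x IH; rewrite count_rcons.
case: (ltnP y (count_mem r w)) => [/IH[j hj [e1 e2]] _|h1 h2].
  exists j; first by rewrite size_rcons ltnW.
  by rewrite nth_rcons hj -cats1 takel_cat ?(ltnW hj).
exists (size w); first by rewrite size_rcons.
rewrite nth_rcons ltnn eqxx -cats1 take_size_cat //; move: h2 h1.
by case: eqP => [->|]; lia.
Qed.

Definition shaped (w : seq nat) : Prop :=
  [/\ yam w, size w = m & forall r, count_mem r w = prow la r].

Lemma shaped_rw t : shaped (rw t).
Proof. by split; [exact: yam_rw | exact: size_rw | exact: count_rw]. Qed.

Lemma count_take_lt (w : seq nat) j : (j < size w)%N ->
  (count_mem (nth 0%N w j) (take j w) < count_mem (nth 0%N w j) w)%N.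
Proof.
move=> h; set x := nth 0%N w j.
rewrite -[X in (_ < count_mem _ X)%N](cat_take_drop j w) count_cat.
by rewrite (drop_nth 0%N h) /= eqxx; lia.
Qed.

Lemma count_take_mono (w : seq nat) r i j : (i <= j)%N ->
  (count_mem r (take i w) <= count_mem r (take j w))%N.
Proof.
move=> h; rewrite -(subnKC h) takeD count_cat; exact: leq_addr.
Qed.

(** The entry of the box [(r, y)] is the position of the letter [r] that is
    preceded by [y] others; columns increase because the counts of the prefixes
    form partitions. *)
Lemma rw_onto w : shaped w -> exists t, rw t = w.
Proof.
case=> yw sw cw.
have ex b : exists j : 'I_m,
    (nth 0%N w j == brow b) && (count_mem (brow b) (take j w) == bcol b).
  have := bcol_lt b; rewrite -cw => /nth_occurrence[j hj [e1 e2]].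
  by rewrite sw in hj; exists (Ordinal hj); rewrite /= e1 e2 !eqxx.
pose t := [ffun b => xchoose (ex b)].
have tP b : nth 0%N w (t b) = brow b /\ count_mem (brow b) (take (t b) w) = bcol b.
  by rewrite ffunE; case/andP: (xchooseP (ex b)) => /eqP -> /eqP ->.
have tlt b : (t b < size w)%N by rewrite sw.
have onto (j : 'I_m) : exists b, t b = j.
  have hj : (j < size w)%N by rewrite sw.
  have := count_take_lt hj; rewrite cw => /mkbox[b [e1 e2]]; exists b.
  have [e3 e4] := tP b; rewrite e1 in e3 e4; rewrite e2 in e4.
  apply/val_inj; case: (ltngtP (t b) j) => // h.
    have := count_take_mono w (nth 0%N w j) h.
    by rewrite (take_nth 0%N (tlt b)) e3 count_rcons eqxx e4; lia.
  have := count_take_mono w (nth 0%N w j) h.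
  by rewrite (take_nth 0%N hj) count_rcons eqxx e4; lia.
have std : is_std t.
  apply/and4P; split.
  - apply/injectiveP => b c e; have [e1 e2] := tP b; have [e3 e4] := tP c.
    by rewrite e in e1 e2; apply: box_inj; [rewrite -e1 -e3 | rewrite -e2 -e4 -e1 -e3].
  - by apply/forallP => j; have [b <-] := onto j; exact: codom_f.
  - apply/forallP => b; apply/forallP => c; apply/implyP => /andP[/eqP e h].
    have [e1 e2] := tP b; have [e3 e4] := tP c.
    rewrite ltnNge; apply/negP => h'; have := count_take_mono w (brow b) h'.
    by rewrite e2 e e4; lia.
  - apply/forallP => b; apply/forallP => c; apply/implyP => /andP[/eqP e h].
    have [e1 e2] := tP b; have [e3 e4] := tP c.
    rewrite ltnNge; apply/negP => h'; have := count_take_mono w (brow b) h'.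
    have : ((t c).+1 <= t b)%N.
      rewrite ltn_neqAle h' andbT; apply/eqP => /val_inj e5; move: e1 e3 h.
      by rewrite e5 => -> ->; rewrite ltnn.
    move=> h'' _; have := count_take_mono w (brow b) h''.
    have := yam_shape_le (yam_take (t c).+1 yw) (ltnW h).
    by rewrite (take_nth 0%N (tlt c)) e3 !count_rcons eqxx e2 e4 e; lia.
exists (exist _ t std); apply: (@eq_from_nth _ 0%N); rewrite size_rw ?sw // => j hj.
have [b e] := onto (Ordinal hj); have := nth_rw (exist _ t std) b.
by rewrite /= e /= => ->; have [<- _] := tP b; rewrite e.
Qed.

End TabWord.

(** Contents differing by one force adjacent boxes: no row or column of the shape
    ends strictly between two neighbouring diagonals. *)
Lemma ct_adj_row u a b : yam (rcons (rcons u a) b) ->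
  (ct (rcons u a) b - ct u a == 1) = (a == b).
Proof.
rewrite !yam_rcons => /andP[/andP[yu]]; rewrite /ct /addable !count_rcons.
case: (ltngtP a b) => [h|h|<-] h1 h2; last lia.
- by have := yam_shape_le yu (ltnW h); lia.
- have := yam_shape_le yu (ltnW h); have := @yam_shape_le _ b a.-1 yu. lia.
Qed.

Lemma ct_adj_col u a b : yam (rcons (rcons u a) b) ->
  (ct (rcons u a) b - ct u a == -1) =
  (a != b) && (count_mem b (rcons u a) == count_mem a u).
Proof.
rewrite !yam_rcons => /andP[/andP[yu]]; rewrite /ct /addable !count_rcons.
case: (ltngtP a b) => [h|h|<-] h1 h2; last lia.
- have := yam_shape_le yu (ltnW h); have := @yam_shape_le _ a b.-1 yu.
  by move: h2; case: (eqVneq a b.-1) => [e|ne]; rewrite -?e; lia.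
- have := yam_shape_le yu (ltnW h); have := @yam_shape_le _ b a.-1 yu; lia.
Qed.

Section SwapTab.
Variables (m : nat) (la : part m).
Implicit Types (t : STab la) (i : 'I_m.-1).

Definition tdist t i : int := cont (rw t) i.+1 - cont (rw t) i.

Lemma lt_predm i : (i.+1 < m)%N.
Proof. exact: (ltn_ord (hi i)). Qed.

Lemma tdist_adj t i b c : val t b = i :> nat -> val t c = i.+1 :> nat ->
  ((tdist t i == 1) = (brow b == brow c)) * ((tdist t i == -1) = (bcol b == bcol c)).
Proof.
move=> eb ec; have im := lt_predm i; have bc : b != c.
  by apply/eqP => e; move: ec; rewrite -e eb; lia.
have h : (i.+1 < size (rw t))%N by rewrite size_rw.
have [u [x [y [v [Ew iu]]]]] := split2P h.
have yxy : yam (rcons (rcons u x) y).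
  by apply: (@yam_prefix _ v); rewrite !cat_rcons -Ew yam_rw.
have xb : x = brow b by rewrite -(nth_rw t b) eb Ew -iu nth_cat ltnn subnn.
have yc : y = brow c.
  by rewrite -(nth_rw t c) ec Ew -iu -cat_rcons -(size_rcons u x) nth_cat ltnn subnn.
have xcol : count_mem x u = bcol b.
  by rewrite -(count_take_box t b) eb Ew -iu take_size_cat // xb.
have ycol : count_mem y (rcons u x) = bcol c.
  rewrite -(count_take_box t c) ec Ew -iu -cat_rcons -(size_rcons u x).
  by rewrite take_size_cat // yc.
rewrite /tdist Ew -iu cont_cat cont_cat1 ct_adj_row // ct_adj_col // xcol ycol xb yc.
split=> //; case: (eqVneq (bcol c) (bcol b)) => e; rewrite ?andbF //.
by rewrite andbT; apply: contra bc => /eqP e'; apply/eqP/box_inj.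
Qed.

Lemma nth_swp (w : seq nat) i (j : nat) : (i.+1 < size w)%N -> nth 0%N (swp i w) j =
  nth 0%N w (if j == i :> nat then i.+1 else if j == i.+1 then i : nat else j).
Proof.
move=> h; have [u [x [y [v [-> iu]]]]] := split2P h.
rewrite -iu swp_cat !nth_cat; case: (eqVneq j (size u)) => [->|j1].
  by rewrite ltnn subnn /= ifN ?subSnn //; lia.
case: (eqVneq j (size u).+1) => [->|j2]; first by rewrite ifN ?ltnn ?subnn ?subSnn //; lia.
case: ltnP => // h'; move: h' j1 j2; rewrite leq_eqVlt eq_sym => /orP[->//|].
by rewrite -subn_gt0; case E: (j - size u)%N => [|[|k]] //=; lia.
Qed.

Lemma tperm_lohi i (j : 'I_m) : tperm (lo i) (hi i) j =
  (if j == i :> nat then i.+1 else if j == i.+1 :> nat then i : nat else j) :> nat.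
Proof.
rewrite permE /= -!(inj_eq val_inj) /=.
by case: ifP => //; case: ifP.
Qed.

Lemma tab_swap_rw t t0 i : val t0 = tab_swap i t -> rw t0 = swp i (rw t).
Proof.
move=> e; have h := lt_predm i; apply: (@eq_from_nth _ 0%N).
  by rewrite size_swp !size_rw.
move=> j; rewrite size_rw => jm; have [b eb] := stab_onto t0 jm.
rewrite -eb nth_rw nth_swp ?size_rw // -tperm_lohi.
by rewrite e ffunE tpermK nth_rw.
Qed.

Lemma tab_swap_std t i :
  is_std (tab_swap i t) = (tdist t i != 1) && (tdist t i != -1).
Proof.
have [b eb] := stab_onto t (ltn_ord (lo i)); have [c ec] := stab_onto t (ltn_ord (hi i)).
rewrite /= in eb ec; have [-> ->] := tdist_adj eb ec.
have sE d : tab_swap i t d =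
  (if val t d == i :> nat then i.+1 else if val t d == i.+1 :> nat then i : nat
   else val t d) :> nat by rewrite ffunE tperm_lohi.
have sb : tab_swap i t b = i.+1 :> nat by rewrite sE eb eqxx.
have sc : tab_swap i t c = i :> nat by rewrite sE ec eqxx gtn_eqF.
apply/idP/andP => [std|[rbc cbc]].
  pose t0 : STab la := exist (fun x => is_std x) _ std.
  split; apply/eqP => e.
    have := stab_row_ltE t e; have := stab_row_ltE t0 e.
    by rewrite /= sb sc eb ec; lia.
  have := stab_col_ltE t e; have := stab_col_ltE t0 e.
  by rewrite /= sb sc eb ec; lia.
have mono d e : ~~ ((d == b) && (e == c)) -> (val t d < val t e)%N ->
    (tab_swap i t d < tab_swap i t e)%N.
  move=> nbc lt; rewrite !sE; have : ~~ ((val t d == i :> nat) && (val t e == i.+1 :> nat)).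
    apply: contra nbc => /andP[/eqP h1 /eqP h2]; apply/andP; split; apply/eqP;
    by apply: (@stab_inj _ _ t); apply: val_inj; rewrite /= ?h1 ?h2 ?eb ?ec.
  by do !case: ifPn; lia.
apply/and4P; split.
- by apply/injectiveP => d e; rewrite !ffunE => /perm_inj/stab_inj.
- apply/forallP => j; have [d ed] := stab_onto t (ltn_ord (tperm (lo i) (hi i) j)).
  apply/codomP; exists d; rewrite ffunE; apply: (canRL (tpermK _ _)).
  by apply/esym/val_inj.
- apply/forallP => d; apply/forallP => e; apply/implyP => /andP[/eqP h1 h2].
  apply: mono; last exact: stab_row.
  by apply: contra rbc => /andP[/eqP <- /eqP <-]; rewrite h1.
- apply/forallP => d; apply/forallP => e; apply/implyP => /andP[/eqP h1 h2].
  apply: mono; last exact: stab_col.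
  by apply: contra cbc => /andP[/eqP <- /eqP <-]; rewrite h1.
Qed.

Lemma tdist_neq0 t i : tdist t i != 0.
Proof.
have h : (i.+1 < size (rw t))%N by rewrite size_rw lt_predm.
have [u [x [y [v [Ew iu]]]]] := split2P h.
rewrite /tdist Ew -iu cont_cat cont_cat1; apply: ct_neq.
by apply: (@yam_prefix _ v); rewrite !cat_rcons -Ew yam_rw.
Qed.

Lemma tab_swapK t t0 i : val t0 = tab_swap i t -> val t = tab_swap i t0.
Proof. by move=> e; apply/ffunP => b; rewrite ffunE e ffunE tpermK. Qed.

Lemma tdist_swap t t0 i : val t0 = tab_swap i t -> tdist t0 i = - tdist t i.
Proof.
move=> e; have /andP[d1 d2] : (tdist t i != 1) && (tdist t i != -1).
  by rewrite -tab_swap_std -e (valP t0).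
have h : (i.+1 < size (rw t))%N by rewrite size_rw lt_predm.
have yw := yam_rw t; move: d1 d2; rewrite /tdist (tab_swap_rw e).
have [u [x [y [v [Ew iu]]]]] := split2P h.
rewrite Ew -iu in yw *; rewrite swp_cat !cont_cat !cont_cat1 => d1 d2.
by have [_ _ -> ->] := yam_swap yw d1 d2; rewrite (opprB (ct (rcons u x) y)).
Qed.

Section Coefficients.
Variables (F : fieldType).

(** Turns a vector into a function of words, 0 on those that do not have the shape
    [la], so that vectors of different shapes and sizes can be compared. *)
Definition wcoef (v : Vmod F la) (w : seq nat) : F :=
  if [pick t | rw t == w] is Some t then v t else 0.

Lemma wcoef_rw v t : wcoef v (rw t) = v t.
Proof.
rewrite /wcoef; case: pickP => [t' /eqP/rw_inj -> //|/(_ t)].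
by rewrite eqxx.
Qed.

Lemma wcoef_out v w : ~ shaped la w -> wcoef v w = 0.
Proof.
rewrite /wcoef; case: pickP => // t /eqP <- []; exact: shaped_rw.
Qed.

Variable q : F.
Hypothesis q_neq0 : q != 0.
Hypothesis qint_neq0 : forall L : int, L != 0 -> qint q L != 0.

Lemma wcoef_swap v t i :
  ucoef q (tdist t i) * wcoef v (swp i (rw t)) =
  \sum_(t0 : STab la | val t0 == tab_swap i t) ucoef q (tdist t i) * v t0.
Proof.
case: (boolP (is_std (tab_swap i t))) => st.
  pose t1 : STab la := exist (fun x => is_std x) _ st.
  rewrite (big_pred1 t1); first by rewrite -(@tab_swap_rw t t1) // wcoef_rw.
  by move=> t0 /=; apply/eqP/eqP => [e|->//]; exact: val_inj.
rewrite big_pred0 => [|t0]; last by apply/negbTE; apply: contra st => /eqP <-; exact: (valP t0).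
by move: st; rewrite tab_swap_std negb_and !negbK /ucoef => ->; rewrite mul0r.
Qed.

Lemma sigma_tabE t t0 i : sigma_tab q i t0 t =
  gcoef q (tdist t0 i) * (t == t0)%:R +
  (gcoef q (tdist t0 i) + q^-1) * (val t == tab_swap i t0)%:R.
Proof.
by rewrite /sigma_tab !tab_cc_rw !ffunE -(inj_eq val_inj) -hcoefE // tdist_neq0.
Qed.

Lemma sigma_opE v t i : sigma_op q i v t = opw q m i (wcoef v) (rw t).
Proof.
rewrite /opw yam_rw size_rw eqxx -/(tdist t i) wcoef_swap wcoef_rw.
have -> : sigma_op q i v t = \sum_t0 (v t0 * sigma_tab q i t0 t).
  by rewrite /sigma_op sum_ffunE; apply: eq_bigr => t0 _; rewrite ffunE.
transitivity (\sum_t0 (v t0 * (gcoef q (tdist t0 i) * (t == t0)%:R)) +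
              \sum_t0 (v t0 * ((gcoef q (tdist t0 i) + q^-1) *
                                (val t == tab_swap i t0)%:R))).
  by rewrite -big_split; apply: eq_bigr => t0 _; rewrite sigma_tabE mulrDr.
congr (_ + _).
  rewrite (bigD1 t) //= eqxx mulr1 mulrC big1 ?addr0 // => t0 /negPf.
  by rewrite eq_sym => ->; rewrite !mulr0.
rewrite [RHS]big_mkcond; apply: eq_bigr => t0 _.
have -> : (val t == tab_swap i t0) = (val t0 == tab_swap i t).
  by apply/eqP/eqP => /tab_swapK.
case: eqP => [e|_]; last by rewrite !mulr0.
have := valP t0; rewrite e tab_swap_std => /andP[/negPf d1 /negPf d2].
by rewrite (tdist_swap e) /ucoef d1 d2 mulr1 mulrC.
Qed.

End Coefficients.
End SwapTab.

(** * Sorting the columns of a tableau within blocks *)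

(** The column of the box that the [j]-th letter of [w] adds. *)
Definition col (w : seq nat) (j : nat) : nat := count_mem (nth 0%N w j) (take j w).

Lemma col_cat u a v : col (u ++ a :: v) (size u) = count_mem a u.
Proof. by rewrite /col take_size_cat // nth_cat ltnn subnn. Qed.

Lemma col_cat1 u a b v : col (u ++ a :: b :: v) (size u).+1 = count_mem b (rcons u a).
Proof. by rewrite -cat_rcons -(size_rcons u a) col_cat. Qed.

Lemma col_catl u v j : (j < size u)%N -> col (u ++ v) j = col u j.
Proof. by move=> h; rewrite /col nth_cat h takel_cat // ltnW. Qed.

Lemma swp_col w i : yam w -> (i.+1 < size w)%N -> (col w i.+1 < col w i)%N ->
  [/\ yam (swp i w), cont w i.+1 - cont w i != 1, cont w i.+1 - cont w i != -1
    & forall j, col (swp i w) j =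
        col w (if j == i then i.+1 else if j == i.+1 then i else j)].
Proof.
move=> yw iw; have [u [a [b [v [Ew iu]]]]] := split2P iw; rewrite Ew -iu in yw *.
rewrite col_cat col_cat1 cont_cat cont_cat1 => hc.
have yab : yam (rcons (rcons u a) b).
  by apply: (@yam_prefix _ v); rewrite !cat_rcons.
have d1 : ct (rcons u a) b - ct u a != 1.
  rewrite ct_adj_row //; apply: contraTneq hc => ->.
  by rewrite count_rcons eqxx; lia.
have d2 : ct (rcons u a) b - ct u a != -1.
  by rewrite ct_adj_col // negb_and; apply/orP; right; lia.
have [ab yw' _ _] := yam_swap yw d1 d2; rewrite swp_cat; split=> // j.
have cb : count_mem b (rcons u a) = count_mem b u.
  by rewrite count_rcons (negPf ab) addn0.
have ca : count_mem a (rcons u b) = count_mem a u.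
  by rewrite count_rcons eq_sym (negPf ab) addn0.
case: (eqVneq j (size u)) => [->|j1]; first by rewrite col_cat col_cat1.
case: (eqVneq j (size u).+1) => [->|j2]; first by rewrite col_cat1 col_cat.
case: (ltnP j (size u)) => j3; first by rewrite !col_catl.
have -> : j = (size u + (j - size u - 2).+2)%N by lia.
move: (j - size u - 2)%N => l; rewrite /col !nth_cat !take_cat !ifN; try lia.
by rewrite !addKn /=; apply/seq.permP; exact: perm_eq_cons2.
Qed.

(** Induction for properties of tableau words that propagate along the exchanges
    of neighbouring entries [i], [i+1] such that [i] lies strictly to the right
    of [i+1]: such exchanges terminate, since they decrease the sum of the
    columns weighted by decreasing weights. *)
Lemma colsort_ind m (B : pred nat) (P : seq nat -> Prop) :
  (forall w, yam w -> size w = m ->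
     (forall i, (i.+1 < m)%N -> B i -> (col w i <= col w i.+1)%N) -> P w) ->
  (forall i w, yam w -> size w = m -> (i.+1 < m)%N -> B i ->
     (col w i.+1 < col w i)%N -> P (swp i w) -> P w) ->
  forall w, yam w -> size w = m -> P w.
Proof.
move=> H0 H1 w; pose M w := (\sum_(j < m) (m - j) * col w j)%N.
have [n] := ubnP (M w); elim: n w => // n IH w hn yw sw.
have [h|h] := EM (forall i, (i.+1 < m)%N -> B i -> (col w i <= col w i.+1)%N).
  exact: H0.
have [i [im [Bi hi]]] : exists i, (i.+1 < m)%N /\ B i /\ (col w i.+1 < col w i)%N.
  apply: contrapT => h'; apply: h => i im Bi; rewrite leqNgt; apply/negP => h3.
  by apply: h'; exists i.
have iw : (i.+1 < size w)%N by rewrite sw.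
have [yw' _ _ cE] := swp_col yw iw hi.
apply: (H1 i) => //; apply: IH; rewrite ?size_swp //.
rewrite ltnS in hn; apply: leq_trans hn; rewrite /M.
pose i0 := Ordinal (ltnW im); pose i1 := Ordinal im.
have n10 : i1 != i0 by rewrite -(inj_eq val_inj) /= gtn_eqF.
rewrite [X in (X < _)%N](bigD1 i0) //= [X in (_ < X)%N](bigD1 i0) //=.
rewrite [X in (_ + X < _)%N](bigD1 i1) //= [X in (_ < _ + X)%N](bigD1 i1) //=.
rewrite !cE eqxx gtn_eqF // eqxx.
set s1 := (\sum_(j < m | _) _)%N; set s2 := (\sum_(j < m | _) _)%N.
have -> : s1 = s2.
  apply: eq_bigr => j /andP[j0 j1]; rewrite cE !ifN //.
have [x Ex] : exists x, (m - i = x.+1)%N by exists (m - i.+1)%N; lia.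
have [y ->] : exists y, (col w i = col w i.+1 + y.+1)%N.
  by exists (col w i - (col w i.+1).+1)%N; lia.
have -> : (m - i.+1 = x)%N by lia.
rewrite Ex.
by move: (col w i.+1) s2 => c s2; nia.
Qed.

(** Suppose that [w] and [w'] first differ at [j], where [w] has the smaller
    column. Up to the end of the block the columns of [w'] stay larger than that
    one, so the box that [w] adds at [j] is still missing there in [w'], although
    the shapes agree. *)
Lemma colsort_uniq m (B : pred nat) w w' :
  yam w -> yam w' -> size w = m -> size w' = m ->
  (forall i, (i.+1 < m)%N -> B i -> (col w i <= col w i.+1)%N) ->
  (forall i, (i.+1 < m)%N -> B i -> (col w' i <= col w' i.+1)%N) ->
  (forall p, (0 < p <= m)%N -> (p == m) || ~~ B p.-1 -> perm_eq (take p w) (take p w')) ->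
  w = w'.
Proof.
move=> yw yw' sw sw' cw cw' bd.
have key x x' j : yam x -> yam x' -> size x = m -> size x' = m ->
    (forall i, (i.+1 < m)%N -> B i -> (col x' i <= col x' i.+1)%N) ->
    (forall p, (0 < p <= m)%N -> (p == m) || ~~ B p.-1 ->
       perm_eq (take p x) (take p x')) ->
    (j < m)%N -> take j x = take j x' -> ~ (col x j < col x' j)%N.
  move=> yx yx' sx sx' cx' bx jm e hc.
  have exp : exists p, (j < p <= m)%N && ((p == m) || ~~ B p.-1).
    by exists m; rewrite jm leqnn eqxx.
  (* The end of the block of [j]. *)
  case: (ex_minnP exp) => p /andP[/andP[jp pm] pb] pmin.
  set a := nth 0%N x j.
  have cnt : (col x j < count_mem a (take p x'))%N.
    have p0 : (0 < p <= m)%N by rewrite pm andbT; lia.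
    have /seq.permP <- := bx p p0 pb.
    apply: leq_trans (count_take_mono x a jp).
    by rewrite (take_nth 0%N) ?sx // count_rcons eqxx addn1.
  have [l] := nth_occurrence cnt; rewrite size_takel ?sx' // => lp.
  rewrite nth_take // take_takel ?(ltnW lp) // => -[el ecl].
  have jl : (j <= l)%N.
    rewrite leqNgt; apply/negP => lj; have := count_take_mono x' a lj.
    rewrite (take_nth 0%N) ?sx' ?(leq_trans lp) // el count_rcons eqxx ecl -e.
    by rewrite -[count_mem a (take j x)]/(col x j); lia.
  have mono d : (j + d < p)%N -> (col x' j <= col x' (j + d))%N.
    elim: d => [|d IHd] h; first by rewrite addn0.
    have h' : (j + d < p)%N by lia.
    apply: leq_trans (IHd h') _; rewrite addnS; apply: cx'; first by lia.
    apply: contraT => nB; have := pmin (j + d).+1.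
    by rewrite nB orbT andbT; lia.
  have := mono (l - j)%N; rewrite subnKC // => /(_ lp).
  by rewrite [X in (_ <= X)%N]/col el ecl; lia.
suff E j : (j <= m)%N -> take j w = take j w'.
  by have := E m (leqnn m); rewrite !take_oversize ?sw ?sw'.
elim: j => [|j IH] h; first by rewrite !take0.
have e := IH (ltnW h); rewrite !(take_nth 0%N) ?sw ?sw' // e.
have c1 := key w w' j yw yw' sw sw' cw' bd h e.
have c2 : ~ (col w' j < col w j)%N.
  apply: key => // p p1 p2; rewrite perm_sym; exact: bd.
have H : col w j = col w' j by case: (ltngtP (col w j) (col w' j)).
rewrite /col e in H; congr rcons.
have a1 : addable (take j w') (nth 0%N w j).
  have := yam_take j.+1 yw; rewrite (take_nth 0%N) ?sw // yam_rcons e.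
  by case/andP.
have a2 : addable (take j w') (nth 0%N w' j).
  have := yam_take j.+1 yw'; rewrite (take_nth 0%N) ?sw' // yam_rcons.
  by case/andP.
have yu := yam_take j yw'; move: a1 a2 H; rewrite /addable.
move: (nth 0%N w j) (nth 0%N w' j) (take j w') yu => a b u yu.
case: (ltngtP a b) => [h1|h1|->] // a1 a2 H.
- by have := @yam_shape_le _ a b.-1 yu; lia.
- by have := @yam_shape_le _ b a.-1 yu; lia.
Qed.

(** * The seminormal representations *)

Section SeminormalModules.
Variables (F : fieldType) (q : F) (m : nat).
Hypothesis q_neq0 : q != 0.
Hypothesis qint_neq0 : forall L : int, L != 0 -> qint q L != 0.

Section OneShape.
Variable la : part m.
Implicit Types (v : Vmod F la) (i : 'I_m.-1).

Lemma wcoef_inj v v' : wcoef v =1 wcoef v' -> v = v'.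
Proof. by move=> h; apply/ffunP => t; rewrite -!wcoef_rw h. Qed.

Lemma wcoef_linear a v v' w : wcoef (a *: v + v') w = a * wcoef v w + wcoef v' w.
Proof.
by rewrite /wcoef; case: pickP => [t _|_]; rewrite ?ffunE ?mulr0 ?addr0.
Qed.

Lemma wcoefZ a v w : wcoef (a *: v) w = a * wcoef v w.
Proof. by rewrite /wcoef; case: pickP => [t _|_]; rewrite ?ffunE ?mulr0. Qed.

Lemma wcoefD v v' w : wcoef (v + v') w = wcoef v w + wcoef v' w.
Proof. by rewrite /wcoef; case: pickP => [t _|_]; rewrite ?ffunE ?addr0. Qed.

Lemma wcoef0 w : wcoef (0 : Vmod F la) w = 0.
Proof. by rewrite /wcoef; case: pickP => // t _; rewrite ffunE. Qed.

Lemma shaped_swp i w : yam w -> size w = m -> shaped la (swp i w) -> shaped la w.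
Proof.
move=> yw sw [_ _ cw]; have hi : (i.+1 < size w)%N by rewrite sw lt_predm.
by have /seq.permP h := perm_swp hi; split=> // r; rewrite -cw h.
Qed.

Lemma wcoef_sigma i v : wcoef (sigma_op q i v) = opw q m i (wcoef v).
Proof.
apply/funext => w; have [h|h] := EM (shaped la w).
  by have [t <-] := rw_onto h; rewrite wcoef_rw sigma_opE.
rewrite wcoef_out // /opw wcoef_out // !mulr0 add0r.
case: ifP => // /andP[yw /eqP sw].
by rewrite wcoef_out ?mulr0 // => h'; apply: h; exact: shaped_swp h'.
Qed.

(** All relations are checked on the functions of words, where they hold without
    reference to a shape. *)
Lemma sigma_act_rel : hecke_act_rel q (@sigma_op F q m la).
Proof.
split=> [i a u v|i v|i j v ji|i j v ij].
- apply: wcoef_inj => w; rewrite wcoef_linear !wcoef_sigma -opw_linear.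
  by congr (opw _ _ _ _ _); apply/funext => x; exact: wcoef_linear.
- apply: wcoef_inj => w; rewrite wcoefD wcoefZ !wcoef_sigma.
  exact: opw_quad (lt_predm i).
- apply: wcoef_inj => w; rewrite !wcoef_sigma ji; apply: opw_braid => //.
  by rewrite -ji lt_predm.
- apply: wcoef_inj => w; rewrite !wcoef_sigma.
  case/orP: ij => ij; first exact: opw_comm (lt_predm j).
  by apply/esym; exact: opw_comm (lt_predm i).
Qed.

Lemma Vrep_gen i v : Vrep (hgen q i) v = sigma_op q i v.
Proof. by have [h _ _ _ _] := hactP sigma_act_rel; exact: h. Qed.

Lemma Vrep_linear x : linear (@Vrep F q m la x).
Proof. by have [_ h _ _ _] := hactP sigma_act_rel; exact: h. Qed.

Lemma Vrep_linearl a x y v : Vrep (a *: x + y) v = a *: @Vrep F q m la x v + Vrep y v.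
Proof. by have [_ _ h _ _] := hactP sigma_act_rel; exact: h. Qed.

Lemma Vrep1 v : @Vrep F q m la 1 v = v.
Proof. by have [_ _ _ h _] := hactP sigma_act_rel; exact: h. Qed.

Lemma VrepM x y v : @Vrep F q m la (x * y) v = Vrep x (Vrep y v).
Proof. by have [_ _ _ _ h] := hactP sigma_act_rel; exact: h. Qed.

Lemma VrepD x y v : @Vrep F q m la (x + y) v = Vrep x v + Vrep y v.
Proof. by rewrite -[x]scale1r Vrep_linearl !scale1r. Qed.

Lemma Vrep0 v : @Vrep F q m la 0 v = 0.
Proof.
by have := VrepD 0 0 v; rewrite addr0 -{1}[Vrep 0 v]addr0 => /addrI <-.
Qed.

Lemma VrepZ a x v : @Vrep F q m la (a *: x) v = a *: Vrep x v.
Proof. by rewrite -[a *: x]addr0 Vrep_linearl Vrep0 addr0. Qed.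

Lemma Vrep_sum (I : Type) (r : seq I) (P : pred I) (E : I -> hecke q m) v :
  Vrep (\sum_(i <- r | P i) E i) v = \sum_(i <- r | P i) @Vrep F q m la (E i) v.
Proof.
by apply: (big_morph (fun x => @Vrep F q m la x v)) => [x y|]; rewrite ?VrepD ?Vrep0.
Qed.

Lemma VrepA x u v : @Vrep F q m la x (u + v) = Vrep x u + Vrep x v.
Proof. by rewrite -[u]scale1r Vrep_linear !scale1r. Qed.

Lemma Vrepr0 x : @Vrep F q m la x 0 = 0.
Proof.
by have := VrepA x 0 0; rewrite addr0 -{1}[Vrep x 0]addr0 => /addrI <-.
Qed.

Lemma VrepS x a v : @Vrep F q m la x (a *: v) = a *: Vrep x v.
Proof. by rewrite -[a *: v]addr0 Vrep_linear Vrepr0 addr0. Qed.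

Lemma wcoef_gen (i : nat) v : (i.+1 < m)%N ->
  wcoef (Vrep (hgen_nat q m i) v) = opw q m i (wcoef v).
Proof.
rewrite -ltn_predRL => im.
rewrite /hgen_nat; case: insubP => [j _ <-|]; last by rewrite im.
by rewrite /= Vrep_gen wcoef_sigma.
Qed.

End OneShape.

(** * Jucys-Murphy elements and matrix units *)

Fixpoint jucys_murphy (i : nat) : hecke q m :=
  if i is j.+1 then
    hgen_nat q m j * jucys_murphy j * hgen_nat q m j + hgen_nat q m j
  else 0.

Lemma wcoef_jm la i (v : Vmod F la) w : (i < m)%N ->
  wcoef (Vrep (jucys_murphy i) v) w = jmval q (cont w i) * wcoef v w.
Proof.
elim: i v w => [|i IH] v w im /=.
  rewrite Vrep0 wcoef0; have [h|h] := EM (shaped la w); last by rewrite wcoef_out ?mulr0.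
  case: h => yw sw _; have : (0 < size w)%N by rewrite sw.
  case: w yw {sw} => [|a w] yw // _.
  have : yam [:: a] by apply: (@yam_prefix _ w).
  rewrite (yam_rcons [::] a) yam_nil /addable orbF => /eqP ->.
  by rewrite /cont /ct take0 subrr jmval0 mul0r.
have [h|h] := EM (shaped la w); last by rewrite !wcoef_out ?mulr0.
have [yw sw _] := h.
rewrite VrepD !VrepM wcoefD !wcoef_gen //.
have E : wcoef (Vrep (jucys_murphy i) (Vrep (hgen_nat q m i) v)) =
    fun x => jmval q (cont x i) * opw q m i (wcoef v) x.
  by apply/funext => x; rewrite IH ?(ltnW im) // wcoef_gen.
rewrite {}E; rewrite -sw in im; have [u [a [b [z [Ew iu]]]]] := split2P im.
rewrite Ew -iu in yw sw *.
have yab : yam (rcons (rcons u a) b).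
  by apply: (@yam_prefix _ z); rewrite !cat_rcons.
rewrite opw_cat // opw_cat // !cont_cat cont_cat1.
have := ct_neq yab; rewrite subr_eq0 eq_sym => xy.
have d1 := jm_diag q_neq0 qint_neq0 xy.
have [u0|[ab yw' e1 e2]] := ucoef_swap q yw.
  by rewrite u0 in d1 *; rewrite -d1; ring.
rewrite opw_cat //; last by rewrite -sw !size_cat.
have := jm_offdiag q_neq0 qint_neq0 xy; move: d1; rewrite e1 e2.
move: (ct (rcons u a) b) (ct u a) => y x.
move: (wcoef v (u ++ [:: a, b & z])) (wcoef v (u ++ [:: b, a & z])) => A B.
move: (jmval q x) (jmval q y) (gcoef q (y - x)) (gcoef q (x - y))
  (ucoef q (y - x)) (ucoef q (x - y)) => jx jy g g' s s' d1 d2.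
transitivity ((g * (jx * g) + s * (jy * s') + g) * A + s * (g * jx + g' * jy + 1) * B).
  by ring.
by rewrite d1 d2; ring.
Qed.

(** The boxes that can be added to a shape lie on distinct diagonals. *)
Lemma cont_inj (w w' : seq nat) : yam w -> yam w' -> size w = m -> size w' = m ->
  (forall i, (i < m)%N -> cont w i = cont w' i) -> w = w'.
Proof.
move=> yw yw' sw sw' h; suff E j : (j <= m)%N -> take j w = take j w'.
  by have := E m (leqnn m); rewrite !take_oversize ?sw ?sw'.
elim: j => [|j IH] jm; first by rewrite !take0.
have e := IH (ltnW jm); rewrite !(take_nth 0%N) ?sw ?sw' // e; congr rcons.
have := h j jm; rewrite /cont e; have := yam_take j yw'.
move: (take j w') (nth _ w j) (nth _ w' j) => u a b yu; rewrite /ct => hc.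
case: (ltngtP a b) => [h1|h1|//].
- by have := yam_shape_le yu (ltnW h1); lia.
- by have := yam_shape_le yu (ltnW h1); lia.
Qed.

(** [x] acts on all the seminormal representations as a matrix unit. *)
Definition munit (s t : seq nat) (x : hecke q m) : Prop :=
  forall la (v : Vmod F la) w,
    wcoef (Vrep x v) w = (w == s)%:R * wcoef v t.

(** The word [s] differs from any other one in the content of some entry, and a
    polynomial in the corresponding Jucys-Murphy element takes the values 1 and 0
    on the two. *)
Lemma diag_separation (L : seq (seq nat)) s : yam s -> size s = m ->
  all (fun w => yam w && (size w == m)) L ->
  exists (x : hecke q m) (phi : seq nat -> F),
    [/\ forall la (v : Vmod F la) w, wcoef (Vrep x v) w = phi w * wcoef v w,
        phi s = 1 & forall w, w \in L -> w != s -> phi w = 0].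
Proof.
move=> ys ss; elim: L => [_|w0 L IH /= /andP[/andP[yw0 /eqP sw0] /IH[x [phi [h1 h2 h3]]]]].
  by exists 1, (fun=> 1); split=> // la v w; rewrite Vrep1 mul1r.
have [e|ne] := eqVneq w0 s.
  exists x, phi; split=> // w; rewrite inE => /orP[/eqP ->|]; last exact: h3.
  by rewrite e eqxx.
have [i [im hi]] : exists i, (i < m)%N /\ cont w0 i != cont s i.
  apply: contrapT => h; case/eqP: ne; apply: cont_inj => // i im.
  by apply/eqP; apply: contrapT => h'; apply: h; exists i; split=> //; apply/negP.
pose d := jmval q (cont s i) - jmval q (cont w0 i).
have d0 : d != 0.
  by rewrite subr_eq0 (inj_eq (jmval_inj q_neq0 qint_neq0)) eq_sym.
exists (d^-1 *: (jucys_murphy i - jmval q (cont w0 i) *: 1) * x).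
exists (fun w => d^-1 * (jmval q (cont w i) - jmval q (cont w0 i)) * phi w).
split=> [la v w||w].
- rewrite VrepM -scaleN1r addrC VrepZ wcoefZ scalerA Vrep_linearl wcoef_linear.
  by rewrite Vrep1 wcoef_jm // h1; ring.
- by rewrite h2 mulr1 mulVf.
rewrite inE => /orP[/eqP ->|wL] ws; first by rewrite subrr mulr0 mul0r.
by rewrite h3 // mulr0.
Qed.

End SeminormalModules.
Lemma yam_mem_lt w r : yam w -> r \in w -> (r < size w)%N.
Proof.
elim/last_ind: w r => // w a IH r; rewrite yam_rcons mem_rcons inE size_rcons.
move=> /andP[yw aw] /orP[/eqP ->|/(IH _ yw)]; last exact: ltnW.
case: a aw => // a; rewrite /addable /= => h.
rewrite ltnS; apply: IH => //; rewrite -has_pred1 has_count.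
exact: leq_ltn_trans (leq0n _) h.
Qed.

Fixpoint yams (m : nat) : seq (seq nat) :=
  if m is m'.+1 then
    [seq rcons w r | w <- yams m', r <- [seq r <- iota 0 m'.+1 | addable w r]]
  else [:: [::]].

Lemma mem_yams m w : (w \in yams m) = yam w && (size w == m).
Proof.
elim: m w => [|m IH] w.
  by rewrite inE size_eq0; case: eqP => [->|]; rewrite ?yam_nil ?andbF.
case/lastP: w => [|w r]; first by rewrite andbF; apply/negP => /allpairsPdep[w [r [_ _ /(congr1 size)]]]; rewrite size_rcons.
rewrite size_rcons eqSS yam_rcons; apply/idP/idP.
  move=> /allpairsPdep[w' [r' []]]; rewrite IH mem_filter => /andP[yw sw] /andP[aw _].
  by move=> /rcons_inj[-> ->]; rewrite yw sw aw.
move=> /andP[/andP[yw aw] sw]; apply/allpairsPdep; exists w, r.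
rewrite IH yw sw mem_filter aw mem_iota; split=> //=.
have : yam (rcons w r) by rewrite yam_rcons yw.
by move=> /(@yam_mem_lt _ r); rewrite size_rcons mem_rcons mem_head (eqP sw); apply.
Qed.

Section MatrixUnits.
Variables (F : fieldType) (q : F) (m : nat).
Hypothesis q_neq0 : q != 0.
Hypothesis qint_neq0 : forall L : int, L != 0 -> qint q L != 0.

Local Notation munit := (@munit F q m).

Lemma munit_diag s : yam s -> size s = m -> exists x, munit s s x.
Proof.
move=> ys ss.
have [|x [phi [h1 h2 h3]]] := @diag_separation F q m q_neq0 qint_neq0 (yams m) s ys ss.
  by apply/allP => w; rewrite mem_yams.
exists x => la v w; rewrite h1; have [->|ws] := eqVneq w s; first by rewrite h2.
have [h|h] := EM (shaped la w); last by rewrite wcoef_out ?mulr0 ?mul0r.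
by rewrite h3 ?mul0r // mem_yams; case: h => -> ->; rewrite eqxx.
Qed.

Lemma munit_trans s t u x y : munit s t x -> munit t u y -> munit s u (x * y).
Proof. by move=> hx hy la v w; rewrite VrepM // hx hy eqxx mul1r. Qed.

Definition linked (s t : seq nat) : Prop :=
  (exists x, munit s t x) /\ (exists x, munit t s x).

Lemma linked_sym s t : linked s t -> linked t s.
Proof. by case. Qed.

Lemma linked_trans s t u : linked s t -> linked t u -> linked s u.
Proof.
move=> [[x hx] [x' hx']] [[y hy] [y' hy']]; split.
  by exists (x * y); exact: munit_trans hx hy.
by exists (y' * x'); exact: munit_trans hy' hx'.
Qed.

(** The generator moves between [w] and [swp i w] with a nonzero coefficient; the
    diagonal units on both sides remove all its other entries. *)
Lemma munit_step w i : yam w -> size w = m -> (i.+1 < m)%N ->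
  ucoef q (cont w i.+1 - cont w i) != 0 -> yam (swp i w) ->
  exists x, munit w (swp i w) x.
Proof.
move=> yw sw im u0 yw'; have iw : (i.+1 < size w)%N by rewrite sw.
have [x hx] := munit_diag yw sw.
have [y hy] := @munit_diag (swp i w) yw' (etrans (size_swp iw) sw).
exists ((ucoef q (cont w i.+1 - cont w i))^-1 *: (x * (hgen_nat q m i * y))).
move=> la v z; rewrite VrepZ // wcoefZ !VrepM // hx wcoef_gen // /opw yw sw eqxx /=.
rewrite !hy eqxx mul1r.
have -> : (w == swp i w) = false.
  apply/negP => /eqP e; move: u0; rewrite /ucoef.
  have [u [a [b [v' [Ew iu]]]]] := split2P iw; move: e yw.
  rewrite Ew -iu swp_cat cont_cat cont_cat1 => /eqP.
  rewrite eqseq_cat // eqxx => /eqP[-> _] yw.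
  rewrite ct_adj_row ?eqxx //; by apply: (@yam_prefix _ v'); rewrite !cat_rcons.
rewrite mul0r mulr0 add0r mulrCA; congr (_ * _); by rewrite mulKf.
Qed.

Lemma linked_sorted w : yam w -> size w = m ->
  exists c, [/\ linked w c, perm_eq w c, yam c, size c = m &
    forall i, (i.+1 < m)%N -> (col c i <= col c i.+1)%N].
Proof.
move: w; apply: (@colsort_ind m predT) => [w yw sw h|i w yw sw im _ hc [c [h1 h2 h3 h4 h5]]].
  exists w; split=> //; first by split; exact: munit_diag.
  by move=> i im; exact: h.
have iw : (i.+1 < size w)%N by rewrite sw.
have [yw' d1 d2 _] := swp_col yw iw hc.
have sw' : size (swp i w) = m by rewrite size_swp.
have iw' : (i.+1 < size (swp i w))%N by rewrite sw'.
have d0 : cont w i.+1 - cont w i != 0.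
  have [u [a [b [v' [Ew iu]]]]] := split2P iw; rewrite Ew -iu cont_cat cont_cat1.
  by apply: ct_neq; apply: (@yam_prefix _ v'); rewrite !cat_rcons -Ew.
have K : swp i (swp i w) = w.
  by have [u [a [b [v' [-> <-]]]]] := split2P iw; rewrite !swp_cat.
have dN : cont (swp i w) i.+1 - cont (swp i w) i = - (cont w i.+1 - cont w i).
  have [u [a [b [v' [Ew iu]]]]] := split2P iw.
  move: yw d1 d2; rewrite Ew -iu swp_cat !cont_cat !cont_cat1 => yw d1 d2.
  by have [_ _ -> ->] := yam_swap yw d1 d2; rewrite (opprB (ct (rcons u a) b)).
exists c; split=> //; last by apply: perm_trans h2; rewrite perm_sym perm_swp.
apply: linked_trans h1; split; first by apply: munit_step => //; exact: ucoef_neq0.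
have [||x hx] := @munit_step (swp i w) i yw' sw' im.
- rewrite dN; apply: ucoef_neq0 => //; first by rewrite oppr_eq0.
    by rewrite eqr_oppLR.
  by rewrite (inj_eq oppr_inj).
- by rewrite K.
by exists x; rewrite K in hx.
Qed.

(** Any two tableaux of the same shape are linked: sorting the columns leads
    from both of them to the tableau filled column by column. *)
Lemma munit_exists s t : yam s -> yam t -> size s = m -> perm_eq s t ->
  exists x, munit s t x.
Proof.
move=> ys yt ss st; have tt : size t = m by rewrite -(perm_size st).
have [c [l1 p1 yc sc cc]] := linked_sorted ys ss.
have [d [l2 p2 yd sd cd]] := linked_sorted yt tt.
suff e : c = d by rewrite -e in l2; case: (linked_trans l1 (linked_sym l2)).
apply: (@colsort_uniq m predT) => // [i im _|i im _|p /andP[_ pm]]; [exact: cc|exact: cd|].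
rewrite orbF => /eqP ->; rewrite !take_oversize ?sc ?sd //.
by rewrite (perm_trans _ p2) // perm_sym (perm_trans _ p1) // perm_sym.
Qed.

Definition mx_unit (s t : seq nat) : hecke q m := xget 0 (munit s t).

Lemma mx_unitP s t : yam s -> yam t -> size s = m -> perm_eq s t ->
  munit s t (mx_unit s t).
Proof. by move=> ys yt ss st; exact: (xgetPex 0 (munit_exists ys yt ss st)). Qed.

End MatrixUnits.

(** * The number of pairs of standard tableaux of the same shape *)

Section CountPairs.
Implicit Types (mu nu : nat -> nat).
Local Open Scope nat_scope.

Definition shape (w : seq nat) : nat -> nat := fun r => count_mem r w.
Definition is_partition mu : bool := `[< forall r, mu r.+1 <= mu r >].
Definition add_box mu (r : nat) : nat -> nat := fun x => mu x + (x == r).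
Definition del_box mu (r : nat) : nat -> nat := fun x => mu x - (x == r).

Definition num_tab (m : nat) mu : nat := count (fun w => `[< shape w = mu >]) (yams m).

Lemma is_partitionP mu : reflect (forall r, mu r.+1 <= mu r) (is_partition mu).
Proof. exact: asboolP. Qed.

Lemma shape_rcons w r : shape (rcons w r) = add_box (shape w) r.
Proof. by apply/funext => x; rewrite /shape count_rcons eq_sym. Qed.

Lemma shape_eqP s t : (shape s = shape t) <-> perm_eq s t.
Proof.
split=> [h|/seq.permP h]; last by apply/funext => r; exact: h.
by apply/allP => x _ /=; apply/eqP; exact: (congr1 (fun f => f x) h).
Qed.

Lemma num_tab_gt0 m mu : 0 < num_tab m mu ->
  exists w, [/\ yam w, size w = m & shape w = mu].
Proof.
rewrite -has_count => /hasP[w]; rewrite mem_yams => /andP[yw /eqP sw] /asboolP e.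
by exists w.
Qed.

Lemma num_tab_not_partition m mu : ~~ is_partition mu -> num_tab m mu = 0.
Proof.
move=> h; apply/eqP; rewrite -leqn0 leqNgt; apply: contra h => /num_tab_gt0[w [yw _ <-]].
by apply/is_partitionP => r; exact: yam_shape.
Qed.

Lemma num_tab_support m mu r : 0 < num_tab m mu -> m <= r -> mu r = 0.
Proof.
move=> /num_tab_gt0[w [yw <- <-]] h; apply/eqP; rewrite -leqn0 leqNgt.
rewrite -has_count has_pred1; apply/negP => /(yam_mem_lt yw); rewrite ltnNge.
by rewrite h.
Qed.

Lemma addable_le w r : yam w -> addable w r -> r <= size w.
Proof.
move=> yw aw; have /(@yam_mem_lt _ r) : yam (rcons w r) by rewrite yam_rcons yw.
by rewrite mem_rcons mem_head size_rcons => /(_ isT).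
Qed.

Lemma yamsS m : yams m.+1 =
  [seq rcons w r | w <- yams m, r <- [seq r <- iota 0 m.+1 | addable w r]].
Proof. by []. Qed.

Lemma num_tab_succ M m mu : m < M -> is_partition mu ->
  num_tab m.+1 mu = \sum_(x < M | 0 < mu x) num_tab m (del_box mu x).
Proof.
move=> mM /is_partitionP pmu; rewrite /num_tab yamsS /allpairs_dep count_flatten sumnE !big_map.
transitivity (\sum_(w <- yams m) \sum_(x < M | 0 < mu x) `[< shape w = del_box mu x >]).
  apply: eq_big_seq => w; rewrite mem_yams => /andP[yw /eqP sw].
  rewrite count_map count_filter.
  rewrite -sum1_count big_mkcond -[iota 0 m.+1]/(index_iota 0 m.+1).
  transitivity (\sum_(0 <= x < M) (addable w x && `[< shape (rcons w x) = mu >])).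
    rewrite [RHS](@big_cat_nat _ _ _ m.+1) //= [X in _ + X]big_nat_cond.
    rewrite [X in _ + X]big1 => [|x /andP[/andP[mx _] _]].
      by rewrite addn0; apply: eq_bigr => x _; rewrite andbC; case: andP.
    by case: (boolP (addable w x)) => // /(addable_le yw); rewrite sw leqNgt mx.
  rewrite big_mkord [RHS]big_mkcond; apply: eq_bigr => x _; rewrite andbC.
  case: asboolP => [e|ne]; last first.
    case: ifP => // x0; case: asboolP => // e; case: ne; rewrite shape_rcons e.
    by apply/funext => y; rewrite /add_box /del_box; case: eqP => [->|]; lia.
  have E y : mu y = shape w y + (y == x) by rewrite -e shape_rcons.
  have -> : 0 < mu x by rewrite E eqxx addn1.
  have -> : `[< shape w = del_box mu x >].
    by apply/asboolP/funext => y; rewrite /del_box E; lia.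
  suff -> : addable w x by [].
  have addE r : addable w r = (r == 0) || (shape w r < shape w r.-1) by [].
  rewrite addE; case: (nat_of_ord x) E => // y E.
  by have := pmu y; rewrite !E -[y.+1.-1]/y; lia.
rewrite exchange_big /=; apply: eq_bigr => x _.
by rewrite -sum1_count [RHS]big_mkcond; apply: eq_bigr => w _; case: asboolP.
Qed.

(** Adding a box and removing another one commute. Adding a box and removing the
    same one is possible in one way more than the other way round, since the rows
    where a box can be added are the first one and those below a row where a box
    can be removed. *)
Lemma num_tab_add M m mu : m < M -> is_partition mu ->
  \sum_(r < M | is_partition (add_box mu r)) num_tab m.+1 (add_box mu r) =
  \sum_(x < M | (0 < mu x) && is_partition (del_box mu x))
    \sum_(r < M | is_partition (add_box (del_box mu x) r))
       num_tab m (add_box (del_box mu x) r) + num_tab m mu.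
Proof.
move=> mM pmu.
move/is_partitionP: (pmu) => pmu'.
(* The common terms, in which two different boxes are added and removed. *)
pose off (x r : 'I_M) := (x != r) * ((0 < mu x) * num_tab m (del_box (add_box mu r) x)).
have addP r : is_partition (add_box mu r) = (r == 0) || (mu r < mu r.-1).
  apply/is_partitionP/idP => [h|h y].
    case: r h => [|r] h //; have := h r; rewrite /add_box eqxx -[r.+1.-1]/r; lia.
  rewrite /add_box; have := pmu' y; case: (eqVneq y.+1 r) h => [<-|_ _]; rewrite -?[y.+1.-1]/y; lia.
have delP x : (0 < mu x) && is_partition (del_box mu x) = (mu x.+1 < mu x).
  apply/andP/idP => [[h /is_partitionP /(_ x)]|h].
    by rewrite /del_box eqxx; lia.
  split; first lia; apply/is_partitionP => y; rewrite /del_box.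
  by have := pmu' y; case: (eqVneq y x) => [->|_]; lia.
have L : \sum_(r < M | is_partition (add_box mu r)) num_tab m.+1 (add_box mu r) =
  \sum_(r < M) (is_partition (add_box mu r) * num_tab m mu + \sum_(x < M) off x r).
  rewrite big_mkcond; apply: eq_bigr => r _; case: ifPn => [pr|npr].
    have ar : 0 < add_box mu r r by rewrite /add_box eqxx addn1.
    rewrite (@num_tab_succ M) // (bigD1 r ar) /=.
    rewrite mul1n; congr (_ + _).
      by congr num_tab; apply/funext => y; rewrite /del_box /add_box; lia.
    rewrite [RHS](bigD1 r) //= /off eqxx mul0n add0n [LHS]big_mkcond [RHS]big_mkcond.
    apply: eq_bigr => x _; rewrite /add_box.
    case: (eqVneq x r) => [->|xr]; first by rewrite andbF.
    rewrite -val_eqE in xr; rewrite (negPf xr) andbT addn0 mul1n.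
    by case: ifP => _; rewrite ?mul1n ?mul0n.
  rewrite mul0n add0n big1 // => x _; rewrite /off.
  case: (eqVneq x r) => //= xr; rewrite mul1n.
  have [//|x0] := posnP (mu x); rewrite mul1n num_tab_not_partition //.
  apply: contra npr => /is_partitionP pnu; rewrite addP.
  rewrite -val_eqE /= in xr; case: (nat_of_ord r) xr pnu => // y xr /(_ y) /=.
  by rewrite /del_box /add_box eqxx; lia.
have R : \sum_(x < M | (0 < mu x) && is_partition (del_box mu x))
    \sum_(r < M | is_partition (add_box (del_box mu x) r))
       num_tab m (add_box (del_box mu x) r) =
  \sum_(x < M) (((0 < mu x) && is_partition (del_box mu x)) * num_tab m mu
                + \sum_(r < M) off x r).
  rewrite big_mkcond; apply: eq_bigr => x _; case: ifPn => [/andP[x0 px]|npx].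
    have eqx : add_box (del_box mu x) x = mu.
      by apply/funext => y; rewrite /del_box /add_box; case: (eqVneq y x) => [->|]; lia.
    rewrite (bigD1 x) ?eqx //= mul1n; congr (_ + _).
    rewrite [RHS](bigD1 x) //= /off eqxx mul0n add0n [LHS]big_mkcond [RHS]big_mkcond.
    apply: eq_bigr => r _; case: (eqVneq r x) => [->|rx]; first by rewrite andbF.
    rewrite andbT x0 !mul1n.
    have -> : del_box (add_box mu r) x = add_box (del_box mu x) r.
      apply/funext => y; rewrite /del_box /add_box; rewrite -val_eqE /= in rx.
      by case: (eqVneq y x) => [->|]; lia.
    by case: ifPn => // /num_tab_not_partition ->.
  rewrite mul0n add0n big1 // => r _; rewrite /off.
  case: (eqVneq x r) => //= xr; rewrite mul1n.
  have [//|x0] := posnP (mu x); rewrite mul1n num_tab_not_partition //.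
  apply: contra npx => /is_partitionP pnu; rewrite delP.
  rewrite -val_eqE /= in xr; have := pnu x.
  by rewrite /del_box /add_box eqxx; lia.
rewrite L R !big_split /= -!big_distrl /= [X in _ + X]exchange_big /= addnAC.
congr (_ + _); rewrite -mulSnr.
have [->|N0] := posnP (num_tab m mu); first by rewrite !muln0.
congr (_ * _); case: M mM {off L R} => // M mM.
have muM : mu M = 0 by exact: num_tab_support N0 mM.
rewrite big_ord_recl big_ord_recr /= delP muM ltn0 addn0 addP /= add1n.
by congr _.+1; apply: eq_bigr => x _; rewrite addP delP.
Qed.

(** Young's lattice is a differential poset: the inner sums in [num_tab_add] are
    known by induction, and the last box of a tableau is one of those that can be
    removed. *)
Lemma num_tab_up M m mu : m < M -> is_partition mu ->
  \sum_(r < M | is_partition (add_box mu r)) num_tab m.+1 (add_box mu r) =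
  m.+1 * num_tab m mu.
Proof.
elim: m mu => [|m IH] mu mM pmu; rewrite num_tab_add // mulSnr; congr (_ + _).
  rewrite mul0n big1 // => x _; rewrite big1 // => r _; apply/eqP.
  rewrite -leqn0 leqNgt; apply/negP => /num_tab_gt0[w [_ /size0nil -> e]].
  by have := congr1 (fun f => f (nat_of_ord r)) e; rewrite /add_box eqxx addn1.
rewrite (@num_tab_succ M) ?(ltnW mM) // big_distrr /= [RHS](bigID (fun x : 'I_M =>
  is_partition (del_box mu x))) /= [X in _ = _ + X]big1 => [|x /andP[_ np]]; last first.
  by rewrite num_tab_not_partition ?muln0.
by rewrite addn0; apply: eq_bigr => x /andP[_ px]; rewrite IH // ltnW.
Qed.

Lemma addableE w r : yam w -> addable w r = is_partition (add_box (shape w) r).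
Proof.
move=> yw; rewrite -shape_rcons; apply/idP/idP => [aw|/is_partitionP h].
  by apply/is_partitionP => y; apply: yam_shape; rewrite yam_rcons yw.
have addE : addable w r = (r == 0) || (shape w r < shape w r.-1) by [].
rewrite addE; case: r h {addE} => // r /(_ r); rewrite shape_rcons /add_box eqxx.
by rewrite -[r.+1.-1]/r; lia.
Qed.

Definition same_shape_pairs m : seq (seq nat * seq nat) :=
  [seq (s, t) | s <- yams m, t <- [seq t <- yams m | perm_eq s t]].

(** The classical identity that the squares of the dimensions add up to [m`!]:
    cutting off the last letter of the first word and summing over it with
    [num_tab_up] gives the factor [m]. *)
Lemma size_same_shape_pairs m : size (same_shape_pairs m) = m`!.
Proof.
rewrite size_allpairs_dep sumnE big_map.
transitivity (\sum_(s <- yams m) num_tab m (shape s)).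
  apply: eq_bigr => s _; rewrite size_filter; apply: eq_count => t.
  by apply/idP/asboolP => [|/shape_eqP]; [move/shape_eqP | rewrite perm_sym].
elim: m => [|m IH]; first by rewrite big_seq1 /num_tab /= asboolT.
rewrite factS -IH yamsS /allpairs_dep big_flatten big_map big_distrr.
apply: eq_big_seq => w; rewrite mem_yams => /andP[yw sw].
rewrite big_map big_filter -[iota 0 m.+1]/(index_iota 0 m.+1) big_mkord.
rewrite -[RHS]/(m.+1 * num_tab m (shape w)) -(@num_tab_up m.+1) //; last by apply/is_partitionP => r; exact: yam_shape.
apply: eq_big => [r|r _]; first exact: addableE.
by rewrite shape_rcons.
Qed.

Lemma uniq_yams m : uniq (yams m).
Proof.
elim: m => // m IH; apply: allpairs_uniq_dep => // [w _|].
  by rewrite filter_uniq // iota_uniq.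
by move=> [w r] [w' r'] _ _ /= /rcons_inj[-> ->].
Qed.

Lemma uniq_same_shape_pairs m : uniq (same_shape_pairs m).
Proof.
apply: allpairs_uniq_dep => [|w _|[w r] [w' r'] _ _ /= [-> ->] //].
  exact: uniq_yams.
by rewrite filter_uniq // uniq_yams.
Qed.

Lemma mem_same_shape_pairs m s t : ((s, t) \in same_shape_pairs m) =
  [&& yam s, yam t, size s == m & perm_eq s t].
Proof.
apply/allpairsPdep/and4P => [[s' [t' []]]|[ys yt ss st]].
  rewrite mem_filter !mem_yams => /andP[ys ss] /and3P[st yt _] [-> ->].
  by split.
exists s, t; rewrite mem_filter !mem_yams ys ss yt st -(perm_size st) ss.
by split.
Qed.

End CountPairs.

(** * Reduced words and Matsumoto's theorem *)

Section Matsumoto.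
Variables (F : fieldType) (q : F) (m : nat).
Implicit Types (w : 'S_m) (i j : 'I_m.-1) (s : seq 'I_m.-1).
Local Open Scope group_scope.

Definition simple i : 'S_m := tperm (lo i) (hi i).

(** The number of inversions, which is the length: see [ellE]. *)
Definition inv w : nat :=
  #|[set p : 'I_m * 'I_m | (p.1 < p.2)%N && (w p.2 < w p.1)%N]|.

Lemma simpleK i : simple i * simple i = 1.
Proof. exact: tperm2. Qed.

Lemma simpleKl i w : simple i * (simple i * w) = w.
Proof. by rewrite mulgA simpleK mul1g. Qed.

Lemma lohi_lt i : (lo i < hi i)%N.
Proof. exact: ltnSn. Qed.

Lemma simple_lo i w : (simple i * w) (lo i) = w (hi i).
Proof. by rewrite permM tpermL. Qed.

Lemma simple_hi i w : (simple i * w) (hi i) = w (lo i).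
Proof. by rewrite permM tpermR. Qed.

Lemma simple_mono i (x y : 'I_m) : ~~ ((x == lo i) && (y == hi i)) ->
  ~~ ((x == hi i) && (y == lo i)) -> (simple i x < simple i y)%N = (x < y)%N.
Proof.
rewrite -!val_eqE /simple !tperm_lohi /=.
by move: (nat_of_ord x) (nat_of_ord y) (nat_of_ord i) => a b c; do !case: ifPn; lia.
Qed.

(** Multiplication by [simple i] exchanges the values at two neighbouring places,
    which changes the status of that pair of places only. *)
Lemma inv_asc i w : (w (lo i) < w (hi i))%N -> inv (simple i * w) = (inv w).+1.
Proof.
move=> asc; rewrite /inv.
have na : (w (hi i) < w (lo i))%N = false by rewrite ltnNge ltnW.
pose f (p : 'I_m * 'I_m) := (simple i p.1, simple i p.2).
have fK : involutive f.
  by case=> x y; rewrite /f /simple /= !tpermK.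
rewrite -(card_imset _ (inv_inj fK)).
have -> : [set f p | p in [set p : 'I_m * 'I_m | (p.1 < p.2)%N &&
      ((simple i * w)%g p.2 < (simple i * w)%g p.1)%N]] =
    (hi i, lo i) |: [set p : 'I_m * 'I_m | (p.1 < p.2)%N && (w p.2 < w p.1)%N].
  apply/setP => -[x y]; rewrite (can_imset_pre _ fK) !inE /= !permM [X in w X]tpermK.
  rewrite [X in (_ < w X)%N]tpermK xpair_eqE; case: (boolP ((x == hi i) && (y == lo i))) => [/andP[/eqP-> /eqP->]|h].
    by rewrite tpermL tpermR lohi_lt asc.
  case: (boolP ((x == lo i) && (y == hi i))) => [/andP[/eqP-> /eqP->]|h'].
    by rewrite na !andbF.
  by rewrite simple_mono.
by rewrite cardsU1 !inE /= ltnNge ltnW ?lohi_lt.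
Qed.

Lemma inv_desc i w : (w (hi i) < w (lo i))%N -> inv w = (inv (simple i * w)).+1.
Proof.
by move=> h; rewrite -[in LHS](simpleKl i w) inv_asc // simple_lo simple_hi.
Qed.

Lemma asc_or_desc i w : {(w (lo i) < w (hi i))%N} + {(w (hi i) < w (lo i))%N}.
Proof.
case: (ltngtP (w (lo i)) (w (hi i))) => h; [by left | by right | exfalso].
by have := lohi_lt i; rewrite (perm_inj (val_inj h)) ltnn.
Qed.

(** An increasing self-map of an interval of integers lies both above and below
    the identity. *)
Lemma no_desc w : (forall i, (w (lo i) < w (hi i))%N) -> w = 1.
Proof.
move=> asc.
have asc' x (h : (x.+1 < m)%N) : (w (Ordinal (ltnW h)) < w (Ordinal h))%N.
  have hx : (x < m.-1)%N by rewrite ltn_predRL.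
  have e1 : lo (Ordinal hx) = Ordinal (ltnW h) by apply: val_inj.
  have e2 : hi (Ordinal hx) = Ordinal h by apply: val_inj.
  by have := asc (Ordinal hx); rewrite e1 e2.
have lb x (h : (x < m)%N) : (x <= w (Ordinal h))%N.
  elim: x h => // x IH h; have := IH (ltnW h); have := asc' x h.
  by move=> h1 h2; exact: leq_ltn_trans h2 h1.
have ub d x (h : (x < m)%N) : (m = x + d.+1)%N -> (w (Ordinal h) <= x)%N.
  elim: d x h => [|d IH] x h e; first by have := ltn_ord (w (Ordinal h)); lia.
  have h' : (x.+1 < m)%N by lia.
  have := asc' x h'; rewrite (bool_irrelevance (ltnW h') h) => h1.
  have := IH x.+1 h' ltac:(lia); lia.
apply/permP => -[x h]; rewrite perm1; apply/val_inj/eqP; rewrite eqn_leq /= lb andbT.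
by apply: (@ub (m - x.+1)%N); lia.
Qed.

Lemma inv1 : inv 1 = 0%N.
Proof.
apply/eqP; rewrite cards_eq0; apply/eqP/setP => p; rewrite !inE !perm1.
by case: (ltngtP p.1 p.2).
Qed.

Lemma word_perm_cons i s : word_perm (i :: s) = simple i * word_perm s.
Proof. exact: big_cons. Qed.

Lemma inv_word_perm s : (inv (word_perm s) <= size s)%N.
Proof.
elim: s => [|i s IH]; first by rewrite /word_perm big_nil inv1.
rewrite word_perm_cons; case: (asc_or_desc i (word_perm s)) => h.
  by rewrite inv_asc.
by apply: leq_trans (leqW IH); rewrite (inv_desc h) leqW.
Qed.

Lemma exists_word w : exists s, word_perm s = w /\ size s = inv w.
Proof.
have [n] := ubnP (inv w); elim: n w => // n IH w; rewrite ltnS => hn.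
have [h|h] := EM (exists i, (w (hi i) < w (lo i))%N); last first.
  exists [::]; rewrite (_ : w = 1) ?inv1 /word_perm ?big_nil //.
  by apply: no_desc => i; case: (asc_or_desc i w) => // hi; case: h; exists i.
case: h => i hi; have [|s [e1 e2]] := IH (simple i * w).
  by rewrite -(inv_desc hi).
by exists (i :: s); rewrite word_perm_cons e1 simpleKl /= e2 (inv_desc hi).
Qed.

Lemma reducedP w s : reduced w s <-> word_perm s = w /\ size s = inv w.
Proof.
split=> [[e h]|[e1 e2]]; split=> //.
  apply/eqP; rewrite eqn_leq -{2}e inv_word_perm andbT.
  by have [s' [e1 <-]] := exists_word w; exact: h.
by move=> s' e3; rewrite e2 -e3 inv_word_perm.
Qed.

Lemma red_wordP w : word_perm (red_word w) = w /\ size (red_word w) = inv w.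
Proof.
apply/reducedP; apply: xgetPex; have [s h] := exists_word w.
by exists s; apply/reducedP.
Qed.

Lemma ellE w : ell w = inv w.
Proof. by case: (red_wordP w). Qed.

Lemma reduced_cons w i s : word_perm (i :: s) = w -> size (i :: s) = inv w ->
  [/\ (w (hi i) < w (lo i))%N, word_perm s = simple i * w & size s = inv (simple i * w)].
Proof.
rewrite word_perm_cons => e1 e2.
have es : word_perm s = simple i * w by rewrite -e1 simpleKl.
have := inv_word_perm s; rewrite es.
case: (asc_or_desc i w) => h; first by rewrite (inv_asc h) -e2 /=; lia.
by move=> _; split=> //; apply/eqP; rewrite -eqSS -(inv_desc h) -e2.
Qed.

Lemma simple_comm i j : (i.+1 < j)%N || (j.+1 < i)%N ->
  simple i * simple j = simple j * simple i.
Proof.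
move=> h; have nij : (i != j :> nat) /\ (i.+1 != j) /\ (i != j.+1 :> nat) by lia.
apply/permP => x; rewrite !permM; apply/val_inj; rewrite /= /simple !tperm_lohi.
by move: (nat_of_ord x) (nat_of_ord i) (nat_of_ord j) nij => a b c;
  do !case: ifPn; lia.
Qed.

Lemma simple_braid i j : j = i.+1 :> nat ->
  simple i * simple j * simple i = simple j * simple i * simple j.
Proof.
move=> h; apply/permP => x; rewrite !permM; apply/val_inj; rewrite /= /simple !tperm_lohi.
by move: (nat_of_ord x) (nat_of_ord i) (nat_of_ord j) h => a b c ->;
  do !case: ifPn; lia.
Qed.

Lemma simple_far i j : (i.+1 < j)%N || (j.+1 < i)%N ->
  (simple i (lo j) = lo j) * (simple i (hi j) = hi j).
Proof.
by move=> h; split; rewrite tpermD // -val_eqE /=; lia.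
Qed.

Definition hprod s : hecke q m := (\prod_(i <- s) hgen q i)%R.

Lemma hprod_cons i s : hprod (i :: s) = (hgen q i * hprod s)%R.
Proof. exact: big_cons. Qed.

(** Two reduced words starting with commuting letters [i] and [j] can be replaced,
    by induction on the length, by words starting with [i j] and [j i]. *)
Lemma hprod_reduced_far w i j u v : (i.+1 < j)%N || (j.+1 < i)%N ->
  (forall w' s s', (inv w' < inv w)%N -> word_perm s = w' -> word_perm s' = w' ->
     size s = inv w' -> size s' = inv w' -> hprod s = hprod s') ->
  word_perm (i :: u) = w -> word_perm (j :: v) = w ->
  size (i :: u) = inv w -> size (j :: v) = inv w ->
  hprod (i :: u) = hprod (j :: v).
Proof.
move=> ij IH eu ev su sv.
have [di eu' su'] := reduced_cons eu su; have [dj ev' sv'] := reduced_cons ev sv.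
have [r [er sr]] := exists_word (simple j * (simple i * w)).
have dji : ((simple i * w)%g (hi j) < (simple i * w)%g (lo j))%N.
  by rewrite !permM !(simple_far ij).
have ivi := inv_desc di; have ivj := inv_desc dj; have ivji := inv_desc dji.
rewrite !hprod_cons (IH _ u (j :: r) _ eu') //; first last.
- by rewrite /= sr ivji.
- by rewrite word_perm_cons er simpleKl.
- by rewrite ivi.
rewrite (IH _ v (i :: r) _ ev') //; first last.
- by rewrite /= sr; lia.
- by rewrite word_perm_cons er !mulgA simple_comm // -!mulgA simpleKl.
- by rewrite ivj.
by have [_ _ cm] := hgen_rel q m; rewrite !hprod_cons !mulrA (cm _ _ ij).
Qed.

(** As before, with [i j i] and [j i j]. *)
Lemma hprod_reduced_adj w i j u v : j = i.+1 :> nat ->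
  (forall w' s s', (inv w' < inv w)%N -> word_perm s = w' -> word_perm s' = w' ->
     size s = inv w' -> size s' = inv w' -> hprod s = hprod s') ->
  word_perm (i :: u) = w -> word_perm (j :: v) = w ->
  size (i :: u) = inv w -> size (j :: v) = inv w ->
  hprod (i :: u) = hprod (j :: v).
Proof.
move=> ij IH eu ev su sv.
have [di eu' su'] := reduced_cons eu su; have [dj ev' sv'] := reduced_cons ev sv.
have lj : lo j = hi i by exact: val_inj.
have hj : simple i (hi j) = hi j by rewrite tpermD // -val_eqE /= ij; lia.
have li : simple j (lo i) = lo i by rewrite tpermD // -val_eqE /= ij; lia.
have d2 : ((simple i * w)%g (hi j) < (simple i * w)%g (lo j))%N.
  by rewrite lj simple_hi permM hj; apply: ltn_trans di; rewrite -lj.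
have d3 : ((simple j * (simple i * w))%g (hi i) < (simple j * (simple i * w))%g (lo i))%N.
  by rewrite -lj simple_lo !permM li hj tpermL -lj.
have [r [er sr]] := exists_word (simple i * (simple j * (simple i * w))).
have iv1 := inv_desc di; have iv2 := inv_desc d2; have iv3 := inv_desc d3.
have ivj := inv_desc dj.
rewrite !hprod_cons (IH _ u (j :: i :: r) _ eu') //; first last.
- by rewrite /= sr; lia.
- by rewrite !word_perm_cons er !simpleKl.
- by rewrite iv1.
rewrite (IH _ v (i :: j :: r) _ ev') //; first last.
- by rewrite /= sr; lia.
- rewrite !word_perm_cons er.
  transitivity (simple i * simple j * simple i * (simple j * (simple i * w))).
    by rewrite !mulgA.
  by rewrite simple_braid // -!mulgA !simpleKl.
- by rewrite ivj.
by have [_ br _] := hgen_rel q m; rewrite !hprod_cons !mulrA (br _ _ ij).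
Qed.

(** Matsumoto's theorem, in the Hecke algebra: the arbitrary choice of a reduced
    word in the definition of [hsig] is harmless. *)
Lemma hprod_reduced w s s' : word_perm s = w -> word_perm s' = w ->
  size s = inv w -> size s' = inv w -> hprod s = hprod s'.
Proof.
have [n] := ubnP (inv w); elim: n w s s' => // n IH w s s' hn.
have IH' w' t t' : (inv w' < inv w)%N -> word_perm t = w' -> word_perm t' = w' ->
     size t = inv w' -> size t' = inv w' -> hprod t = hprod t'.
  by move=> h; apply: IH; rewrite ltnS in hn; exact: leq_trans hn.
case: s => [|i u]; case: s' => [|j v] es es' ss ss' //.
- by rewrite -ss in ss'.
- by rewrite -ss' in ss.
have [eij|nij] := eqVneq i j.
  subst j; have [di eu su] := reduced_cons es ss.
  have [dj ev sv] := reduced_cons es' ss'.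
  by rewrite !hprod_cons (IH' _ u v _ eu ev su sv) // (inv_desc di).
rewrite -val_eqE /= in nij; have sv := ss'.
have [h|h] := boolP ((i.+1 < j)%N || (j.+1 < i)%N).
  exact: hprod_reduced_far h IH' es es' ss sv.
have [ij|ij] := eqVneq (j : nat) i.+1; first exact: hprod_reduced_adj ij IH' es es' ss sv.
apply/esym; apply: hprod_reduced_adj IH' es' es sv ss.
by move: h nij ij; lia.
Qed.

Lemma hsig_asc i w : (w (lo i) < w (hi i))%N ->
  (hgen q i * hsig q w = hsig q (simple i * w)%g)%R.
Proof.
move=> h; have [e1 e2] := red_wordP w; have [e3 e4] := red_wordP (simple i * w).
rewrite -[hsig q w]/(hprod (red_word w)) -hprod_cons.
apply: (hprod_reduced _ e3 _ e4); rewrite ?word_perm_cons ?e1 //=.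
by rewrite e2 inv_asc.
Qed.

Lemma hsig_desc i w : (w (hi i) < w (lo i))%N ->
  (hgen q i * hsig q w = (q - q^-1) *: hsig q w + hsig q (simple i * w)%g)%R.
Proof.
move=> h; have e : (hgen q i * hsig q (simple i * w)%g = hsig q w)%R.
  by rewrite hsig_asc ?simpleKl // simple_lo simple_hi.
have [quad _ _] := hgen_rel q m.
by rewrite -{1}e mulrA quad mulrDl mul1r -scalerAl e.
Qed.

Lemma hsig1 : hsig q (1 : 'S_m) = 1%R.
Proof.
have [_] := red_wordP 1; rewrite inv1 => /size0nil e.
by rewrite /hsig e big_nil.
Qed.

End Matsumoto.

(** * The seminormal representations are jointly faithful *)

Section HeckeInduction.
Variables (F : fieldType) (q : F) (m : nat).

Lemma hecke_ind (P : hecke q m -> Prop) :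
  (forall a, P (a *: 1)) -> (forall i, P (hgen q i)) ->
  (forall x y, P x -> P y -> P (x + y)) -> (forall x y, P x -> P y -> P (x * y)) ->
  forall x, P x.
Proof.
move=> Ps Pg Pa Pm; elim/heckeW; elim=> [a|i|x IHx y IHy|x IHx y IHy].
- by rewrite -[hcls _ _]mulr1; exact: Ps.
- exact: Pg.
- by rewrite -hadd_pi; exact: Pa.
- by rewrite -hmul_pi; exact: Pm.
Qed.

Definition hsig_sum (x : hecke q m) : Prop :=
  exists c : 'S_m -> F, x = \sum_w c w *: hsig q w.

Lemma hsig_sumD x y : hsig_sum x -> hsig_sum y -> hsig_sum (x + y).
Proof.
move=> [c ->] [d ->]; exists (fun w => c w + d w).
by rewrite -big_split; apply: eq_bigr => w _; rewrite scalerDl.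
Qed.

Lemma hsig_sumZ a x : hsig_sum x -> hsig_sum (a *: x).
Proof.
move=> [c ->]; exists (fun w => a * c w).
by rewrite scaler_sumr; apply: eq_bigr => w _; rewrite scalerA.
Qed.

Lemma hsig_sum_hsig w : hsig_sum (hsig q w).
Proof.
exists (fun w' => (w' == w)%:R); rewrite (bigD1 w) //= eqxx scale1r big1 ?addr0 //.
by move=> w' /negPf ->; rewrite scale0r.
Qed.

Lemma hsig_sum_sum (I : Type) (r : seq I) (E : I -> hecke q m) :
  (forall i, hsig_sum (E i)) -> hsig_sum (\sum_(i <- r) E i).
Proof.
move=> h; elim/big_rec: _ => [|i x _]; last exact: hsig_sumD.
by exists (fun=> 0); rewrite big1 // => w _; rewrite scale0r.
Qed.

(** The span of the [hsig q w] contains 1 and is stable under left multiplication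
    by the generators. *)
Lemma hsig_span x : hsig_sum x.
Proof.
suff h z : forall y, hsig_sum y -> hsig_sum (z * y).
  by rewrite -[x]mulr1; apply: h; rewrite -(hsig1 q m); exact: hsig_sum_hsig.
elim/hecke_ind: z => [a|i|u v hu hv|u v hu hv] y hy.
- by rewrite -scalerAl mul1r; exact: hsig_sumZ.
- case: hy => c ->; rewrite mulr_sumr; apply: hsig_sum_sum => w.
  rewrite -scalerAr; apply: hsig_sumZ; case: (asc_or_desc i w) => h.
    by rewrite hsig_asc //; exact: hsig_sum_hsig.
  rewrite hsig_desc //; apply: hsig_sumD; last exact: hsig_sum_hsig.
  by apply: hsig_sumZ; exact: hsig_sum_hsig.
- by rewrite mulrDl; apply: hsig_sumD; [exact: hu | exact: hv].
- by rewrite -mulrA; apply: hu; exact: hv.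
Qed.

End HeckeInduction.

Lemma sum_count_mem (w : seq nat) M : (forall r, r \in w -> (r < M)%N) ->
  (\sum_(r < M) count_mem (nat_of_ord r) w)%N = size w.
Proof.
elim: w => [|a w IH] h; first by rewrite big1.
have aM : (a < M)%N by apply: h; rewrite mem_head.
rewrite /= big_split /= IH => [|r rw]; last by apply: h; rewrite inE rw orbT.
rewrite (bigD1 (Ordinal aM)) //= eqxx big1 ?addn0 ?add1n // => r.
by rewrite -val_eqE /= eq_sym => /negPf ->.
Qed.

Lemma part_of_word m w : yam w -> size w = m -> exists la : part m, shaped la w.
Proof.
move=> yw sw.
have cm r : (count_mem r w < m.+1)%N by rewrite ltnS -sw count_size.
pose l := [tuple Ordinal (cm (nat_of_ord r)) | r < m].
have lE : [seq val i | i <- l] = [seq count_mem r w | r <- iota 0 m].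
  by rewrite -val_enum_ord -[enum 'I_m]/(tval (ord_tuple m)) /l /= -!map_comp; exact: eq_map.
have pl : is_part l.
  apply/andP; split; rewrite lE.
    apply: (homo_sorted (e := ltn)); last exact: iota_ltn_sorted.
    by move=> x y /ltnW h; exact: yam_shape_le.
  rewrite sumnE big_map -[X in iota 0 X]subn0 -/(index_iota 0 m) big_mkord sum_count_mem ?sw //.
  by move=> r; rewrite -sw; exact: yam_mem_lt.
exists (exist (fun l => is_part l) l pl); split=> // r.
rewrite /prow /parts /= lE; case: (ltnP r m) => h.
  by rewrite (nth_map 0%N) ?size_iota // nth_iota.
rewrite nth_default ?size_map ?size_iota //; apply/eqP.
rewrite -leqn0 leqNgt -has_count has_pred1; apply/negP => /(yam_mem_lt yw).
by rewrite sw ltnNge h.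
Qed.

Lemma wcoef_vtab m (la : part m) (F : fieldType) (t : STab la) w :
  wcoef (vtab F (val t)) w = (w == rw t)%:R.
Proof.
rewrite /wcoef; case: pickP => [t' /eqP <-|h].
  by rewrite ffunE (inj_eq (@rw_inj _ _)) (inj_eq val_inj).
by have := h t; rewrite eq_sym => ->.
Qed.

Section Faithful.
Variables (F : fieldType) (q : F) (m : nat).
Hypothesis q_neq0 : q != 0.
Hypothesis qint_neq0 : forall L : int, L != 0 -> qint q L != 0.

Let N := #|{: 'S_m}|.
Let L := same_shape_pairs m.
Let E (k : 'I_N) : hecke q m :=
  mx_unit q m (nth ([::], [::]) L k).1 (nth ([::], [::]) L k).2.

Let sizeL : size L = N.
Proof. by rewrite size_same_shape_pairs /N card_Sn. Qed.

(** Applied to the basis vector of the tableau [t], a combination of matrix units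
    shows its coefficient at [(s, t)] as the coordinate at [s]. *)
Let E_sep (y : 'I_N -> F) :
  (forall la (v : Vmod F la), Vrep (\sum_k y k *: E k) v = 0) -> forall k, y k = 0.
Proof.
move=> h k; set st := nth ([::], [::]) L k.
have kL (l : 'I_N) : (l < size L)%N by rewrite sizeL.
have stP (l : 'I_N) : let p := nth ([::], [::]) L l in
    [/\ yam p.1, yam p.2, size p.1 = m & perm_eq p.1 p.2].
  move=> p; have := mem_nth ([::], [::]) (kL l); rewrite -/p [p]surjective_pairing.
  by rewrite mem_same_shape_pairs => /and4P[? ? /eqP ? ?].
have [ys yt ss pst] := stP k; rewrite -/st in ys yt ss pst.
have st2 : size st.2 = m by rewrite -(perm_size pst).
have [la /rw_onto[t et]] := part_of_word yt st2.
have := congr1 (fun u => wcoef u st.1) (h la (vtab F (val t))).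
rewrite Vrep_sum // wcoef0.
have -> : wcoef (\sum_i Vrep (y i *: E i) (vtab F (val t))) st.1 =
          \sum_i wcoef (Vrep (y i *: E i) (vtab F (val t))) st.1.
  by apply: (big_morph (fun u => wcoef u st.1)) => [u u'|]; rewrite ?wcoefD ?wcoef0.
rewrite (bigD1 k) //= big1 ?addr0 => [|l lk].
  rewrite VrepZ // wcoefZ mx_unitP // eqxx mul1r wcoef_vtab et eqxx mulr1 //.
have [yls ylt ssl pl] := stP l.
rewrite VrepZ // wcoefZ mx_unitP // wcoef_vtab et.
case: eqP => e1; last by rewrite mul0r mulr0.
case: eqP => e2; last by rewrite !mulr0.
case/eqP: lk; apply: val_inj; apply/eqP.
rewrite -(nth_uniq ([::], [::]) (kL l) (kL k) (uniq_same_shape_pairs m)).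
by apply/eqP; rewrite -/st [RHS]surjective_pairing e1 -e2 -surjective_pairing.
Qed.

(** The matrix units are [m`!] linearly independent elements in the span of the
    [m`!] elements [hsig q w], hence they span the Hecke algebra. *)
Lemma hecke_faithful (x : hecke q m) :
  (forall la (v : Vmod F la), Vrep x v = 0) -> x = 0.
Proof.
move=> x0.
have [c cE] := @boolp.choice _ _ (fun k c => E k = \sum_w c w *: hsig q w)
  (fun k => hsig_span (E k)).
pose w_ (l : 'I_N) : 'S_m := enum_val l.
have sumw (f : 'S_m -> hecke q m) : \sum_w f w = \sum_l f (w_ l).
  apply: reindex; exists (fun w => enum_rank w) => w _; first exact: enum_valK.
  exact: enum_rankK.
pose M := \matrix_(k < N, l < N) c k (w_ l).
have EM k : E k = \sum_l M k l *: hsig q (w_ l).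
  by rewrite cE sumw; apply: eq_bigr => l _; rewrite mxE.
have Mfree : row_free M.
  apply: inj_row_free => z zM; apply/rowP => k; rewrite mxE.
  apply: (E_sep (y := fun k => z 0 k)) => la v.
  suff -> : \sum_k z 0 k *: E k = 0 by rewrite Vrep0.
  under eq_bigr => i _ do rewrite EM scaler_sumr.
  rewrite exchange_big big1 // => l _.
  have := congr1 (fun A : 'rV_N => A 0 l) zM; rewrite !mxE => e.
  by under eq_bigr => i _ do rewrite scalerA; rewrite -scaler_suml e scale0r.
have Mu : M \in unitmx by rewrite -row_free_unit.
have hE l : hsig q (w_ l) = \sum_k invmx M l k *: E k.
  under eq_bigr => i _ do rewrite EM scaler_sumr.
  rewrite exchange_big /=.
  have e l' : \sum_k (invmx M l k * M k l') = (l == l')%:R.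
    by have := congr1 (fun A : 'M_N => A l l') (mulVmx Mu); rewrite !mxE.
  rewrite [RHS](bigD1 l) //= [X in _ + X]big1 ?addr0 => [|l' ll'].
    by under eq_bigr => i _ do rewrite scalerA; rewrite -scaler_suml e eqxx scale1r.
  under eq_bigr => i _ do rewrite scalerA.
  by rewrite -scaler_suml e eq_sym (negPf ll') scale0r.
have [d dE] := hsig_span x; rewrite sumw in dE.
pose y k := \sum_l d (w_ l) * invmx M l k.
have xE : x = \sum_k y k *: E k.
  rewrite dE; under eq_bigr => l _ do rewrite hE scaler_sumr.
  rewrite exchange_big; apply: eq_bigr => k _.
  by under eq_bigr => l _ do rewrite scalerA; rewrite -scaler_suml.
rewrite xE big1 // => k _; rewrite E_sep ?scale0r // => la v.
by rewrite -xE x0.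
Qed.

End Faithful.

(** * The symmetriser *)

Section Poincare.

Lemma inv_sum m (w : 'S_m) :
  inv w = (\sum_(x < m) \sum_(y < m) ((x < y) && (w y < w x)))%N.
Proof.
rewrite /inv -sum1dep_card big_mkcond pair_bigA; apply: eq_bigr => p _.
by case: ifP.
Qed.

(** The inversions that involve the first place are counted by the value taken
    there. *)
Lemma inv_lift_perm m (j : 'I_m.+1) (s : 'S_m) :
  inv (lift_perm ord0 j s) = (j + inv s)%N.
Proof.
rewrite !inv_sum big_ord_recl /= lift_perm_id; congr (_ + _)%N.
  rewrite big_ord_recl /= add0n.
  under eq_bigr => k _ do rewrite lift_perm_lift.
  rewrite (reindex_inj (perm_inj (s := s^-1)%g)) /=.
  under eq_bigr => k _ do rewrite permKV.
  have jm : (j <= m)%N by rewrite -ltnS.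
  transitivity (\sum_(k < m) (k < j))%N.
    apply: eq_bigr => k _; congr nat_of_bool; rewrite /bump.
    by case: leqP => h; apply/idP/idP; lia.
  have -> : (\sum_(k < m) (k < j))%N = #|[set k : 'I_m | (k < j)%N]|.
    rewrite -sum1dep_card [RHS]big_mkcond; apply: eq_bigr => k _; by case: ifP.
  have winj : injective (widen_ord jm) by move=> x y /(congr1 val) /= /val_inj.
  rewrite -[RHS](card_ord j) -(card_imset _ winj).
  apply: eq_card => k; rewrite inE; apply/idP/imsetP => [h|[l _ ->]]; last exact: (ltn_ord l).
  by exists (Ordinal h) => //; exact: val_inj.
apply: eq_bigr => k _; rewrite big_ord_recl /= add0n.
apply: eq_bigr => l _; rewrite !lift_perm_lift /= /bump !add1n ltnS; congr nat_of_bool.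
by congr (_ && _); apply/idP/idP; do 2 case: leqP; lia.
Qed.

Lemma poincare_poly (F : fieldType) (x : F) m :
  \sum_(w : 'S_m) x ^+ inv w = \prod_(i < m) \sum_(j < i.+1) x ^+ j.
Proof.
elim: m => [|m IH].
  rewrite big_ord0 (big_pred1 1%g) => [|w]; first by rewrite inv1.
  by apply/esym/eqP/permP => -[].
rewrite big_ord_recr /= -IH big_distrl /=.
under [RHS]eq_bigr => s _ do rewrite big_distrr /=.
pose f (p : 'S_m * 'I_m.+1) : 'S_m.+1 := lift_perm ord0 p.2 p.1.
have finj : injective f.
  move=> [s j] [s' j']; rewrite /f /= => e.
  have ej : j = j' by rewrite -(lift_perm_id ord0 j s) e lift_perm_id.
  rewrite -ej in e *; congr (_, _); apply/permP => k.
  by apply: (@lift_inj _ j); rewrite -(lift_perm_lift ord0 j s) e lift_perm_lift.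
have fbij : bijective f.
  by apply: inj_card_bij => //; rewrite card_prod !card_Sn card_ord factS mulnC.
rewrite pair_bigA /= (reindex f) /=; last exact: onW_bij.
by apply: eq_bigr => -[s j] _; rewrite /f /= inv_lift_perm addnC exprD.
Qed.

Variables (F : fieldType) (q : F).
Hypothesis q_neq0 : q != 0.
Hypothesis qint_neq0 : forall L : int, L != 0 -> qint q L != 0.

(** Relates the factors of the Poincare polynomial to quantum integers, which do
    not vanish. *)
Lemma jmval_geometric n : jmval q n%:Z = q * \sum_(j < n) q ^+ 2 ^+ j.
Proof.
elim: n => [|n IH]; first by rewrite jmval0 big_ord0 mulr0.
rewrite intS jmvalD // IH jmval1 // -[q ^ 1]/q big_ord_recl expr0 mulrDr mulr1.
congr (_ + _); rewrite [in LHS]mulrCA !mulr_sumr; apply: eq_bigr => j _.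
by rewrite /= /bump add1n [in RHS]exprS expr2 !mulrA.
Qed.

Lemma poincare_neq0 m : \sum_(w : 'S_m) q ^+ (2 * ell w) != 0.
Proof.
under eq_bigr => w _ do rewrite ellE exprM.
rewrite poincare_poly; apply/prodf_neq0 => i _; apply/eqP => h.
have := @jmval_neq0 _ _ q_neq0 qint_neq0 i.+1%:Z isT.
by rewrite jmval_geometric h mulr0 eqxx.
Qed.

Variable m : nat.

(** The terms of [w] and of its product with the simple transposition are matched:
    their sum is an eigenvector of the generator for the eigenvalue [q]. *)
Lemma hgen_qsym (i : 'I_m.-1) : hgen q i * qsym q m = q *: qsym q m.
Proof.
rewrite /qsym -scalerAr scalerA mulrC -scalerA; congr (_ *: _).
rewrite mulr_sumr scaler_sumr.
have reidx : \sum_(w : 'S_m) q ^+ ell w *: hsig q (simple i * w)%g =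
             \sum_(w : 'S_m) q ^+ ell (simple i * w)%g *: hsig q w.
  rewrite [RHS](reindex_inj (mulgI (simple i))); apply: eq_bigr => w _.
  by rewrite simpleKl.
transitivity (\sum_(w : 'S_m) q ^+ ell w *: hsig q (simple i * w)%g +
  \sum_(w : 'S_m) (if (w (hi i) < w (lo i))%N then
     (q - q^-1) * q ^+ ell w else 0) *: hsig q w).
  rewrite -big_split /=; apply: eq_bigr => w _; rewrite -scalerAr.
  case: (asc_or_desc i w) => h.
    by rewrite hsig_asc // ltnNge (ltnW h) /= scale0r addr0.
  by rewrite h hsig_desc // scalerDr scalerA [_ * (q - _)]mulrC addrC.
rewrite reidx -big_split /=; apply: eq_bigr => w _.
rewrite -scalerDl scalerA; congr (_ *: _); rewrite !ellE.
case: (asc_or_desc i w) => h.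
  by rewrite inv_asc // ltnNge (ltnW h) /= addr0 exprS.
by rewrite h (inv_desc h) exprS; move: (q ^+ _) => x; field.
Qed.

End Poincare.

Section Parabolic.
Variables (F : fieldType) (q : F).

Lemma hgen_natE m i (h : (i < m.-1)%N) : hgen_nat q m i = hgen q (Ordinal h).
Proof. by rewrite /hgen_nat insubT. Qed.

Lemma hgen_nat_comm m i j : (i < m.-1)%N -> (j < m.-1)%N ->
  (i.+1 < j)%N || (j.+1 < i)%N ->
  hgen_nat q m i * hgen_nat q m j = hgen_nat q m j * hgen_nat q m i.
Proof.
by move=> hi hj h; rewrite !hgen_natE; have [_ _ cm] := hgen_rel q m; exact: cm.
Qed.

Lemma hshift_rel m M j : (j + m <= M)%N ->
  hecke_rel q (fun i : 'I_m.-1 => hgen_nat q M (j + i)).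
Proof.
move=> h; have lt (i : 'I_m.-1) : (j + i < M.-1)%N by have := ltn_ord i; lia.
have [r1 r2 r3] := hgen_rel q M; split=> [i|i i' e|i i' e]; rewrite !hgen_natE.
- exact: r1.
- by apply: r2; rewrite /= e addnS.
- by apply: r3; rewrite /=; lia.
Qed.

Section Shift.
Variables (m M j : nat).
Hypothesis jmM : (j + m <= M)%N.

Lemma hshift_gen (i : 'I_m.-1) :
  hshift M j (hgen q i) = hgen_nat q M (j + i).
Proof. by have [h _ _ _] := hliftP (hshift_rel jmM); exact: h. Qed.

Lemma hshift_linear : linear (@hshift F q m M j).
Proof. by have [_ h _ _] := hliftP (hshift_rel jmM). Qed.

Lemma hshift1 : @hshift F q m M j 1 = 1.
Proof. by have [_ _ h _] := hliftP (hshift_rel jmM). Qed.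

Lemma hshiftM x y : @hshift F q m M j (x * y) = hshift M j x * hshift M j y.
Proof. by have [_ _ _ h] := hliftP (hshift_rel jmM); exact: h. Qed.

Lemma hshiftD x y : @hshift F q m M j (x + y) = hshift M j x + hshift M j y.
Proof. by have := hshift_linear 1 x y; rewrite !scale1r. Qed.

Lemma hshift0 : @hshift F q m M j 0 = 0.
Proof. by have := hshiftD 0 0; rewrite addr0 -{1}[hshift M j 0]addr0 => /addrI. Qed.

Lemma hshiftZ a x : @hshift F q m M j (a *: x) = a *: hshift M j x.
Proof. by have := hshift_linear a x 0; rewrite hshift0 !addr0. Qed.

Lemma hshift_comm (y : hecke q M) (x : hecke q m) :
  (forall i : 'I_m.-1, y * hgen_nat q M (j + i) = hgen_nat q M (j + i) * y) ->
  y * hshift M j x = hshift M j x * y.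
Proof.
move=> h; elim/hecke_ind: x => [a|i|u v hu hv|u v hu hv].
- by rewrite hshiftZ hshift1 -scalerAl -scalerAr mul1r mulr1.
- by rewrite hshift_gen h.
- by rewrite hshiftD mulrDl mulrDr hu hv.
- by rewrite hshiftM mulrA hu -mulrA hv mulrA.
Qed.

End Shift.

Hypothesis q_neq0 : q != 0.
Hypothesis qint_neq0 : forall L : int, L != 0 -> qint q L != 0.

Section ShiftSymmetriser.
Variables (m M j : nat).
Hypothesis jmM : (j + m <= M)%N.

Lemma hshift_qsym_gen (i : nat) : (i.+1 < m)%N ->
  hgen_nat q M (j + i) * hshift M j (qsym q m) = q *: hshift M j (qsym q m).
Proof.
rewrite -ltn_predRL => im; rewrite -(hshift_gen jmM (Ordinal im)) -hshiftM //.
by rewrite hgen_qsym // hshiftZ.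
Qed.

Lemma hshift_qsym_fix la (v : Vmod F la) :
  (forall i, (i.+1 < m)%N -> Vrep (hgen_nat q M (j + i)) v = q *: v) ->
  Vrep (hshift M j (qsym q m)) v = v.
Proof.
move=> h; have hs (w : 'S_m) : Vrep (hshift M j (hsig q w)) v = q ^+ ell w *: v.
  rewrite /ell /hsig; elim: (red_word w) => [|i s IH].
    by rewrite big_nil hshift1 // Vrep1 // expr0 scale1r.
  rewrite big_cons hshiftM // hshift_gen // VrepM // IH VrepS // h -?ltn_predRL //.
  by rewrite scalerA exprSr.
rewrite /qsym hshiftZ // VrepZ //.
have -> : hshift M j (\sum_(w : 'S_m) q ^+ ell w *: hsig q w) =
          \sum_(w : 'S_m) q ^+ ell w *: hshift M j (hsig q w).
  transitivity (\sum_(w : 'S_m) hshift M j (q ^+ ell w *: hsig q w)).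
    by apply: (big_morph (fun x => @hshift F q m M j x)) => [x y|]; rewrite ?hshiftD ?hshift0.
  by apply: eq_bigr => w _; rewrite hshiftZ //.
rewrite Vrep_sum //.
have -> : \sum_(w : 'S_m) Vrep (q ^+ ell w *: hshift M j (hsig q w)) v =
          \sum_(w : 'S_m) q ^+ (2 * ell w) *: v.
  by apply: eq_bigr => w _; rewrite VrepZ // hs scalerA -exprD addnn -mul2n.
by rewrite -scaler_suml scalerA mulVf ?scale1r // poincare_neq0.
Qed.

End ShiftSymmetriser.

Section Fused.
Variables (k : nat -> nat) (n : nat).

(** The indices of the generators of the parabolic subalgebra: the positions
    [i] such that [i] and [i+1] belong to the same block. *)
Definition inblock (i : nat) : bool :=
  [exists a : 'I_n, (psum k a <= i)%N && (i.+1 < psum k a.+1)%N].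

Lemma psumS a : psum k a.+1 = (psum k a + k a)%N.
Proof. exact: big_ord_recr. Qed.

Lemma psum_mono a b : (a <= b)%N -> (psum k a <= psum k b)%N.
Proof.
by move=> /subnK <-; elim: (b - a)%N => // d IH; rewrite addSn psumS (leq_trans IH) // leq_addr.
Qed.

Lemma inblockP i : reflect
  (exists2 a, (a < n)%N & (psum k a <= i)%N && (i.+1 < psum k a.+1)%N) (inblock i).
Proof.
apply: (iffP existsP) => [[a h]|[a an h]]; first by exists a.
by exists (Ordinal an).
Qed.

Lemma inblock_lt i : inblock i -> (i.+1 < psum k n)%N.
Proof. by case/inblockP => a an /andP[_ h]; exact: leq_trans h (psum_mono an). Qed.

Let e (a : nat) : hecke q (psum k n) := hshift (psum k n) (psum k a) (qsym q (k a)).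

(** The generator commutes with the symmetrisers of the other blocks and is
    absorbed by that of its own block. *)
Lemma fidem_gen i : inblock i ->
  hgen_nat q (psum k n) i * fidem q k n = q *: fidem q k n.
Proof.
case/inblockP => b bn /andP[bi ib].
have fit a : (a < n)%N -> (psum k a + k a <= psum k n)%N.
  by move=> an; rewrite -psumS psum_mono.
have im : (i < (psum k n).-1)%N.
  by rewrite ltn_predRL; exact: leq_trans ib (psum_mono bn).
have comm a : (a < n)%N -> a != b -> hgen_nat q (psum k n) i * e a =
    e a * hgen_nat q (psum k n) i.
  move=> an ab; apply: hshift_comm (fit a an) _ _ _ => j; have jk := ltn_ord j.
  apply: hgen_nat_comm => //; first by have := fit a an; lia.
  case: (ltngtP a b) ab => // ab _.
    by have := psum_mono ab; rewrite psumS; lia.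
  by have := psum_mono ab; lia.
have own : hgen_nat q (psum k n) i * e b = q *: e b.
  rewrite -(subnKC bi); apply: hshift_qsym_gen; first exact: fit.
  move: bi ib; rewrite psumS; lia.
rewrite /fidem -/(psum k n).
have key n' : (n' <= n)%N -> hgen_nat q (psum k n) i * \prod_(a < n') e a =
    if (b < n')%N then q *: \prod_(a < n') e a
    else \prod_(a < n') e a * hgen_nat q (psum k n) i.
  elim: n' => [|n' IH] h; first by rewrite big_ord0 mulr1 mul1r.
  rewrite big_ord_recr /= mulrA IH ?(ltnW h) // ltnS [(b <= n')%N]leq_eqVlt.
  case: (ltngtP b n') => /= h'; first by rewrite scalerAl.
    by rewrite -!mulrA comm // ltn_eqF.
  by rewrite -h' -mulrA own -scalerAr.
by have := key n (leqnn n); rewrite bn.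
Qed.

Lemma fidem_fix la (v : Vmod F la) :
  (forall i, inblock i -> Vrep (hgen_nat q (psum k n) i) v = q *: v) ->
  Vrep (fidem q k n) v = v.
Proof.
move=> h; apply: (big_ind (fun x => Vrep x v = v)) => [|x y hx hy|a _].
- exact: Vrep1.
- by rewrite VrepM // hy.
have an := ltn_ord a; apply: hshift_qsym_fix; first by rewrite -psumS psum_mono.
move=> i ik; apply: h; apply/inblockP; exists a => //.
by rewrite psumS; lia.
Qed.

Lemma fidem_fixP la (v : Vmod F la) :
  Vrep (fidem q k n) v = v <->
  (forall i, inblock i -> Vrep (hgen_nat q (psum k n) i) v = q *: v).
Proof.
split=> [h i hi|]; last exact: fidem_fix.
by rewrite -h -VrepM // fidem_gen // VrepZ.
Qed.

Lemma fidem_idem_act la (v : Vmod F la) :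
  Vrep (fidem q k n) (Vrep (fidem q k n) v) = Vrep (fidem q k n) v.
Proof. by apply: fidem_fix => i hi; rewrite -VrepM // fidem_gen // VrepZ. Qed.

Lemma fidem_idem : fidem q k n * fidem q k n = fidem q k n.
Proof.
apply/eqP; rewrite -subr_eq0; apply/eqP; apply: hecke_faithful => // la v.
by rewrite -scaleN1r addrC Vrep_linearl // VrepM // fidem_idem_act scaleN1r addNr.
Qed.

Lemma mem_Wsp la (v : Vmod F la) : (v \in Wsp q la) = (Vrep (fidem q k n) v == v).
Proof.
pose f : {linear Vmod F la -> Vmod F la} := HB.pack (@Vrep F q _ la (fidem q k n))
  (GRing.isLinear.Build F (Vmod F la) (Vmod F la) *:%R (@Vrep F q _ la (fidem q k n))
    (Vrep_linear q_neq0 qint_neq0 (fidem q k n))).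
apply/memv_imgP/eqP => [[u _ ->]|h].
  by rewrite -[linfun _]/(linfun f) lfunE; exact: fidem_idem_act.
by exists v; rewrite ?memvf // -[linfun _]/(linfun f) lfunE.
Qed.

End Fused.
End Parabolic.

(** * Canonical tableaux and semistandard tableaux *)

Section Blocks.
Variables (k : nat -> nat) (n : nat).

Local Notation m := (psum k n).
Local Notation inblock := (inblock k n).

Lemma block_exists i : (i < m)%N ->
  exists2 a, (a < n)%N & (psum k a <= i < psum k a.+1)%N.
Proof.
elim: n => [|n' IH]; first by rewrite /psum big_ord0.
move=> h; case: (ltnP i (psum k n')) => [/IH[a an ha]|h'].
  by exists a => //; exact: ltnW.
by exists n'; rewrite ?h'.
Qed.

Lemma block_mono a b i j : (psum k a <= i)%N -> (j < psum k b.+1)%N -> (i <= j)%N ->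
  (a <= b)%N.
Proof.
by move=> h1 h2 h3; rewrite leqNgt; apply/negP => /(psum_mono k) h; lia.
Qed.

Lemma block_uniq a b i : (psum k a <= i < psum k a.+1)%N ->
  (psum k b <= i < psum k b.+1)%N -> a = b.
Proof.
move=> /andP[h1 h2] /andP[h3 h4]; apply/eqP; rewrite eqn_leq.
by rewrite (block_mono h1 h4) ?(block_mono h3 h2).
Qed.

Lemma boundary p : (0 < p <= m)%N -> (p == m) || ~~ inblock p.-1 ->
  exists2 a, (a <= n)%N & p = psum k a.
Proof.
move=> /andP[p0 pm] h; have [a an /andP[h1 h2]] := @block_exists p.-1 ltac:(lia).
case/orP: h => [/eqP ->|nb]; first by exists n.
exists a.+1 => //; apply/eqP; rewrite eqn_leq; apply/andP; split; first lia.
rewrite leqNgt; apply: contra nb => h; apply/inblockP; exists a => //.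
by rewrite h1 /=; lia.
Qed.

(** Within each block the columns of the entries increase strictly: in the class
    of the standard tableaux with a given semistandard tableau as image, this
    is the one to which sorting leads. *)
Definition canonical (w : seq nat) : Prop :=
  forall i, inblock i -> (col w i < col w i.+1)%N.

Lemma canonical_lt w a x y : canonical w -> (a < n)%N ->
  (psum k a <= x)%N -> (x < y)%N -> (y < psum k a.+1)%N -> (col w x < col w y)%N.
Proof.
move=> cw an hx; elim: y => // y IH; rewrite ltnS leq_eqVlt => h hy.
have yb : (col w y < col w y.+1)%N.
  apply: cw; apply/inblockP; exists a => //; rewrite hy andbT.
  by move: h; case: eqP => [<-//|_ /= h]; lia.
case/orP: h => [/eqP ->//|h]; apply: leq_trans yb; rewrite ltnS ltnW //.
by apply: IH => //; exact: ltnW.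
Qed.

End Blocks.

Section Canonical.
Variables (k : nat -> nat) (n : nat) (la : part (psum k n)).

Local Notation m := (psum k n).
Local Notation inblock := (inblock k n).
Local Notation canonical := (canonical k n).
Implicit Types (t : STab la) (b c : box la) (T : {ffun box la -> 'I_n}).

Lemma col_box t b : col (rw t) (val t b) = bcol b.
Proof. by rewrite /col nth_rw count_take_box. Qed.

Lemma is_barP t T : reflect
  (forall b, (psum k (T b) <= val t b < psum k (T b).+1)%N) (is_bar k t T).
Proof. exact: forallP. Qed.

Lemma bar_uniq t T T' : is_bar k t T -> is_bar k t T' -> T = T'.
Proof.
move=> /is_barP h /is_barP h'; apply/ffunP => b; apply/val_inj.
exact: block_uniq (h b) (h' b).
Qed.

Lemma bar_lt t T b a : is_bar k t T -> (val t b < psum k a)%N = (T b < a)%N.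
Proof.
move=> /is_barP /(_ b) /andP[h1 h2]; case: (ltnP (T b) a) => h.
  by rewrite (leq_trans h2) // psum_mono.
by apply/negbTE; rewrite -leqNgt (leq_trans _ h1) // psum_mono.
Qed.

Lemma bar_inblock t T b c i : is_bar k t T -> inblock i ->
  val t b = i :> nat -> val t c = i.+1 :> nat -> T b = T c.
Proof.
move=> /is_barP h /inblockP[a an /andP[h1 h2]] eb ec; apply/val_inj.
have hb := h b; have hc := h c; rewrite eb in hb; rewrite ec in hc.
have e1 : T b = a :> nat by apply: block_uniq hb _; rewrite h1 ltnW.
have e2 : T c = a :> nat by apply: block_uniq hc _; rewrite h2 andbT ltnW.
exact: etrans e1 (esym e2).
Qed.

(** A semistandard tableau prescribes the shapes at the ends of the blocks, and
    [colsort_uniq] does the rest. *)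
Lemma canonical_uniq t t' T : canonical (rw t) -> canonical (rw t') ->
  is_bar k t T -> is_bar k t' T -> t = t'.
Proof.
move=> ct ct' bt bt'; apply: rw_inj.
apply: (@colsort_uniq m inblock); rewrite ?size_rw ?yam_rw //.
- by move=> i _ /ct /ltnW.
- by move=> i _ /ct' /ltnW.
move=> p p1 /(boundary p1)[a an ->]; apply/shape_eqP/funext => r.
rewrite /shape !count_take_rw ?psum_mono //.
by apply: eq_card => b; rewrite !inE (bar_lt _ _ bt) (bar_lt _ _ bt').
Qed.

Lemma card_tab_lt t p : (p <= m)%N -> #|[set b | (val t b < p)%N]| = p.
Proof.
move=> pm; have tinj : injective (val t) by exact: stab_inj.
have winj : injective (widen_ord pm) by move=> x y /(congr1 val) /= /val_inj.
rewrite -(card_imset _ tinj) -[RHS](card_ord p) -(card_imset _ winj).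
apply: eq_card => j; apply/imsetP/imsetP => [[b]|[l _ ->]].
  by rewrite inE => h ->; exists (Ordinal h) => //; exact: val_inj.
have [b e] := stab_onto t (leq_trans (ltn_ord l) pm).
by exists b; [rewrite inE e ltn_ord | exact: val_inj].
Qed.

(** Two boxes of a column with the same entry would contradict the strict increase
    of the columns within a block. *)
Lemma canonical_bar t : canonical (rw t) -> exists T : SSTab la k n, is_bar k t (val T).
Proof.
move=> ct.
have ex b : exists a : 'I_n, (psum k a <= val t b < psum k a.+1)%N.
  by have [a an h] := block_exists (ltn_ord (val t b)); exists (Ordinal an).
pose T : {ffun box la -> 'I_n} := [ffun b => xchoose (ex b)].
have bT : is_bar k t T by apply/is_barP => b; rewrite ffunE; exact: (xchooseP (ex b)).
have Tle b c : (val t b <= val t c)%N -> (T b <= T c)%N.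
  move/is_barP: (bT) => h hbc; have /andP[h1 _] := h b; have /andP[_ h2] := h c.
  exact: block_mono h1 h2 hbc.
have sT : is_sstd k T.
  apply/and3P; split.
  - apply/forallP => b; apply/forallP => c; apply/implyP => /andP[/eqP e h].
    by apply: Tle; apply/ltnW/stab_row.
  - apply/forallP => b; apply/forallP => c; apply/implyP => /andP[/eqP e h].
    have tbc : (val t b < val t c)%N by exact: stab_col.
    rewrite ltn_neqAle Tle ?(ltnW tbc) // andbT; apply/eqP => /val_inj eT.
    move/is_barP: (bT) => hb; have /andP[h1 _] := hb b; have /andP[_ h2] := hb c.
    rewrite -eT in h2; have := canonical_lt ct (ltn_ord (T b)) h1 tbc h2.
    by rewrite !col_box e ltnn.
  - apply/forallP => a; have an := ltn_ord a.
    have e1 : #|[set b | (val t b < psum k a.+1)%N]| = psum k a.+1.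
      by apply: card_tab_lt; exact: psum_mono.
    have e2 : #|[set b | (val t b < psum k a)%N]| = psum k a.
      by apply: card_tab_lt; apply: psum_mono; exact: ltnW.
    move: e1; have -> : [set b | (val t b < psum k a.+1)%N] =
      [set b | (val t b < psum k a)%N] :|: [set b | T b == a].
      apply/setP => b; rewrite !inE !(bar_lt _ _ bT) ltnS leq_eqVlt orbC.
      by rewrite (inj_eq val_inj).
    rewrite cardsU e2 psumS (_ : _ :&: _ = finset.set0) ?cards0 ?subn0.
      by move=> /addnI ->.
    apply/setP => b; rewrite !inE (bar_lt _ _ bT) -(inj_eq val_inj).
    by case: ltngtP.
by exists (exist (fun x => is_sstd k x) T sT).
Qed.

Lemma card_box : #|{: box la}| = m.
Proof.
rewrite -[RHS](sum_prow la) -sum1_card.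
rewrite (partition_big (fun b : box la => (val b).1) xpredT) //=.
apply: eq_bigr => r _; rewrite sum1dep_card -[RHS](@card_row_prefix _ la r (prow la r)) //.
apply: eq_card => b; rewrite !inE -(inj_eq val_inj) -/(brow b).
by case: (eqVneq (brow b) r) => [e|//]; rewrite -e bcol_lt.
Qed.

(** Standardisation: the boxes are numbered by increasing entry and, among equal
    entries, from left to right. *)
Lemma standardisation (T : SSTab la k n) :
  exists2 t, canonical (rw t) & is_bar k t (val T).
Proof.
have /and3P[rowT colT cntT] := valP T; move: (val T) rowT colT cntT => {}T.
move=> /forallP rowT /forallP colT /forallP cntT.
have colT' b c : bcol b = bcol c -> (brow b < brow c)%N -> (T b < T c)%N.
  by move=> e h; have /forallP /(_ c) := colT b; rewrite e eqxx h.
have rowT' b c : brow b = brow c -> (bcol b < bcol c)%N -> (T b <= T c)%N.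
  by move=> e h; have /forallP /(_ c) := rowT b; rewrite e eqxx h.
pose lex b c := (T b < T c)%N || (T b == T c) && (bcol b < bcol c)%N.
have lexI b : lex b b = false by rewrite /lex !ltnn eqxx.
have lexT b c d : lex b c -> lex c d -> lex b d.
  rewrite /lex -!(inj_eq val_inj) /=.
  by move: (nat_of_ord (T b)) (nat_of_ord (T c)) (nat_of_ord (T d)) => x y z; lia.
have lexC b c : b != c -> lex b c || lex c b.
  move=> bc; rewrite /lex -!(inj_eq val_inj) /=.
  case: (ltngtP (T b) (T c)) => //= /val_inj eT.
  case: (ltngtP (bcol b) (bcol c)) => //= ec.
  have [h|h|h] := ltngtP (brow b) (brow c).
  - by have := colT' b c ec h; rewrite eT ltnn.
  - by have := colT' c b (esym ec) h; rewrite eT ltnn.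
  - by case/eqP: bc; exact: box_inj.
pose rk b := #|[set c | lex c b]|.
have rk_lt b c : lex b c -> (rk b < rk c)%N.
  move=> h; apply: proper_card; apply/properP; split.
    by apply/fintype.subsetP => d; rewrite !inE => /lexT; apply.
  by exists b; rewrite !inE ?h ?lexI.
have rk_ltE b c : (rk b < rk c)%N = lex b c.
  apply/idP/idP => [h|]; last exact: rk_lt.
  have /lexC/orP[//|/rk_lt h'] : b != c by apply: contraTneq h => ->; rewrite ltnn.
  by move: (ltn_trans h h'); rewrite ltnn.
have rkm b : (rk b < m)%N.
  rewrite -card_box -cardsT; apply: proper_card; apply/properP; split; first exact: finset.subsetT.
  by exists b; rewrite !inE ?lexI.
pose t := [ffun b => Ordinal (rkm b)].
have tE b : t b = rk b :> nat by rewrite ffunE.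
have tinj : injective t.
  move=> b c e; apply/eqP; apply: contraT => /lexC.
  by rewrite -!rk_ltE -!tE e ltnn.
have std : is_std t.
  apply/and4P; split.
  - exact/injectiveP.
  - apply/forallP => j; apply: inj_card_onto => //.
    by rewrite card_ord; exact: eq_leq (esym card_box).
  - apply/forallP => b; apply/forallP => c; apply/implyP => /andP[/eqP e h].
    rewrite !tE rk_ltE /lex h andbT orbC -leq_eqVlt.
    exact: rowT'.
  - apply/forallP => b; apply/forallP => c; apply/implyP => /andP[/eqP e h].
    by rewrite !tE rk_ltE /lex colT'.
pose t0 : STab la := exist (fun x => is_std x) t std.
have cardlt a : (a <= n)%N -> #|[set b | (T b < a)%N]| = psum k a.
  elim: a => [|a IH] h.
    by rewrite /psum big_ord0 (eq_card0 (A := _)) // => b; rewrite inE.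
  have -> : [set b | (T b < a.+1)%N] =
      [set b | (T b < a)%N] :|: [set b | T b == Ordinal h].
    by apply/setP => b; rewrite !inE ltnS leq_eqVlt orbC -(inj_eq val_inj).
  rewrite cardsU IH ?(ltnW h) // (eqP (cntT (Ordinal h))) psumS /=.
  rewrite (_ : _ :&: _ = finset.set0) ?cards0 ?subn0 //.
  by apply/setP => b; rewrite !inE -(inj_eq val_inj) /=; case: ltngtP.
have bT : is_bar k t0 T.
  apply/is_barP => b; rewrite /= tE -(cardlt (T b)) ?(ltnW (ltn_ord _)) //.
  rewrite -(cardlt (T b).+1) //; apply/andP; split.
    apply: subset_leq_card; apply/fintype.subsetP => c; rewrite !inE /lex => h.
    by rewrite h.
  apply: proper_card; apply/properP; split.
    apply/fintype.subsetP => c; rewrite !inE /lex ltnS => /orP[/ltnW //|/andP[/eqP -> _]].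
    exact: leqnn.
  by exists b; rewrite !inE ?lexI ?ltnSn.
exists t0 => // i ib; have im := inblock_lt ib.
have [b eb] := stab_onto t0 (ltnW im); have [c ec] := stab_onto t0 im.
have eT := bar_inblock bT ib eb ec.
rewrite -[X in (col _ X < _)%N]eb -[X in (_ < col _ X)%N]ec !col_box.
have : lex b c by rewrite -rk_ltE -!tE -[t b]/(val t0 b) -[t c]/(val t0 c) eb ec.
by rewrite /lex eT ltnn eqxx.
Qed.

End Canonical.

(** * The image of the idempotent *)

Section Eigenvectors.
Variables (F : fieldType) (q : F).
Hypothesis q_neq0 : q != 0.
Hypothesis qint_neq0 : forall L : int, L != 0 -> qint q L != 0.
Variables (k : nat -> nat) (n : nat) (la : part (psum k n)).

Local Notation m := (psum k n).
Local Notation inblock := (inblock k n).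
Local Notation canonical := (canonical k n).
Implicit Types (v : Vmod F la) (t : STab la).

Lemma Wsp_opw v i w : v \in Wsp q la -> inblock i ->
  opw q m i (wcoef v) w = q * wcoef v w.
Proof.
rewrite mem_Wsp // => /eqP /(fidem_fixP q_neq0 qint_neq0) h ib.
by rewrite -wcoef_gen ?(inblock_lt ib) // h // wcoefZ.
Qed.

Lemma Wsp_swap v i w : v \in Wsp q la -> inblock i -> yam w -> size w = m ->
  let d := cont w i.+1 - cont w i in d != 0 -> d != 1 -> d != -1 ->
  wcoef v (swp i w) = wcoef v w.
Proof.
move=> vW ib yw sw d d0 d1 d2; have := Wsp_opw w vW ib.
rewrite /opw yw sw eqxx /= -/d => h; have u0 := ucoef_neq0 q_neq0 qint_neq0 d0 d1 d2.
apply: (mulfI u0); apply: (addrI (gcoef q d * wcoef v w)); rewrite h -mulrDl.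
by rewrite ucoefE // addrC subrK.
Qed.

Lemma Wsp_col v i w : v \in Wsp q la -> inblock i -> yam w -> size w = m ->
  cont w i.+1 - cont w i = -1 -> wcoef v w = 0.
Proof.
move=> vW ib yw sw d; have := Wsp_opw w vW ib.
rewrite /opw yw sw eqxx /= d gcoefN1 // /ucoef eqxx orbT mul0r addr0 => /eqP.
rewrite eq_sym -subr_eq0 mulNr opprK -mulrDl mulf_eq0.
by rewrite (negPf (two_qint_neq0 q_neq0 qint_neq0)) => /eqP.
Qed.

Lemma Wsp_intro v :
  (forall t (i : 'I_m.-1), inblock i -> tdist t i = -1 -> v t = 0) ->
  (forall t t0 (i : 'I_m.-1), inblock i -> val t0 = tab_swap i t -> v t0 = v t) ->
  v \in Wsp q la.
Proof.
move=> hc hs; rewrite mem_Wsp //; apply/eqP/(fidem_fixP q_neq0 qint_neq0) => i ib.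
have im := inblock_lt ib; rewrite -ltn_predRL in im.
rewrite (hgen_natE q im) Vrep_gen //; apply/ffunP => t; rewrite sigma_opE //.
have -> : (q *: v) t = q * v t by rewrite ffunE.
set j := Ordinal im in ib *.
rewrite /opw yam_rw size_rw eqxx andbT wcoef_rw.
rewrite -[cont _ _ - cont _ _]/(tdist t j).
have [d|d1] := eqVneq (tdist t j) 1.
  by rewrite d gcoef1 // /ucoef eqxx mul0r addr0.
have [d|d2] := eqVneq (tdist t j) (-1).
  by rewrite (hc t j) // d /ucoef eqxx orbT mul0r !mulr0 addr0.
have st : is_std (tab_swap j t) by rewrite tab_swap_std d1 d2.
pose t0 : STab la := exist (fun x => is_std x) _ st.
rewrite -(@tab_swap_rw _ _ t t0 j) // wcoef_rw (hs t t0 j) //.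
by rewrite ucoefE ?tdist_neq0 // -mulrDl addrC subrK.
Qed.

(** Sorting a block preserves the coefficient and ends either at a canonical
    tableau or at one with two consecutive entries of the block in a column, where
    the coefficient is 0. *)
Lemma Wsp_determined v : v \in Wsp q la ->
  (forall t, canonical (rw t) -> v t = 0) -> v = 0.
Proof.
move=> vW h.
suff E w : yam w -> size w = m -> wcoef v w = 0.
  by apply/ffunP => t; rewrite -wcoef_rw E ?yam_rw ?size_rw // ffunE.
move: w; apply: (@colsort_ind m inblock) => [w yw sw cw|i w yw sw im ib hc <-].
  have [sh|] := EM (shaped la w); last exact: wcoef_out.
  have [t et] := rw_onto sh; rewrite -et wcoef_rw; have [cn|ncn] := EM (canonical w).
    by apply: h; rewrite et.
  have [i [ib ce]] : exists i, inblock i /\ col w i = col w i.+1.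
    apply: contrapT => no; apply: ncn => i ib; rewrite ltn_neqAle cw ?(inblock_lt ib) //.
    by rewrite andbT; apply/eqP => e; apply: no; exists i.
  rewrite -wcoef_rw et; apply: (Wsp_col vW ib yw sw); apply/eqP.
  have iw : (i.+1 < size w)%N by rewrite sw inblock_lt.
  have [u [a [b [z [Ew iu]]]]] := split2P iw; move: ce.
  rewrite Ew -iu cont_cat cont_cat1 col_cat col_cat1 => ce.
  have yab : yam (rcons (rcons u a) b).
    by apply: (@yam_prefix _ z); rewrite !cat_rcons -Ew.
  rewrite ct_adj_col // -ce eqxx andbT; apply/eqP => ab.
  by move: ce; rewrite ab count_rcons eqxx; lia.
have iw : (i.+1 < size w)%N by rewrite sw.
have [_ d1 d2 _] := swp_col yw iw hc; apply/esym; apply: (Wsp_swap vW ib yw sw) => //.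
have [u [a [b [z [Ew iu]]]]] := split2P iw; rewrite Ew -iu cont_cat cont_cat1.
by apply: ct_neq; apply: (@yam_prefix _ z); rewrite !cat_rcons -Ew.
Qed.

Lemma wvecE (T : SSTab la k n) t : wvec F T t = (is_bar k t (val T))%:R.
Proof.
have -> : wvec F T t = \sum_(t0 : STab la | is_bar k t0 (val T)) (t == t0)%:R.
  by rewrite /wvec sum_ffunE; apply: eq_bigr => t0 _; rewrite ffunE (inj_eq val_inj).
case: (boolP (is_bar k t (val T))) => h.
  by rewrite (bigD1 t) //= eqxx big1 ?addr0 // => t0 /andP[_ /negPf]; rewrite eq_sym => ->.
by rewrite big1 // => t0 h0; case: eqP => // e; rewrite e h0 in h.
Qed.

Lemma is_bar_swap t t0 (i : 'I_m.-1) (T : {ffun box la -> 'I_n}) : inblock i ->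
  val t0 = tab_swap i t -> is_bar k t T -> is_bar k t0 T.
Proof.
move=> /inblockP[a an /andP[h1 h2]] e /is_barP h; apply/is_barP => b.
have := h b; rewrite e ffunE tperm_lohi; move: (nat_of_ord (T b)) => c hb.
case: eqP => [e1|_].
  have -> : c = a; last by rewrite h2 andbT ltnW.
  by apply: block_uniq hb _; rewrite e1 h1 ltnW.
case: eqP => [e1|_ //].
have -> : c = a; last by rewrite h1 ltnW.
by apply: block_uniq hb _; rewrite e1 h2 andbT ltnW.
Qed.

Lemma wvec_Wsp (T : SSTab la k n) : wvec F T \in Wsp q la.
Proof.
apply: Wsp_intro => [t i ib d|t t0 i ib e]; rewrite !wvecE.
  case: (boolP (is_bar k t (val T))) => // bT; exfalso.
  have [b eb] := stab_onto t (ltn_ord (lo i)).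
  have [c ec] := stab_onto t (ltn_ord (hi i)).
  have [_ dc] := tdist_adj eb ec; rewrite d eqxx in dc.
  have /eqP ebc := esym dc.
  have rbc : (brow b < brow c)%N by rewrite -(stab_col_ltE t ebc) eb ec lohi_lt.
  have eT := bar_inblock bT ib eb ec.
  have /and3P[_ /forallP /(_ b) /forallP /(_ c)] := valP T.
  by rewrite ebc eqxx rbc -/(val T) eT ltnn.
congr (nat_of_bool _)%:R; apply/idP/idP; last exact: is_bar_swap ib e.
by apply: is_bar_swap ib _; exact: tab_swapK.
Qed.

Definition std_of (T : SSTab la k n) : STab la := projT1 (cid2 (standardisation T)).

Lemma std_of_canonical T : canonical (rw (std_of T)).
Proof. by rewrite /std_of; case: cid2. Qed.

Lemma std_of_bar T : is_bar k (std_of T) (val T).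
Proof. by rewrite /std_of; case: cid2. Qed.

Lemma bar_std_of (T T' : SSTab la k n) : is_bar k (std_of T) (val T') = (T == T').
Proof.
apply/idP/eqP => [h|<-]; last exact: std_of_bar.
by apply: val_inj; exact: bar_uniq (std_of_bar T) h.
Qed.

Lemma std_of_onto t : canonical (rw t) -> exists T, t = std_of T.
Proof.
move=> ct; have [T bT] := canonical_bar ct; exists T.
exact: canonical_uniq ct (std_of_canonical T) bT (std_of_bar T).
Qed.

Lemma wvec_sum_std (c : SSTab la k n -> F) T :
  (\sum_T' c T' *: wvec F T' : Vmod F la) (std_of T) = c T.
Proof.
have -> : (\sum_T' c T' *: wvec F T' : Vmod F la) (std_of T) =
          \sum_T' c T' * wvec F T' (std_of T).
  by rewrite sum_ffunE; apply: eq_bigr => T' _; rewrite ffunE.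
rewrite (bigD1 T) //= wvecE bar_std_of eqxx mulr1 big1 ?addr0 // => T' ne.
by rewrite wvecE bar_std_of eq_sym (negPf ne) mulr0.
Qed.

Lemma wvec_sum_Wsp (c : SSTab la k n -> F) :
  (\sum_T c T *: wvec F T : Vmod F la) \in Wsp q la.
Proof. by apply: rpred_sum => T _; apply: rpredZ; exact: wvec_Wsp. Qed.

(** Both sides lie in the image and agree on the canonical tableaux. *)
Lemma Wsp_expand v : v \in Wsp q la -> v = \sum_T v (std_of T) *: wvec F T.
Proof.
move=> vW; apply/eqP; rewrite -subr_eq0; apply/eqP.
apply: Wsp_determined; first by rewrite rpredB // wvec_sum_Wsp.
by move=> t /std_of_onto[T ->]; rewrite !ffunE wvec_sum_std subrr.
Qed.

Lemma Wsp_span : Wsp q la = <<[seq wvec F T | T : SSTab la k n]>>%VS.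
Proof.
apply/eqP; rewrite eqEsubv; apply/andP; split; apply/subvP => v.
  move=> /Wsp_expand ->; apply: rpred_sum => T _; apply: rpredZ.
  by apply: memv_span; apply/fintype.imageP; exists T.
move: v; apply/subvP/span_subvP => v /fintype.imageP[T _ ->]; exact: wvec_Wsp.
Qed.

Lemma Wsp_dim : \dim (Wsp q la) = #|{: SSTab la k n}|.
Proof.
rewrite Wsp_span; set X := [seq _ | T : _]; have sX : size X = #|{: SSTab la k n}|.
  exact: size_image.
rewrite -sX; apply/eqP; rewrite -/(free X).
rewrite -[X]/(tval (in_tuple X)); apply/freeP => c h i.
have nthX (j : 'I_(size X)) : X`_j = wvec F (enum_val (cast_ord sX j)).
  by rewrite -(nth_image 0 (fun T => wvec F T)).
pose c' T := c (cast_ord (esym sX) (enum_rank T)).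
have e0 : \sum_T c' T *: wvec F T = 0 :> Vmod F la.
  apply: etrans h; rewrite (reindex (fun j : 'I_(size X) => enum_val (cast_ord sX j))) /=.
    by apply: eq_bigr => j _; rewrite /c' enum_valK cast_ordK nthX.
  exists (fun T => cast_ord (esym sX) (enum_rank T)) => x _.
    by rewrite enum_valK cast_ordK.
  by rewrite cast_ordKV enum_rankK.
have := wvec_sum_std c' (enum_val (cast_ord sX i)).
by rewrite e0 ffunE /c' enum_valK cast_ordK => ->.
Qed.

Lemma Wsp_extend (f : STab la -> F) :
  exists2 v : Vmod F la, v \in Wsp q la & forall t, canonical (rw t) -> v t = f t.
Proof.
exists (\sum_T f (std_of T) *: wvec F T); first exact: wvec_sum_Wsp.
by move=> t /std_of_onto[T ->]; rewrite wvec_sum_std.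
Qed.

Lemma Wsp_neq0 : (exists2 v : Vmod F la, v \in Wsp q la & v != 0) <->
  (exists t : STab la, canonical (rw t)).
Proof.
split=> [[v vW v0]|[t ct]].
  apply: contrapT => h; case/eqP: v0; apply: Wsp_determined => // t ct.
  by case: h; exists t.
have [v vW vt] := Wsp_extend (fun=> 1); exists v => //.
by apply: contraTneq (oner_neq0 F) => v0; rewrite negbK -(vt t ct) v0 ffunE.
Qed.

End Eigenvectors.

(** * Horizontal strips and the dominance order *)

Section Strips.
Implicit Types (la mu : nat -> nat) (u w : seq nat).
Local Open Scope nat_scope.

Definition interlaced la mu : Prop := forall r, la r.+1 <= mu r <= la r.

(** The word adding a horizontal strip from left to right, hence from the bottom
    row to the top one. *)
Definition strip (M : nat) la mu : seq nat :=
  sort geq (flatten [seq nseq (la r - mu r) r | r <- iota 0 M]).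

Lemma count_strip M la mu r : (forall r, M <= r -> la r = 0) ->
  count_mem r (strip M la mu) = la r - mu r.
Proof.
move=> supp; rewrite /strip (seq.permP (permEl (perm_sort _ _))).
have -> : count_mem r (flatten [seq nseq (la r - mu r) r | r <- iota 0 M]) =
          (r < M) * (la r - mu r).
  elim: M {supp} => [|M IH] //; rewrite -addn1 iotaD map_cat flatten_cat count_cat IH.
  rewrite /= cats0 count_nseq add0n addn1 ltnS /=.
  by case: (ltngtP r M) => h; rewrite ?eqxx ?mul0n ?mul1n ?addn0 ?add0n // ?h ?eqxx ?mul1n.
by case: ltnP => h; rewrite ?mul1n // supp.
Qed.

Lemma strip_sorted M la mu : sorted geq (strip M la mu).
Proof. by apply: sort_sorted => x y; exact: leq_total. Qed.

Lemma count_cat_strip M la mu u : (forall r, M <= r -> la r = 0) ->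
  shape u = mu -> interlaced la mu -> shape (u ++ strip M la mu) = la.
Proof.
move=> supp <- il; apply/funext => r; rewrite /shape count_cat count_strip //.
by have /andP[_] := il r; exact: subnKC.
Qed.

(** Row [r + 1] of the larger shape is not longer than row [r] of the smaller one,
    so the boxes of the strip can be added in any order. *)
Lemma yam_cat_interlaced u s la : yam u -> shape (u ++ s) = la ->
  interlaced la (shape u) -> yam (u ++ s).
Proof.
move=> yu <- il; apply/yamP => j r; case: (leqP j (size u)) => h.
  by rewrite takel_cat //; exact: (yamP _ yu).
have /andP[h1 _] := il r.
have h2 := count_take_mono (u ++ s) r.+1 (leq_maxr j (size (u ++ s))).
have h3 := count_take_mono (u ++ s) r (ltnW h); rewrite take_size_cat // in h3.
apply: leq_trans h3; apply: leq_trans h1.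
by rewrite -[X in _ <= X]/(count_mem r.+1 (u ++ s)) -[X in _ <= count_mem _ X](cat_take_drop j)
   count_cat leq_addr.
Qed.

(** Within a row this is clear; a later row of the strip is higher up, and begins
    where the lower one has already ended, by interlacing. *)
Lemma strip_col u la mu M i j (w := u ++ strip M la mu) : shape w = la -> shape u = mu ->
  (forall r r', r <= r' -> la r' <= la r) -> interlaced la mu ->
  size u <= i -> i < j -> j < size w -> col w i < col w j.
Proof.
move=> sw su dec il ui ij jw.
have iw := ltn_trans ij jw.
pose a := nth 0 w i; pose b := nth 0 w j.
have ba : b <= a.
  rewrite /a /b /w !nth_cat !ltnNge ui (leq_trans ui (ltnW ij)) /=.
  have tr : transitive geq by move=> x y z /= h1 h2; exact: leq_trans h2 h1.
  apply: (sorted_ltn_nth tr 0 (strip_sorted M la mu)); rewrite ?inE; move: jw;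
  rewrite /w size_cat; lia.
have ca : col w i < la a by rewrite -sw; exact: count_take_lt.
have cb : mu b <= col w j.
  rewrite -su /col -/b; have := count_take_mono w b (leq_trans ui (ltnW ij)).
  by rewrite {1}/w take_size_cat.
case: (ltngtP b a) ba => // [h|e] _.
  apply: leq_trans ca _; apply: leq_trans cb; apply: leq_trans (dec _ _ h) _.
  by have /andP[] := il b.
rewrite /col -/a -/b e; have := count_take_mono w a ij.
by rewrite (take_nth 0) // count_rcons -/a eqxx addn1.
Qed.

(** If the inequality failed at [r], both [(r, mu r)] and [(r + 1, mu r)] would be
    added boxes, in the same column. *)
Lemma interlaced_of_col u s : yam (u ++ s) ->
  (forall i j, size u <= i -> i < j -> j < size (u ++ s) -> col (u ++ s) i < col (u ++ s) j) ->
  interlaced (shape (u ++ s)) (shape u).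
Proof.
move=> yw hc r; apply/andP; split; last by rewrite /shape count_cat leq_addr.
rewrite leqNgt; apply/negP => h.
have h' : shape u r < count_mem r (u ++ s) by apply: leq_trans h (yam_shape r yw).
have [j jw [lj cj]] := nth_occurrence h'; have [i iw [li ci]] := nth_occurrence h.
have pos x y : nth 0 (u ++ s) y = x ->
    shape u x <= count_mem x (take y (u ++ s)) -> y < size (u ++ s) -> size u <= y.
  move=> lx cx yw'; rewrite leqNgt; apply/negP => yu.
  have := count_take_mono (u ++ s) x yu; rewrite (take_size_cat s (erefl (size u))).
  rewrite (take_nth 0) // lx.
  rewrite count_rcons eqxx -[count_mem x u]/(shape u x); lia.
have uj : size u <= j by apply: (pos r) => //; rewrite cj.
have ui : size u <= i.
  by apply: (pos r.+1) => //; rewrite ci; exact: yam_shape (yam_prefix yw).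
have e : col (u ++ s) i = col (u ++ s) j by rewrite /col li lj ci cj.
case: (ltngtP i j) => ij.
- by have := hc i j ui ij jw; rewrite e ltnn.
- by have := hc j i uj ij iw; rewrite e ltnn.
- by move: li; rewrite ij lj; lia.
Qed.

Variable k : nat -> nat.

Lemma inblockS n i : inblock k n.+1 i =
  inblock k n i || ((psum k n <= i) && (i.+1 < psum k n.+1)).
Proof.
apply/inblockP/orP => [[a]|[/inblockP[a an h]|h]].
- rewrite ltnS leq_eqVlt => /orP[/eqP -> h|an h]; first by right.
  by left; apply/inblockP; exists a.
- by exists a => //; exact: ltnW.
- by exists n.
Qed.

Lemma canonical_cat n u s : size u = psum k n -> size (u ++ s) = psum k n.+1 ->
  canonical k n.+1 (u ++ s) <->
  (canonical k n u /\ forall i j, size u <= i -> i < j -> j < size (u ++ s) ->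
     col (u ++ s) i < col (u ++ s) j).
Proof.
move=> su sw; split=> [cw|[cu cs] i].
  split=> [i ib|i j ui ij jw]; last first.
    by apply: (canonical_lt cw (ltnSn n)) => //; rewrite -?su -?sw.
  have im := inblock_lt ib; rewrite -su in im.
  have := cw i; rewrite inblockS ib => /(_ isT).
  by rewrite !col_catl // ltnW.
rewrite inblockS => /orP[ib|/andP[h1 h2]]; last by apply: cs; rewrite ?su ?sw.
have im := inblock_lt ib; rewrite -su in im.
by rewrite !col_catl ?(ltnW im) //; exact: cu.
Qed.

Definition partial_sum (f : nat -> nat) (i : nat) : nat := \sum_(r < i) f r.

Lemma partial_sumS f i : partial_sum f i.+1 = partial_sum f i + f i.
Proof. exact: big_ord_recr. Qed.

Lemma partial_sum_shape w M : (forall r, M <= r -> shape w r = 0) ->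
  partial_sum (shape w) M = size w.
Proof.
move=> supp; rewrite -[RHS](@sum_count_mem w M) // => r rw.
rewrite ltnNge; apply/negP => /supp; apply/eqP; rewrite -lt0n.
by rewrite /shape -has_count has_pred1.
Qed.

(** Dominance over a composition, without sorting it: no set of parts exceeds the
    sum of as many largest parts. *)
Definition dominates_comp (n : nat) la : Prop :=
  forall A : seq nat, uniq A -> all (fun a => a < n) A ->
    sumn (map k A) <= partial_sum la (size A).

Lemma interlaced_partial_sum la mu i d : interlaced la mu ->
  partial_sum la (i.+1 + d) + partial_sum mu i <= partial_sum la i.+1 + partial_sum mu (i + d).
Proof.
move=> il; elim: d => [|d IH]; first by rewrite !addn0.
rewrite addSn in IH; rewrite !addnS !addSn (partial_sumS la (i + d).+1) (partial_sumS mu).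
by have /andP[h _] := il (i + d); lia.
Qed.

Lemma partial_sum_support f M d : (forall r, M <= r -> f r = 0) ->
  partial_sum f (M + d) = partial_sum f M.
Proof.
move=> supp; elim: d => [|d IH]; first by rewrite addn0.
by rewrite addnS partial_sumS IH supp ?leq_addr // addn0.
Qed.

Lemma partial_sum_le f i j : i <= j -> partial_sum f i <= partial_sum f j.
Proof.
by move=> /subnKC <-; elim: (j - i) => [|d IH]; rewrite ?addn0 // addnS partial_sumS; lia.
Qed.

(** Removing the last horizontal strip, of size [k n], costs at most this much in
    a partial sum, by [interlaced_partial_sum]: the strip shifts the partial sums
    by one index at most. *)
Lemma dominates_of_canonical n w : yam w -> size w = psum k n -> canonical k n w ->
  dominates_comp n (shape w).
Proof.
elim: n w => [|n IH] w yw sw cw A uA Am.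
  by case: A uA Am => //= _; rewrite /partial_sum.
pose u := take (psum k n) w; pose s := drop (psum k n) w.
have Ew : w = u ++ s by rewrite cat_take_drop.
have su : size u = psum k n by rewrite size_takel // sw psumS leq_addr.
have yu : yam u by exact: yam_take.
rewrite Ew in cw sw yw *; have [cu cs] := (canonical_cat su sw).1 cw.
have il := interlaced_of_col yw cs; have Du := IH u yu su cu.
case: (boolP (n \in A)) => nA; last first.
  have := Du A uA; have -> : all (fun a => a < n) A.
    apply/allP => a aA; have := allP Am a aA; rewrite ltnS leq_eqVlt => /orP[/eqP e|//].
    by rewrite -e aA in nA.
  move=> /(_ isT) h; apply: leq_trans h _; apply: leq_sum => r _.
  by have /andP[] := il r.
have pA := perm_to_rem nA; have uA' := rem_uniq n uA.
have Am' : all (fun a => a < n) (rem n A).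
  apply/allP => a; rewrite mem_rem_uniq // inE => /andP[an aA].
  by have := allP Am a aA; rewrite ltnS leq_eqVlt (negPf an).
have := Du _ uA' Am'; rewrite (perm_sumn (perm_map k pA)) (perm_size pA) /=.
move: (size (rem n A)) (sumn _) => i x hx.
pose M := size (u ++ s).
have supp v : yam v -> size v <= M -> forall r, M <= r -> shape v r = 0.
  move=> yv sv r rM; apply/eqP; rewrite -leqn0 leqNgt -has_count has_pred1.
  by apply/negP => /(yam_mem_lt yv); rewrite ltnNge (leq_trans sv).
have sM : size u <= M by rewrite /M size_cat leq_addr.
have h := interlaced_partial_sum i M il.
have s1 := supp _ yw (leqnn M); have s2 := supp u yu sM.
have e1 := partial_sum_support i.+1 s1; have e2 := partial_sum_support i s2.
rewrite addnC [RHS]partial_sum_shape // sw psumS in e1.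
rewrite addnC [RHS]partial_sum_shape // su in e2.
by rewrite e1 e2 in h; lia.
Qed.

(** The strip is removed from as low rows as possible, which leaves the largest
    possible partial sums, namely [MU] below. *)
Lemma canonical_of_dominates n M la : (forall r, la r.+1 <= la r) ->
  (forall r, M <= r -> la r = 0) -> partial_sum la M = psum k n ->
  dominates_comp n la ->
  exists w, [/\ yam w, size w = psum k n, shape w = la & canonical k n w].
Proof.
elim: n la => [|n IH] la dec supp tot dom.
  exists [::]; split; [exact: yam_nil | by rewrite /psum big_ord0 | | ].
    apply/funext => r; case: (leqP M r) => [/supp -> //|rM].
    move/eqP: tot; rewrite /partial_sum /psum big_ord0 sum_nat_eq0.
    by move=> /forallP /(_ (Ordinal rM)) /= /eqP.
  by move=> i /inblockP[a].
pose L := partial_sum la.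
have kn : k n <= L 1.
  by have := dom [:: n] isT; rewrite /= addn0 andbT => /(_ (ltnSn n)).
have L1 i : L 1 <= L i.+1 by exact: partial_sum_le.
have LS i : L i.+1 = L i + la i by exact: partial_sumS.
pose MU i := minn (L i) (L i.+1 - k n).
pose mu r := MU r.+1 - MU r.
have MUS r : MU r.+1 = MU r + mu r.
  by rewrite subnKC // /MU; have := L1 r; have := kn; rewrite !LS; lia.
have il : interlaced la mu.
  move=> r; have := MUS r; rewrite /MU; have := L1 r; have := L1 r.+1.
  by have := dec r; have := kn; rewrite !LS; lia.
have MUE i : partial_sum mu i = MU i.
  elim: i => [|i IHi]; last by rewrite partial_sumS IHi MUS.
  by rewrite /MU /L /partial_sum !big_ord0 min0n.
have dec' r : mu r.+1 <= mu r by have /andP[h1 h2] := il r; have /andP[h3 h4] := il r.+1; lia.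
have supp' r : M <= r -> mu r = 0.
  by move=> h; have /andP[_] := il r; rewrite supp // leqn0 => /eqP.
have tot' : partial_sum mu M = psum k n.
  rewrite MUE /MU LS supp // addn0 /L tot psumS addnK.
  by apply/minn_idPr; exact: leq_addr.
have [|u [yu su shu cu]] := IH mu dec' supp' tot'.
  move=> A uA Am; rewrite MUE leq_min; apply/andP; split.
    apply: dom => //; apply/allP => a aA; apply: ltnW; exact: (allP Am).
  rewrite leq_subRL; last by have := L1 (size A); lia.
  have := dom (n :: A); rewrite /= uA andbT; apply.
    by apply/negP => nA; have := allP Am n nA; rewrite ltnn.
  by rewrite ltnSn; apply/allP => a aA; apply: ltnW; exact: (allP Am).
pose w := u ++ strip M la mu.
have shw : shape w = la by exact: count_cat_strip.
have yw : yam w by apply: yam_cat_interlaced yu shw _; rewrite shu.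
have sw : size w = psum k n.+1 by rewrite -tot -shw partial_sum_shape // shw.
exists w; split=> //; apply/(canonical_cat su sw); split=> // i j ui ij jw.
apply: strip_col => // r r' /subnKC <-.
by elim: (r' - r) => [|d IHd]; rewrite ?addn0 // addnS; exact: leq_trans (dec _) IHd.
Qed.

(** Induction on the decreasing list: its head is either one of the chosen parts
    or at least as large as any of them. *)
Lemma sumn_take_sorted (s A : seq nat) : sorted geq (map k s) -> uniq A ->
  {subset A <= s} -> sumn (map k A) <= sumn (map k (take (size A) s)).
Proof.
elim: s A => [|x s IH] A srt uA sub.
  by case: A uA sub => // a A _ /(_ a); rewrite mem_head => /(_ isT).
have srt' : sorted geq (map k s) by exact: path_sorted srt.
case: (boolP (x \in A)) => xA.
  have pA := perm_to_rem xA; rewrite (perm_sumn (perm_map k pA)) (perm_size pA) /=.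
  rewrite leq_add2l; apply: IH => //; first exact: rem_uniq.
  move=> a; rewrite mem_rem_uniq // inE => /andP[ax aA].
  by have := sub a aA; rewrite inE (negPf ax).
have sub' : {subset A <= s}.
  move=> a aA; have := sub a aA; rewrite inE => /orP[/eqP e|//].
  by rewrite -e aA in xA.
apply: leq_trans (IH A srt' uA sub') _.
case: (size A) => [|c] //=; first by rewrite !take0.
case: (ltnP c (size s)) => h; last by rewrite !take_oversize ?leq_addl // leqW.
rewrite (take_nth 0) // map_rcons sumn_rcons addnC leq_add2r.
have tr : transitive geq by move=> a b d /= h1 h2; exact: leq_trans h2 h1.
have /allP := order_path_min tr srt; apply.
by apply/map_f/mem_nth.
Qed.

Lemma dominates_compP n (L : seq nat) :
  dominates_comp n (fun r => nth 0 L r) <-> dominates L (kord k n).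
Proof.
pose s := sort (relpre k geq) (iota 0 n).
have ks : kord k n = map k s by rewrite /kord /mkseq sort_map.
have us : uniq s by rewrite sort_uniq iota_uniq.
have ms a : (a \in s) = (a < n) by rewrite mem_sort mem_iota.
have LE i : partial_sum (fun r => nth 0 L r) i = sumn (take i L).
  elim: i => [|i IHi]; first by rewrite take0 /partial_sum big_ord0.
  rewrite partial_sumS IHi; case: (ltnP i (size L)) => h.
    by rewrite (take_nth 0) // sumn_rcons.
  by rewrite !take_oversize ?nth_default ?addn0 // leqW.
have srt : sorted geq (map k s).
  by rewrite -ks; apply: sort_sorted => x y; exact: leq_total.
split=> [D|/asboolP D A uA Am].
  apply/asboolP => i; rewrite ks -map_take -LE.
  apply: leq_trans (D (take i s) (take_uniq _ us) _) _.
    by apply/allP => a /mem_take; rewrite ms.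
  by apply: partial_sum_le; rewrite size_take_min geq_minl.
rewrite LE; apply: leq_trans (D (size A)); rewrite ks -map_take.
apply: sumn_take_sorted => // a aA; rewrite ms; exact: (allP Am).
Qed.

End Strips.

Section Kostka.
Variables (k : nat -> nat) (n : nat) (la : part (psum k n)).

Lemma prowE : prow la = fun r => nth 0%N (parts la) r.
Proof. by []. Qed.

Lemma partial_sum_prow : partial_sum (prow la) (psum k n) = psum k n.
Proof. exact: sum_prow. Qed.

(** Equivalently, a Kostka number is nonzero exactly when the shape dominates the
    sorted weight. *)
Lemma inS_canonical : inS la <-> exists t : STab la, canonical k n (rw t).
Proof.
have H := dominates_compP k n (parts la); rewrite -prowE in H.
split=> [/H D|[t ct]].
  have [w [yw sw shw cw]] :=
    canonical_of_dominates (@prow_noninc _ la) (@prow_out _ la) partial_sum_prow D.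
  have [|t et] := @rw_onto _ la w; last by exists t; rewrite et.
  by split=> // r; rewrite -shw.
apply: H.1; have := dominates_of_canonical (yam_rw t) (size_rw t) ct.
suff -> : shape (rw t) = prow la by [].
by apply/funext => r; exact: count_rw.
Qed.

End Kostka.

(** * Corners of split semisimple algebras *)

Section Corners.
Variables (F : fieldType) (A : algType F) (I : eqType) (V : I -> vectType F).
Variables (r : seq I) (r_uniq : uniq r) (r_mem : forall i, i \in r).
Variables (rho : forall i, A -> V i -> V i) (e : A).
Arguments rho : clear implicits.
Hypothesis rho_linear : forall i x, linear (rho i x).
Arguments rho_linear : clear implicits.
Hypothesis rho_linearl : forall i a x y v, rho i (a *: x + y) v = a *: rho i x v + rho i y v.
Hypothesis rhoM : forall i x y v, rho i (x * y) v = rho i x (rho i y v).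
Hypothesis rank_one : forall i (u : V i) (xi : 'Hom(V i, F^o)), exists x,
  (forall v, rho i x v = xi v *: u) /\ (forall j v, j != i -> rho j x v = 0).
Hypothesis faithful : forall x, (forall i v, rho i x v = 0) -> x = 0.
Hypothesis e_idem : e * e = e.
Variable W : forall i, {vspace V i}.
Hypothesis W_mem : forall i v, (v \in W i) = (rho i e v == v).

Definition corner_act (i : I) (x : A) (w : subvs_of (W i)) : subvs_of (W i) :=
  vsproj (W i) (rho i x (vsval w)).

Let rho0 i x : rho i x 0 = 0.
Proof.
by have := rho_linear i x 1 0 0; rewrite scaler0 addr0 scale1r
  -{1}[rho i x 0]addr0 => /addrI.
Qed.

Let rhoZ i x a v : rho i x (a *: v) = a *: rho i x v.
Proof. by have := rho_linear i x a v 0; rewrite rho0 !addr0. Qed.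

Let rhoD i x u v : rho i x (u + v) = rho i x u + rho i x v.
Proof. by have := rho_linear i x 1 u v; rewrite !scale1r. Qed.

Let rho_sum i x (T : Type) (s : seq T) (f : T -> V i) :
  rho i x (\sum_(t <- s) f t) = \sum_(t <- s) rho i x (f t).
Proof. exact: (big_morph (rho i x) (rhoD x) (rho0 i x)). Qed.

Let rhoDl i x y v : rho i (x + y) v = rho i x v + rho i y v.
Proof. by have := rho_linearl 1 x y v; rewrite !scale1r. Qed.

Let rho0l i v : rho i 0 v = 0.
Proof. by have := rhoDl 0 0 v; rewrite addr0 -{1}[rho i 0 v]addr0 => /addrI. Qed.

Let rho_suml i (T : Type) (s : seq T) (f : T -> A) v :
  rho i (\sum_(t <- s) f t) v = \sum_(t <- s) rho i (f t) v.
Proof. exact: (big_morph (fun x => rho i x v) (fun x y => rhoDl x y v) (rho0l v)). Qed.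

Let faithful_eq x y : (forall i v, rho i x v = rho i y v) -> x = y.
Proof.
move=> h; apply/eqP; rewrite -subr_eq0; apply/eqP/faithful => i v.
by rewrite -scaleN1r addrC rho_linearl h scaleN1r addNr.
Qed.

Let rhoL i x : 'End(V i) := linfun (HB.pack_for {linear V i -> V i} (rho i x)
  (GRing.isLinear.Build F (V i) (V i) *:%R (rho i x) (rho_linear i x))).

Let rhoLE i x v : rhoL i x v = rho i x v.
Proof. by rewrite lfunE. Qed.

Definition rank_one_elt i u xi : A := projT1 (cid (@rank_one i u xi)).

Lemma rank_one_elt_same i u xi v : rho i (@rank_one_elt i u xi) v = xi v *: u.
Proof. by rewrite /rank_one_elt; case: cid => x [h _] /=. Qed.

Lemma rank_one_elt_other i u xi j v : j != i -> rho j (@rank_one_elt i u xi) v = 0.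
Proof. by rewrite /rank_one_elt; case: cid => x [_ h] /=; exact: h. Qed.

Lemma rank_one_elt_mul i u xi y :
  y * @rank_one_elt i u xi = rank_one_elt (rho i y u) xi.
Proof.
apply: faithful_eq => j v; rewrite rhoM; have [ij|ij] := eqVneq i j.
  by subst j; rewrite !rank_one_elt_same rhoZ.
by rewrite !rank_one_elt_other 1?eq_sym.
Qed.

Lemma rank_one_elt_linear i a u u' xi : rank_one_elt (a *: u + u') xi =
  a *: @rank_one_elt i u xi + rank_one_elt u' xi.
Proof.
apply: faithful_eq => j v; rewrite rho_linearl; have [ij|ij] := eqVneq i j.
  by subst j; rewrite !rank_one_elt_same scalerDr !scalerA mulrC.
by rewrite !rank_one_elt_other 1?eq_sym // scaler0 addr0.
Qed.

(** Composition with [e] is what brings the rank one elements into the corner. *)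
Definition corner_form i (xi : 'Hom(V i, F^o)) : 'Hom(V i, F^o) := (xi \o rhoL i e)%VF.

Lemma corner_formE i xi v : @corner_form i xi v = xi (rho i e v).
Proof. by rewrite comp_lfunE rhoLE. Qed.

Lemma corner_rank_one i u xi : u \in W i -> corner e (rank_one_elt u (corner_form xi)).
Proof.
rewrite W_mem => /eqP eu; exists (rank_one_elt u (corner_form xi)).
rewrite rank_one_elt_mul eu; apply: faithful_eq => j v; rewrite rhoM.
have [ij|ij] := eqVneq i j; last by rewrite !rank_one_elt_other 1?eq_sym.
by subst j; rewrite !rank_one_elt_same !corner_formE -rhoM e_idem.
Qed.

Lemma corner_mull x : corner e x -> e * x = x.
Proof. by case=> y ->; rewrite !mulrA e_idem. Qed.

Lemma corner_add x y : corner e x -> corner e y -> corner e (x + y).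
Proof. by case=> a -> [b ->]; exists (a + b); rewrite mulrDr mulrDl. Qed.

Lemma corner0 : corner e (0 : A).
Proof. by exists 0; rewrite mulr0 mul0r. Qed.

Lemma corner_e : corner e e.
Proof. by exists 1; rewrite mulr1 e_idem. Qed.

Lemma corner_actE i x w : corner e x -> vsval (@corner_act i x w) = rho i x (vsval w).
Proof. by move=> cx; rewrite vsprojK // W_mem -rhoM corner_mull. Qed.

Lemma subvs_eq i (u v : subvs_of (W i)) : vsval u = vsval v -> u = v.
Proof. exact: val_inj. Qed.

Lemma corner_act_rep i : is_rep e (@corner_act i).
Proof.
split=> [x cx a u v|a x y v cx cy|x y v cx cy|v]; apply: subvs_eq.
- by rewrite /= /corner_act !linearP /= rho_linear linearP.
- by rewrite /= /corner_act rho_linearl linearP.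
- rewrite !corner_actE ?rhoM //.
  by case: cx => a ->; case: cy => b ->; exists (a * e * e * b); rewrite !mulrA.
- rewrite corner_actE; last exact: corner_e.
  by apply/eqP; rewrite -W_mem subvsP.
Qed.

Let coord_linear i (t : 'I_(\dim {: V i})) :
  linear (fun v : V i => coord (vbasis {: V i}) t v : F^o).
Proof. by move=> a u v; rewrite linearP. Qed.

Definition coord_form i (t : 'I_(\dim {: V i})) : 'Hom(V i, F^o) :=
  linfun (HB.pack_for {linear V i -> F^o}
    (fun v : V i => coord (vbasis {: V i}) t v : F^o)
    (GRing.isLinear.Build F (V i) F^o *:%R
       (fun v : V i => coord (vbasis {: V i}) t v : F^o) (coord_linear t))).

Lemma coord_formE i (t : 'I_(\dim {: V i})) v :
  coord_form t v = coord (vbasis {: V i}) t v.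
Proof. by rewrite lfunE. Qed.

Lemma exists_form i (v : V i) : v != 0 -> exists xi : 'Hom(V i, F^o), xi v = 1.
Proof.
move=> v0; have vE := coord_vbasis (memvf v).
have [t ct] : exists t, coord (vbasis fullv) t v != 0.
  apply: contrapT => h; case/eqP: v0; rewrite vE big1 // => t _.
  have [->|ct] := eqVneq (coord (vbasis fullv) t v) 0; first by rewrite scale0r.
  by case: h; exists t.
exists ((coord (vbasis fullv) t v)^-1 *: coord_form t).
by rewrite scale_lfunE coord_formE; exact: mulVf.
Qed.

Lemma corner_transitive i (w u : subvs_of (W i)) : w != 0 ->
  exists2 x, corner e x & corner_act x w = u /\
    forall j, j != i -> forall v : subvs_of (W j), corner_act x v = 0.
Proof.
move=> w0; have [|xi hxi] := @exists_form i (vsval w).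
  by apply: contra w0 => /eqP h; apply/eqP/subvs_eq.
have cx := corner_rank_one xi (subvsP u).
exists (rank_one_elt (vsval u) (corner_form xi)) => //; split=> [|j ji v].
  apply: subvs_eq; rewrite corner_actE // rank_one_elt_same corner_formE.
  by have /eqP -> : rho i e (vsval w) == vsval w; rewrite -?W_mem ?subvsP // hxi scale1r.
by apply: subvs_eq; rewrite corner_actE // rank_one_elt_other.
Qed.

Lemma corner_act_irreducible i : (exists w : subvs_of (W i), w != 0) ->
  irreducible_rep e (@corner_act i).
Proof.
move=> W0; split=> //; first exact: corner_act_rep.
move=> S [S0 Slin Sact]; have [[w Sw w0]|h] := EM (exists2 w, S w & w != 0).
  right; apply/seteqP; split=> // u _.
  by have [x cx [<- _]] := corner_transitive u w0; exact: Sact.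
left; apply/seteqP; split=> [w Sw|w ->//]; apply/eqP; apply: contrapT => w0.
by apply: h; exists w => //; apply/negP.
Qed.

(** A rank one element attached to [i] acts as 0 on the other modules. *)
Lemma corner_act_iso i j : (exists w : subvs_of (W i), w != 0) ->
  iso_rep e (@corner_act i) (@corner_act j) -> i = j.
Proof.
move=> [w w0] [f [flin feq] /bij_inj finj]; apply/eqP; apply: contraT => ij.
have [x cx [xw xj]] := corner_transitive w w0.
have f0 : f 0 = 0.
  by have := flin 1 0 0; rewrite scaler0 addr0 scale1r -{1}[f 0]addr0 => /addrI.
case/eqP: w0; apply: finj; rewrite f0 -xw feq // xj //.
by rewrite eq_sym.
Qed.

(** Faithfulness turns the expansions of the vectors [e v] in a basis of each
    representation into an identity in the algebra. *)
Lemma corner_unit_sum : e = \sum_(i <- r) \sum_(t < \dim {: V i})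
  rank_one_elt (rho i e (vbasis {: V i})`_t) (corner_form (coord_form t)).
Proof.
apply: faithful_eq => i v; rewrite rho_suml (bigD1_seq i) //= [X in _ + X]big1 => [|j ji].
  rewrite addr0 -[in LHS]e_idem rhoM [in LHS](coord_vbasis (memvf (rho i e v))).
  rewrite rho_sum rho_suml; apply: eq_bigr => t _.
  by rewrite rank_one_elt_same corner_formE rhoZ coord_formE.
by rewrite rho_suml big1 // => t _; rewrite rank_one_elt_other // eq_sym.
Qed.

Section Completeness.
Variables (M : lmodType F) (actM : A -> M -> M).
Hypothesis M_irr : irreducible_rep e actM.

Let M_rep : is_rep e actM. Proof. by case: M_irr. Qed.

Let actMD x y v : corner e x -> corner e y -> actM (x + y) v = actM x v + actM y v.
Proof. by case: M_rep => _ h _ _ cx cy; have := h 1 x y v cx cy; rewrite !scale1r. Qed.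

Let actM0 v : actM 0 v = 0.
Proof. by have := actMD v corner0 corner0; rewrite addr0 -{1}[actM 0 v]addr0 => /addrI. Qed.

Lemma corner_nonzero_elt m : m != 0 -> exists i u xi,
  u \in W i /\ actM (@rank_one_elt i u (corner_form xi)) m != 0.
Proof.
move=> m0; apply: contrapT => h; case/eqP: m0.
have [_ _ _ eM] := M_rep; rewrite -[LHS]eM.
suff [] : corner e e /\ actM e m = 0 by [].
rewrite {2 3}corner_unit_sum.
apply: (big_ind (fun x => corner e x /\ actM x m = 0)).
- by split; [exact: corner0 | exact: actM0].
- by move=> x y [cx x0] [cy y0]; rewrite actMD // x0 y0 addr0; split=> //; exact: corner_add.
move=> i _; apply: (big_ind (fun x => corner e x /\ actM x m = 0)).
- by split; [exact: corner0 | exact: actM0].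
- by move=> x y [cx x0] [cy y0]; rewrite actMD // x0 y0 addr0; split=> //; exact: corner_add.
move=> t _; set u := rho i e _; set xi := coord_form t.
have uW : u \in W i by rewrite W_mem -rhoM e_idem.
split; first exact: corner_rank_one.
apply/eqP; apply: contrapT => /negP nz; apply: h.
by exists i, u, xi.
Qed.

(** By [corner_nonzero_elt], some rank one elements of the corner, with a fixed
    functional, give a nonzero equivariant map from the image of [e] in [V i] to
    [M]; both modules being irreducible, it is bijective. *)
Lemma corner_complete : exists i,
  (exists w : subvs_of (W i), w != 0) /\ iso_rep e actM (@corner_act i).
Proof.
have [_ [m m0] Mirr] := M_irr; have [i [u [xi [uW nz]]]] := corner_nonzero_elt m0.
pose X (w : subvs_of (W i)) := rank_one_elt (vsval w) (corner_form xi).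
have cX w : corner e (X w) by apply: corner_rank_one; exact: subvsP.
pose phi w := actM (X w) m.
have [Mlin Mlinl MM _] := M_rep.
have philin : linear phi.
  move=> a w w'; rewrite /phi -Mlinl //; congr (actM _ m).
  by rewrite /X linearP rank_one_elt_linear.
have phieq x w : corner e x -> phi (corner_act x w) = actM x (phi w).
  move=> cx; rewrite /phi -MM //; congr (actM _ m).
  by rewrite /X corner_actE // -rank_one_elt_mul.
pose u' : subvs_of (W i) := vsproj (W i) u.
have phiu : phi u' != 0 by rewrite /phi /X vsprojK.
have phi0 : phi 0 = 0.
  by have := philin 1 0 0; rewrite scaler0 addr0 scale1r -{1}[phi 0]addr0 => /addrI.
have u0 : u' != 0 by apply: contraNneq phiu => ->; rewrite phi0.
have W0 : exists w : subvs_of (W i), w != 0 by exists u'.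
have [_ _ Wirr] := corner_act_irreducible W0.
have ker : [set w | phi w = 0]%classic = [set 0]%classic.
  have [|//|h] := Wirr [set w | phi w = 0]%classic.
    split=> [|a w w' /= hw hw'|x w cx /= hw] /=; first exact: phi0.
      by rewrite philin hw hw' scaler0 addr0.
    rewrite phieq // hw; have := Mlin x cx 1 0 0.
    by rewrite scaler0 addr0 scale1r -{1}[actM x 0]addr0 => /addrI.
  have : [set w | phi w = 0]%classic u' by rewrite h.
  by move/eqP: phiu.
have img : [set phi w | w in setT]%classic = setT.
  have [|h|//] := Mirr [set phi w | w in setT]%classic.
    split; first by exists 0.
      by move=> a _ _ [w _ <-] [w' _ <-]; exists (a *: w + w') => //; exact: philin.
    by move=> x _ cx [w _ <-]; exists (corner_act x w) => //; exact: phieq.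
  have : [set phi w | w in setT]%classic (phi u') by exists u'.
  by rewrite h => /= /eqP; rewrite (negPf phiu).
have inj : injective phi.
  move=> w w' h; apply/eqP; rewrite -subr_eq0; apply/eqP.
  have : [set w | phi w = 0]%classic (w - w').
    by rewrite /= addrC -scaleN1r philin h scaleN1r addNr.
  by rewrite ker.
have sur y : exists w, phi w = y.
  have : [set phi w | w in setT]%classic y by rewrite img.
  by case=> w _ <-; exists w.
have [psi psiK] := boolp.choice sur.
have phiK : cancel phi psi by move=> w; apply: inj; rewrite psiK.
exists i; split=> //; exists psi; last by exists phi.
split=> [a y y'|x y cx]; apply: inj; rewrite ?philin ?phieq ?psiK //.
Qed.

End Completeness.

Lemma corner_complete_irreps (J : Type) (nu : J -> I) : injective nu ->
  (forall i, (exists w : subvs_of (W i), w != 0) <-> exists j, nu j = i) ->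
  complete_irreps e (fun j => @corner_act (nu j)).
Proof.
move=> nu_inj nuP; split=> [j|i j h|M actM h].
- by apply: corner_act_irreducible; apply/nuP; exists j.
- by apply: nu_inj; apply: corner_act_iso h; apply/nuP; exists i.
have [i [/nuP[j <-] h']] := corner_complete h.
by exists j.
Qed.

End Corners.

(** * Branching *)

Section RankOne.
Variables (F : fieldType) (q : F) (m : nat).
Hypothesis q_neq0 : q != 0.
Hypothesis qint_neq0 : forall L : int, L != 0 -> qint q L != 0.

Lemma part_eq (la mu : part m) : prow la =1 prow mu -> la = mu.
Proof.
move=> h; apply/val_inj/val_inj/(inj_map val_inj).
apply: (@eq_from_nth _ 0%N); first by rewrite !size_map !size_tuple.
by move=> r _; exact: h.
Qed.

Lemma vtab_sum (la : part m) (v : Vmod F la) : v = \sum_t v t *: vtab F (val t).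
Proof.
apply/ffunP => t; rewrite sum_ffunE (bigD1 t) //= big1 => [|t' tt'].
  by rewrite !ffunE eqxx addr0; exact/esym/mulr1.
by rewrite !ffunE (inj_eq val_inj) eq_sym (negPf tt'); exact: mulr0.
Qed.

Lemma wcoef_sum (la : part m) (I : finType) (f : I -> Vmod F la) w :
  wcoef (\sum_i f i) w = \sum_i wcoef (f i) w.
Proof.
by apply: (big_morph (fun u => wcoef u w)) => [u u'|]; rewrite ?wcoefD ?wcoef0.
Qed.

Lemma hecke_rank_one (la : part m) (u : Vmod F la) (xi : 'Hom(Vmod F la, F^o)) :
  exists x : hecke q m, (forall v : Vmod F la, Vrep x v = xi v *: u) /\
    (forall (mu : part m) (v : Vmod F mu), mu != la -> Vrep x v = 0).
Proof.
pose c (s t : STab la) : F := u s * xi (vtab F (val t)).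
pose x := \sum_s \sum_t c s t *: mx_unit q m (rw s) (rw t).
have xE mu (v : Vmod F mu) (s0 : STab mu) : Vrep x v s0 =
    \sum_s \sum_t c s t * ((rw s0 == rw s)%:R * wcoef v (rw t)).
  rewrite -wcoef_rw Vrep_sum // wcoef_sum; apply: eq_bigr => s _.
  rewrite Vrep_sum // wcoef_sum; apply: eq_bigr => t _; rewrite VrepZ // wcoefZ.
  rewrite mx_unitP ?yam_rw ?size_rw //; apply/shape_eqP/funext => r.
  by rewrite /shape !count_rw.
exists x; split=> [v|mu v ne]; apply/ffunP => s0; rewrite xE.
  rewrite (bigD1 s0) //= [X in _ + X]big1 ?addr0 => [|s ss]; last first.
    rewrite big1 // => t _; rewrite (inj_eq (@rw_inj _ _)) eq_sym (negPf ss).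
    by rewrite mul0r mulr0.
  have -> : (xi v *: u) s0 = xi v * u s0 by rewrite ffunE.
  have -> : xi v = \sum_t v t * xi (vtab F (val t)).
    by rewrite {1}(vtab_sum v) linear_sum; apply: eq_bigr => t _; rewrite linearZ.
  rewrite mulr_suml; apply: eq_bigr => t _; rewrite eqxx mul1r wcoef_rw /c.
  by ring.
rewrite ffunE big1 // => s _; rewrite big1 // => t _.
case: eqP => [e|_]; last by rewrite mul0r mulr0.
by case/eqP: ne; apply: part_eq => r; rewrite -(count_rw s0) e count_rw.
Qed.

End RankOne.

Section HorizontalStrips.

Lemma horiz_stripP m m' (la : part m) (mu : part m') :
  horiz_strip la mu <-> interlaced (prow la) (prow mu).
Proof.
split=> [/andP[/asboolP sub /forallP cl] r|il].
  rewrite sub andbT leqNgt; apply/negP => h.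
  have ym : (prow mu r < m)%N by exact: leq_trans h (prow_bound la r.+1).
  have rm : (r.+1 < m)%N.
    by rewrite ltnNge; apply/negP => /(prow_out la) e; rewrite e in h.
  have /card_le1_eqP := cl (Ordinal ym) => /(_ (Ordinal (ltnW rm)) (Ordinal rm)).
  rewrite !inE /= leqnn (leq_trans h (prow_noninc la r)) h andbT prow_noninc.
  by move=> /(_ isT isT) /(congr1 val) /= /eqP; rewrite gtn_eqF.
apply/andP; split; first by apply/asboolP => r; have /andP[] := il r.
apply/forallP => y; apply/card_le1_eqP => x x'; rewrite !inE => /andP[h1 h2] /andP[h3 h4].
have key (a b : nat) : (a < b)%N -> (prow mu a <= y)%N -> (y < prow la b)%N -> False.
  move=> ab ha hb; have /andP[h _] := il a; have := prow_le la ab.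
  by move: (leq_trans h ha) => h5 h6; have := leq_trans hb (leq_trans h6 h5); rewrite ltnn.
apply/val_inj; case: (ltngtP x x') => // h; exfalso.
- exact: key h h1 h4.
- exact: key h h3 h2.
Qed.

End HorizontalStrips.

Section Branching.
Variables (F : fieldType) (q : F).
Hypothesis q_neq0 : q != 0.
Hypothesis qint_neq0 : forall L : int, L != 0 -> qint q L != 0.
Variables (k : nat -> nat) (n : nat) (la : part (psum k n.+1)).

Local Notation m := (psum k n.+1).
Local Notation m' := (psum k n).

Lemma psum_leS : (m' <= m)%N.
Proof. by rewrite psumS leq_addr. Qed.

Lemma psum_le0 : (0 + m' <= m)%N.
Proof. exact: psum_leS. Qed.

Definition strip_of (mu : part m') : seq nat := strip m (prow la) (prow mu).

(** The coefficients on the tableaux that extend one of shape [mu] by the strip in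
    its canonical filling. *)
Definition restr (mu : part m') (v : Vmod F la) : Vmod F mu :=
  [ffun t' => wcoef v (rw t' ++ strip_of mu)].

Section OneShape.
Variable mu : part m'.
Hypothesis il : interlaced (prow la) (prow mu).

Lemma shape_shaped M (nu : part M) w : shaped nu w -> shape w = prow nu.
Proof. by case=> _ _ h; apply/funext. Qed.

Lemma shaped_cat_strip w : shaped mu w -> shaped la (w ++ strip_of mu).
Proof.
move=> sw; have shw := shape_shaped sw; case: sw => yw sw _.
have sh : shape (w ++ strip_of mu) = prow la.
  by apply: count_cat_strip => // r; exact: prow_out.
split; last by move=> r; rewrite -sh.
  by apply: (yam_cat_interlaced yw sh); rewrite shw.
rewrite -(partial_sum_shape (M := m)) sh; first exact: sum_prow.
by move=> r; exact: prow_out.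
Qed.

Lemma canonical_cat_strip w : shaped mu w -> canonical k n w ->
  canonical k n.+1 (w ++ strip_of mu).
Proof.
move=> sw cw; have [_ sz _] := shaped_cat_strip sw; have [_ szw _] := sw.
apply/(canonical_cat szw sz); split=> // i j; apply: strip_col.
- exact: shape_shaped (shaped_cat_strip sw).
- exact: shape_shaped sw.
- by move=> r r'; exact: prow_le.
- exact: il.
Qed.

Lemma wcoef_restr v w : shaped mu w -> wcoef (restr mu v) w = wcoef v (w ++ strip_of mu).
Proof. by case/rw_onto => t <-; rewrite wcoef_rw ffunE. Qed.

Lemma restr_linear : linear (restr mu).
Proof.
by move=> a u v; apply/ffunP => t; rewrite !ffunE wcoef_linear.
Qed.

(** The first generators do not see the strip. *)
Lemma restr_gen i v : (i.+1 < m')%N ->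
  restr mu (Vrep (hgen_nat q m i) v) = Vrep (hgen_nat q m' i) (restr mu v).
Proof.
move=> im'; have im : (i.+1 < m)%N by exact: leq_trans im' psum_leS.
apply/ffunP => t; rewrite ffunE -[RHS]wcoef_rw !wcoef_gen //.
have sh := shaped_rw t; have [yw sw _] := shaped_cat_strip sh.
have iw : (i.+1 < size (rw t))%N by rewrite size_rw.
rewrite /opw yw sw yam_rw size_rw !eqxx /=.
have cE j : (j < m')%N -> cont (rw t ++ strip_of mu) j = cont (rw t) j.
  by move=> jm; rewrite /cont nth_cat size_rw jm takel_cat // size_rw ltnW.
rewrite !cE ?(ltnW im') // wcoef_restr //; congr (_ + _).
have -> : swp i (rw t ++ strip_of mu) = swp i (rw t) ++ strip_of mu.
  by have [a [b [c [z [-> <-]]]]] := split2P iw; rewrite -catA !swp_cat -catA.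
have [->|u0] := eqVneq (ucoef q (cont (rw t) i.+1 - cont (rw t) i)) 0.
  by rewrite !mul0r.
rewrite wcoef_restr //; have [_ sz ct] := sh; split; last first.
- by move=> r; rewrite -ct; exact: (seq.permP (perm_swp iw)).
- by rewrite size_swp.
have yr := yam_rw t; move: u0; have [a [b [c [z [Ew ia]]]]] := split2P iw.
rewrite Ew -ia in yr *; rewrite swp_cat cont_cat cont_cat1 => u0.
by have [h|[]] := ucoef_swap q yr; first by rewrite h eqxx in u0.
Qed.

Lemma restr_shift (y : hecke q m') v : restr mu (Vrep (hshift m 0 y) v) = Vrep y (restr mu v).
Proof.
elim/hecke_ind: y v => [a|i|x y hx hy|x y hx hy] v.
- rewrite hshiftZ ?psum_le0 // hshift1 ?psum_le0 // !VrepZ // !Vrep1 //.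
  have r0 : restr mu 0 = 0 by apply/ffunP => t; rewrite !ffunE wcoef0.
  by have := restr_linear a v 0; rewrite r0 !addr0.
- rewrite hshift_gen ?psum_le0 // restr_gen ?add0n; last by rewrite -ltn_predRL.
  by rewrite (hgen_natE q (ltn_ord i)); congr (Vrep (hgen q _) _); exact: val_inj.
- rewrite hshiftD ?psum_le0 // !VrepD // -hx -hy.
  by have := restr_linear 1; move=> h; rewrite -[X in X + _]scale1r h scale1r.
- by rewrite hshiftM ?psum_le0 // !VrepM // hx hy.
Qed.

Lemma restr_Wsp v : v \in Wsp q la -> restr mu v \in Wsp q mu.
Proof.
rewrite !mem_Wsp // => /eqP /(fidem_fixP q_neq0 qint_neq0) h.
apply/eqP/(fidem_fixP q_neq0 qint_neq0) => i ib.
rewrite -restr_gen ?(inblock_lt ib) // h; last by rewrite inblockS ib.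
have r0 : restr mu 0 = 0 by apply/ffunP => t; rewrite !ffunE wcoef0.
by have := restr_linear q v 0; rewrite r0 !addr0.
Qed.

End OneShape.

(** Elements of the smaller corner preserve the image of the larger idempotent:
    they absorb the symmetrisers of the first blocks and commute with the last
    one. *)
Lemma fincl_act (y : hecke q m') (v : Vmod F la) : corner (fidem q k n) y ->
  v \in Wsp q la -> Vrep (fincl k n n.+1 y) v = Vrep (hshift m 0 y) v.
Proof.
move=> cy; rewrite mem_Wsp // => /eqP ev.
rewrite /fincl !VrepM // ev; apply: fidem_fix => // i.
have fix_v := (fidem_fixP q_neq0 qint_neq0 v).1 ev.
rewrite inblockS => /orP[ib|/andP[h1 h2]].
  have im := inblock_lt ib; rewrite -ltn_predRL in im.
  rewrite -VrepM //; have := hshift_gen q psum_le0 (Ordinal im); rewrite add0n => <-.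
  rewrite -hshiftM ?psum_le0 // -[hgen q _](hgen_natE q im).
  have ey := corner_mull (fidem_idem q_neq0 qint_neq0 k n) cy.
  by rewrite -[in LHS]ey mulrA fidem_gen // -scalerAl ey hshiftZ ?psum_le0 // VrepZ.
rewrite -VrepM // hshift_comm ?psum_le0 // => [|j].
  by rewrite VrepM // fix_v ?VrepS // inblockS h1 h2 orbT.
have jm := ltn_ord j; apply: hgen_nat_comm; have := psum_leS; lia.
Qed.

(** The end of the word coincides with the strip, because a canonical word is
    determined by its shapes at the ends of the blocks. *)
Lemma canonical_decompose (t : STab la) : canonical k n.+1 (rw t) ->
  exists (mu : Resk n la) (t' : STab (val mu)),
    canonical k n (rw t') /\ rw t = rw t' ++ strip_of (val mu).
Proof.
move=> ct; pose u := take m' (rw t); pose s := drop m' (rw t).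
have Ew : rw t = u ++ s by rewrite cat_take_drop.
have yw := yam_rw t; have sw := size_rw t.
have su : size u = m' by rewrite size_takel // size_rw psum_leS.
have yu : yam u by exact: yam_take.
have [mu shu] := part_of_word yu su; have [t' et'] := rw_onto shu.
rewrite Ew in ct yw sw; have [cu cs] := (canonical_cat su sw).1 ct.
have shw : shape (u ++ s) = prow la by rewrite -Ew; exact: shape_shaped (shaped_rw t).
have il : interlaced (prow la) (prow mu).
  by rewrite -shw -(shape_shaped shu); exact: interlaced_of_col.
have inSmu : inS mu && horiz_strip la mu.
  apply/andP; split; last exact/horiz_stripP.
  by apply/inS_canonical; exists t'; rewrite et'.
exists (exist (fun mu => inS mu && horiz_strip la mu) mu inSmu), t'.
rewrite et' Ew /=; split=> //.
have [yw2 sw2 _] := shaped_cat_strip il shu.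
have cw2 := canonical_cat_strip il shu cu.
have cs2 := ((canonical_cat su sw2).1 cw2).2.
apply: (@colsort_uniq m (inblock k n.+1)) => //.
- by move=> i _ /ct /ltnW.
- by move=> i _ /cw2 /ltnW.
move=> p p1 /(boundary p1)[a]; rewrite leq_eqVlt => /orP[/eqP -> ->|an ->].
  rewrite !take_oversize ?sw ?sw2 //; apply/shape_eqP.
  by rewrite shw; apply/esym; exact: shape_shaped (shaped_cat_strip il shu).
have am : (psum k a <= size u)%N by rewrite su psum_mono.
by rewrite !takel_cat.
Qed.

Definition restrW (mu : Resk n la) (w : Wmod q la) : Wmod q (val mu) :=
  vsproj (Wsp q (val mu)) (restr (val mu) (vsval w)).

Let Resk_il (mu : Resk n la) : interlaced (prow la) (prow (val mu)).
Proof. by case/andP: (valP mu) => _ /horiz_stripP. Qed.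

Lemma restrWE mu w : vsval (restrW mu w) = restr (val mu) (vsval w).
Proof. by rewrite vsprojK // restr_Wsp // subvsP. Qed.

Lemma restrW_equivariant mu :
  equivariant (fidem q k n) (fun y => @Wact _ q k n.+1 la (fincl k n n.+1 y))
    (@Wact _ q k n (val mu)) (restrW mu).
Proof.
split=> [a w w'|y w cy].
  by apply: val_inj; rewrite /= /restrW !linearP /= restr_linear linearP.
rewrite /restrW /Wact fincl_act ?subvsP //.
have yW : Vrep (hshift m 0 y) (vsval w) \in Wsp q la.
  rewrite -fincl_act ?subvsP // mem_Wsp // /fincl -mulrA VrepM //.
  by rewrite fidem_idem_act.
by rewrite vsprojK // restr_shift // vsprojK // restr_Wsp // subvsP.
Qed.

Lemma restrW_injective w w' : (forall mu, restrW mu w = restrW mu w') -> w = w'.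
Proof.
move=> h; apply: val_inj; apply/eqP; rewrite -subr_eq0; apply/eqP.
apply: (Wsp_determined q_neq0 qint_neq0); first by rewrite rpredB ?subvsP.
move=> t /canonical_decompose[mu [t' [_ et]]].
have := congr1 (fun z : subvs_of (Wsp q (val mu)) => (vsval z : Vmod F (val mu)) t') (h mu).
rewrite !restrWE !ffunE -et !wcoef_rw => ->.
by rewrite subrr.
Qed.

(** The coefficients prescribed on the canonical tableaux are those of the given
    family, at most one member of which has the shape of a given prefix. *)
Lemma restrW_surjective (f : forall mu : Resk n la, Wmod q (val mu)) :
  exists w, forall mu, restrW mu w = f mu.
Proof.
pose phi (t : STab la) : F :=
  \sum_(mu : Resk n la) wcoef (vsval (f mu)) (take m' (rw t)).
have [v vW vt] := Wsp_extend q_neq0 qint_neq0 phi.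
exists (vsproj (Wsp q la) v) => mu; apply: val_inj.
apply/eqP; rewrite -subr_eq0; apply/eqP.
apply: (Wsp_determined q_neq0 qint_neq0); first by rewrite rpredB ?subvsP.
move=> t' ct'; have sh := shaped_rw t'.
have shw := shaped_cat_strip (Resk_il mu) sh; have [t et] := rw_onto shw.
have -> : val (restrW mu (vsproj (Wsp q la) v)) = restr (val mu) v.
  by apply: etrans (restrWE mu _) _; rewrite vsprojK.
rewrite !ffunE -et wcoef_rw vt; last first.
  by rewrite et; apply: canonical_cat_strip.
rewrite /phi et take_size_cat ?size_rw // (bigD1 mu) //= wcoef_rw big1 ?addr0 ?subrr //.
move=> nu ne; apply: wcoef_out => sh'; case/eqP: ne; apply: val_inj; apply: part_eq => r.
by rewrite -(shape_shaped sh') (shape_shaped sh).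
Qed.

Lemma restriction_decomposes :
  iso_dsum (fidem q k n) (fun y => @Wact _ q k n.+1 la (fincl k n n.+1 y))
    (fun mu : Resk n la => @Wact _ q k n (val mu)).
Proof.
exists restrW; first exact: restrW_equivariant.
have [g gE] := boolp.choice restrW_surjective.
exists g => [w|f]; first by apply: restrW_injective => mu; exact: gE.
by apply: functional_extensionality_dep => mu; exact: gE.
Qed.

End Branching.

(** * The fused Hecke algebra *)

Section FusedHecke.
Variables (F : fieldType) (q : F).
Hypothesis q_neq0 : q != 0.
Hypothesis qint_neq0 : forall L : int, L != 0 -> qint q L != 0.
Variables (k : nat -> nat) (n : nat).

Lemma fused_complete_irreps :
  complete_irreps (fidem q k n) (fun la : Skn k n => @Wact _ q k n (val la)).
Proof.
apply: (@corner_complete_irreps F (hecke q (psum k n)) (part (psum k n))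
  (fun la => Vmod F la) (enum {: part (psum k n)}) (enum_uniq _) _
  (fun la => @Vrep F q _ la) (fidem q k n) _ _ _ _ _ _
  (fun la => Wsp q la) _ (Skn k n) val).
- by move=> la; rewrite mem_enum.
- by move=> la x; exact: Vrep_linear.
- by move=> la a x y v; exact: Vrep_linearl.
- by move=> la x y v; exact: VrepM.
- by move=> la u xi; exact: hecke_rank_one.
- by move=> x; exact: hecke_faithful.
- exact: fidem_idem.
- by move=> la v; exact: mem_Wsp.
- exact: val_inj.
move=> la; split=> [[w w0]|[[mu S] <-]].
  have /inS_canonical S : exists t : STab la, canonical k n (rw t).
    apply/(Wsp_neq0 q_neq0 qint_neq0); exists (vsval w); first exact: subvsP.
    by apply: contra w0 => /eqP h; apply/eqP/subvs_eq.
  by exists (exist (fun la => inS la) la S).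
have /(Wsp_neq0 q_neq0 qint_neq0)[v vW v0] := (inS_canonical mu).1 S.
exists (vsproj (Wsp q mu) v); apply: contra v0 => /eqP h.
by rewrite -(vsprojK vW) h.
Qed.

End FusedHecke.

(** The vanishing of [[L]_q] would make [q ^+ 2] a nontrivial root of unity, unless
    [q ^+ 2 = 1], where [[L]_q] is [L] up to sign. *)
Lemma qint_complex_neq0 (R : realType) (q : complex R) (L : int) : q != 0 ->
  (forall N : nat, (0 < N)%N -> (q ^+ 2) ^+ N = 1 -> q ^+ 2 = 1) ->
  L != 0 -> qint q L != 0.
Proof.
move=> q0 hq L0; rewrite /qint; case: ifPn => q2.
  by rewrite mulf_neq0 ?intr_eq0 // expfz_neq0.
have root N : (0 < N)%N -> (q ^+ 2) ^+ N != 1.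
  by move=> N0; apply: contra q2 => /eqP /(hq N N0) ->.
have pow (N : nat) : (0 < N)%N -> q ^ N%:Z - q ^ (- N%:Z) != 0.
  move=> N0; rewrite subr_eq0; apply: contra (root N N0) => /eqP e.
  rewrite -exprM mul2n -addnn exprD -[q ^+ N]/(q ^ N%:Z) {2}e -expfzDr //.
  by rewrite subrr expr0z.
have d : q - q^-1 != 0 by have := pow 1%N isT.
rewrite mulf_neq0 ?invr_eq0 //.
case: L L0 => N N0; first by apply: pow; rewrite lt0n.
by rewrite NegzE opprK -opprB oppr_eq0 pow.
Qed.

Theorem theorem6p5 (R : realType) (q : complex R) (hq0 : q != 0)
    (hq : forall N : nat, (0 < N)%N -> (q ^+ 2) ^+ N = 1 -> q ^+ 2 = 1)
    (k : nat -> nat) (n : nat) (hn : (1 <= n)%N) :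
  [/\ forall la : part (psum k n),
        Wsp q la = <<[seq wvec (complex R) T | T : SSTab la k n]>>%VS,
      complete_irreps (fidem q k n)
        (fun la : Skn k n => @Wact _ q k n (val la)),
      forall la : part (psum k n), \dim (Wsp q la) = #|{: SSTab la k n}|
    & forall la : Skn k n,
        iso_dsum (fidem q k n.-1)
          (fun y => @Wact _ q k n (val la) (fincl k n.-1 n y))
          (fun mu : Resk n.-1 (val la) => @Wact _ q k n.-1 (val mu))].
Proof.
have qint_neq0 (L : int) : L != 0 -> qint q L != 0 by exact: qint_complex_neq0.
split=> [la||la|].
- exact: Wsp_span.
- exact: fused_complete_irreps.
- exact: Wsp_dim.
case: n hn => // n' _ la; exact: restriction_decomposes.
Qed.
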